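(* Let $(M^4,g)$ be a closed Riemannian four-manifold. Then $$\inf_{w\in W^{2,2}(M)}F_P[w]=-\infty,\qquad \sup_{w\in W^{2,2}(M)}F_P[w]=+\infty,$$ and likewise $$\inf_{w\in W^{2,2}(M)}F_\tau[w]=-\infty,\qquad \sup_{w\in W^{2,2}(M)}F_\tau[w]=+\infty .$$
   Context: All geometric quantities are with respect to $g$: $dv$ is the volume form, $R$ the scalar curvature, $Ric$ the Ricci tensor, $W$ the Weyl tensor with $|W|^2=W_{ijkl}W^{ijkl}$, $\Delta$ the Laplace--Beltrami operator (non-positive spectrum), $\fint f\,dv=\frac{1}{Vol(M)}\int f\,dv$, and $$Q=\tfrac1{12}\left(-\Delta R+R^2-3|Ric|^2\right).$$ The Paneitz operator is $P=(-\Delta)^2+\delta\left(\tfrac23Rg-2Ric\right)\circ\nabla$, where $\delta$ is the negative divergence, so that $$\int wPw\,dv=\int\left[(\Delta w)^2+\tfrac23R|\nabla w|^2-2Ric(\nabla w,\nabla w)\right]dv .$$ Define $$I[w]=4\int w|W|^2dv-\Big(\int|W|^2dv\Big)\log\fint e^{4w}dv,$$ $$II[w]=\int wPw\,dv+4\int Qw\,dv-\Big(\int Q\,dv\Big)\log\fint e^{4w}dv,$$ $$III[w]=12\int(\Delta w+|\nabla w|^2)^2dv-4\int(w\Delta R+R|\nabla w|^2)\,dv .$$ The functional $F_P$ (log-determinant of the Paneitz operator) is $F_P=\gamma_1I+\gamma_2II+\gamma_3III$ with $(\gamma_1,\gamma_2,\gamma_3)=(-\tfrac14,-14,\tfrac83)$.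 The functional $F_\tau$ (Cheeger's half-torsion) is $F_\tau=\gamma_1I+\gamma_2II+\gamma_3III$ with $(\gamma_1,\gamma_2,\gamma_3)=(-13,-248,\tfrac{116}3)$. *)

(* Defs.v *)
From HB Require Import structures.
From mathcomp Require Import all_boot all_order all_algebra.
From mathcomp Require Import all_classical all_reals all_analysis.
Import Order.TTheory GRing.Theory Num.Theory.
Import numFieldNormedType.Exports.

Set Implicit Arguments.
Unset Strict Implicit.
Unset Printing Implicit Defensive.

Local Open Scope classical_set_scope.
Local Open Scope ring_scope.

Notation E4 R := 'rV[R]_4.

Definition pd (R : realType) (k : 'I_4) (f : E4 R -> R) : E4 R -> R :=
  fun x => 'D_(delta_mx 0 k) f x.

Definition ipd (R : realType) (s : seq 'I_4) (f : E4 R -> R) : E4 R -> R :=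
  foldr (@pd R) f s.

(* C^oo on the open set U: the iterated partial derivatives of every order
   exist and are continuous on U. *)
Definition smooth_on (R : realType) (U : set (E4 R)) (f : E4 R -> R) : Prop :=
  forall (s : seq 'I_4) (x : E4 R), U x ->
    {for x, continuous (ipd s f)} /\
    forall k : 'I_4, derivable (ipd s f) x (delta_mx 0 k).

(* The library has no Lebesgue measure on 'rV[R]_4: it is taken as the
   iterated product measure on R * R * R * R, and sets and functions on
   'rV[R]_4 are pulled back along the coordinate bijection [vec4]. *)
Definition vec4 (R : realType) (p : R * R * R * R) : E4 R :=
  \row_(k < 4) [:: p.1.1.1; p.1.1.2; p.1.2; p.2]`_k.

Definition leb4 (R : realType) :=
  (((@lebesgue_measure R \x @lebesgue_measure R)
     \x @lebesgue_measure R) \x @lebesgue_measure R)%E.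

Definition int4 (R : realType) (A : set (E4 R)) (f : E4 R -> R) : R :=
  \int[@leb4 R]_(p in @vec4 R @^-1` A) f (vec4 p).

Definition L2loc (R : realType) (U : set (E4 R)) (u : E4 R -> R) : Prop :=
  measurable_fun (@vec4 R @^-1` U) (u \o @vec4 R) /\
  forall K : set (E4 R), compact K -> K `<=` U ->
    (\int[@leb4 R]_(p in @vec4 R @^-1` K) (u (vec4 p) ^+ 2)%:E < +oo)%E.

Definition test_fun (R : realType) (U : set (E4 R)) (phi : E4 R -> R) : Prop :=
  smooth_on [set: E4 R] phi /\
  exists K : set (E4 R),
    [/\ compact K, K `<=` U & forall x, ~ K x -> phi x = 0].

Definition is_wpd (R : realType) (U : set (E4 R)) (k : 'I_4)
    (u v : E4 R -> R) : Prop :=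
  L2loc U v /\
  forall phi, test_fun U phi ->
    int4 U (fun x => u x * pd k phi x) = - int4 U (fun x => v x * phi x).

(* A representative of the weak partial derivative of u in L^2_loc(U); it is
   unique almost everywhere on U when it exists. *)
Definition wpd (R : realType) (U : set (E4 R)) (k : 'I_4)
    (u : E4 R -> R) : E4 R -> R :=
  xget (cst 0) [set v | is_wpd U k u v].

(* By compactness, finitely many charts suffice.  [parm i] is the inverse of
   the chart [chart i], and [met i x] is the matrix (g_ab) of the metric in the
   chart i; values of [chart i] outside [dom i], and of [parm i] and [met i]
   outside the image of the chart i, are irrelevant. *)
Record closed_riemannian4 (R : realType) (M : topologicalType) :=
  ClosedRiemannian4 {
  nchart : nat;
  dom : 'I_nchart -> set M;
  chart : 'I_nchart -> M -> E4 R;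
  parm : 'I_nchart -> E4 R -> M;
  met : 'I_nchart -> E4 R -> 'M[R]_4;
  M_nonempty : [set: M] !=set0;
  M_hausdorff : hausdorff_space M;
  M_compact : compact [set: M];
  dom_open : forall i, open (dom i);
  dom_cover : \bigcup_i dom i = [set: M];
  img_open : forall i, open (chart i @` dom i);
  chartK : forall i p, dom i p -> parm i (chart i p) = p;
  chart_cont : forall i p, dom i p -> {for p, continuous (chart i)};
  parm_cont : forall i x, (chart i @` dom i) x -> {for x, continuous (parm i)};
  trans_smooth : forall i j (c : 'I_4),
    smooth_on (chart i @` (dom i `&` dom j))
      (fun x => chart j (parm i x) 0 c);
  met_smooth : forall i (a b : 'I_4),
    smooth_on (chart i @` dom i) (fun x => met i x a b);
  met_sym : forall i x, (chart i @` dom i) x -> (met i x)^T = met i x;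
  met_pos : forall i x, (chart i @` dom i) x ->
    forall v : E4 R, v != 0 -> 0 < (v *m met i x *m v^T) 0 0;
  met_trans : forall i j x, (chart i @` (dom i `&` dom j)) x ->
    forall a b : 'I_4,
      met i x a b =
        \sum_(c < 4) \sum_(d < 4)
           pd a (fun y => chart j (parm i y) 0 c) x *
           pd b (fun y => chart j (parm i y) 0 d) x *
           met j (chart j (parm i x)) c d
}.

Section LocalGeometry.
Variables (R : realType) (G : E4 R -> 'M[R]_4).
Implicit Types (x : E4 R) (a b c d e : 'I_4).

Definition low a b : E4 R -> R := fun x => G x a b.
Definition upp a b : E4 R -> R := fun x => invmx (G x) a b.

(* [christoffel c a b] is Gamma^c_{ab}. *)
Definition christoffel c a b : E4 R -> R := fun x =>
  2^-1 * \sum_(d < 4) upp c d x *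
    (pd a (low b d) x + pd b (low a d) x - pd d (low a b) x).

(* [riem d c a b] is R_{ab c}^d, the d-component of R(e_a, e_b) e_c, where
   R(X, Y) = [nabla_X, nabla_Y] - nabla_[X, Y]; round spheres have Ric > 0. *)
Definition riem d c a b : E4 R -> R := fun x =>
  pd a (christoffel d b c) x - pd b (christoffel d a c) x
  + \sum_(e < 4) (christoffel d a e x * christoffel e b c x
                  - christoffel d b e x * christoffel e a c x).

Definition riem_low d c a b : E4 R -> R := fun x =>
  \sum_(e < 4) low d e x * riem e c a b x.

Definition ric a b : E4 R -> R := fun x => \sum_(c < 4) riem c a c b x.

Definition scal : E4 R -> R := fun x =>
  \sum_(a < 4) \sum_(b < 4) upp a b x * ric a b x.

Definition ric_norm2 : E4 R -> R := fun x =>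
  \sum_(a < 4) \sum_(b < 4) \sum_(c < 4) \sum_(d < 4)
    upp a c x * upp b d x * ric a b x * ric c d x.

(* The totally trace-free part of [riem_low]; the constants 1/2 = 1/(n-2) and
   1/6 = 1/((n-1)(n-2)) are those of dimension n = 4. *)
Definition weyl d c a b : E4 R -> R := fun x =>
  riem_low d c a b x
  - 2^-1 * (low d a x * ric c b x - low d b x * ric c a x
            - low c a x * ric d b x + low c b x * ric d a x)
  + 6^-1 * scal x * (low d a x * low c b x - low d b x * low c a x).

Definition weyl_norm2 : E4 R -> R := fun x =>
  \sum_(a < 4) \sum_(b < 4) \sum_(c < 4) \sum_(d < 4)
  \sum_(a' < 4) \sum_(b' < 4) \sum_(c' < 4) \sum_(d' < 4)
    upp a a' x * upp b b' x * upp c c' x * upp d d' x *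
    weyl a b c d x * weyl a' b' c' d' x.

(* Laplacian, |gradient|^2 and Ric(gradient, gradient) of a function given by
   its (classical or weak) first and second partial derivatives. *)
Definition lap_of (D1 : 'I_4 -> E4 R -> R) (D2 : 'I_4 -> 'I_4 -> E4 R -> R) :
    E4 R -> R := fun x =>
  \sum_(a < 4) \sum_(b < 4) upp a b x *
    (D2 a b x - \sum_(c < 4) christoffel c a b x * D1 c x).

Definition grad2_of (D1 : 'I_4 -> E4 R -> R) : E4 R -> R := fun x =>
  \sum_(a < 4) \sum_(b < 4) upp a b x * D1 a x * D1 b x.

Definition ricgrad_of (D1 : 'I_4 -> E4 R -> R) : E4 R -> R := fun x =>
  \sum_(a < 4) \sum_(b < 4) \sum_(c < 4) \sum_(d < 4)
    ric a b x * upp a c x * upp b d x * D1 c x * D1 d x.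

Definition lap (f : E4 R -> R) : E4 R -> R :=
  lap_of (fun a => pd a f) (fun a b => pd a (pd b f)).

Definition Qcurv : E4 R -> R := fun x =>
  12^-1 * (- lap scal x + scal x ^+ 2 - 3 * ric_norm2 x).

Definition vol_density : E4 R -> R := fun x => Num.sqrt (\det (G x)).

End LocalGeometry.

Section Functionals.
Variables (R : realType) (M : topologicalType) (g : closed_riemannian4 R M).
Implicit Type w : M -> R.

Definition img (i : 'I_(nchart g)) : set (E4 R) := chart i @` dom i.

(* The image under the chart i of the points of [dom i] lying in no [dom j],
   j < i: these sets correspond to a finite Borel partition of M. *)
Definition piece (i : 'I_(nchart g)) : set (E4 R) :=
  chart i @` [set p | dom i p /\ forall j : 'I_(nchart g), (j < i)%N -> ~ dom j p].

(* Integral against dv of the function on M whose expression in the chart i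
   is [f i]; each point of M is counted in exactly one chart. *)
Definition intM (f : 'I_(nchart g) -> E4 R -> R) : R :=
  \sum_(i < nchart g) int4 (piece i) (fun x => f i x * vol_density (met i) x).

Definition loc w (i : 'I_(nchart g)) : E4 R -> R := w \o parm i.

Definition wD1 w (i : 'I_(nchart g)) (a : 'I_4) : E4 R -> R :=
  wpd (img i) a (loc w i).

Definition wD2 w (i : 'I_(nchart g)) (a b : 'I_4) : E4 R -> R :=
  wpd (img i) a (wD1 w i b).

(* W^{2,2}(M): in every chart, w and its weak derivatives of order at most 2
   are in L^2_loc (M being compact, this is the global space). *)
Definition W22 : set (M -> R) := [set w | forall i : 'I_(nchart g),
  [/\ L2loc (img i) (loc w i),
      forall a, exists v, is_wpd (img i) a (loc w i) v
    & forall a b, exists v, is_wpd (img i) a (wD1 w i b) v]].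

Definition Lap w i : E4 R -> R := lap_of (met i) (wD1 w i) (wD2 w i).
Definition Grad2 w i : E4 R -> R := grad2_of (met i) (wD1 w i).
Definition RicGrad w i : E4 R -> R := ricgrad_of (met i) (wD1 w i).

Definition W2 (i : 'I_(nchart g)) : E4 R -> R := weyl_norm2 (met i).
Definition Sc (i : 'I_(nchart g)) : E4 R -> R := scal (met i).
Definition Q (i : 'I_(nchart g)) : E4 R -> R := Qcurv (met i).

Definition Vol : R := intM (fun=> cst 1).

Definition log_mean_exp4 w : R :=
  ln (Vol^-1 * intM (fun i x => expR (4 * loc w i x))).

(* The integral of w P w, P the Paneitz operator, as the quadratic form that
   is meaningful for w in W^{2,2}. *)
Definition paneitz_form w : R :=
  intM (fun i x => Lap w i x ^+ 2 + 2 / 3 * Sc i x * Grad2 w i x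
                   - 2 * RicGrad w i x).

Definition FI w : R :=
  4 * intM (fun i x => loc w i x * W2 i x) - intM W2 * log_mean_exp4 w.

Definition FII w : R :=
  paneitz_form w + 4 * intM (fun i x => Q i x * loc w i x)
  - intM Q * log_mean_exp4 w.

Definition FIII w : R :=
  12 * intM (fun i x => (Lap w i x + Grad2 w i x) ^+ 2)
  - 4 * intM (fun i x => loc w i x * lap (met i) (Sc i) x
                         + Sc i x * Grad2 w i x).

Definition Ffun (g1 g2 g3 : R) w : R := g1 * FI w + g2 * FII w + g3 * FIII w.

Definition F_P w : R := Ffun (- (1 / 4)) (- 14) (8 / 3) w.
Definition F_tau w : R := Ffun (- 13) (- 248) (116 / 3) w.

End Functionals.

(* Main.v *)
(** Near a point x0 of a chart, with u = e + lam |x - x0|^2 in the metric at x0,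
    take w to be t log (1 / u), cut off in C^2 fashion at u = 1. The quadratic part
    of the integrand of the functional is
    16 t^2 lam^2 (gamma2 + 12 gamma3 (1 - t)^2) u^-2 up to lower order terms, so that
    it contributes a multiple of log (1 / e), of the sign of
    gamma2 + 12 gamma3 (1 - t)^2. For t <= 3/8 the integral of exp (4 w) stays
    bounded as e -> 0, hence so does the logarithmic term. For both functionals this
    sign is negative at t = 3/8 and positive at t = 1/8. *)
From HB Require Import structures.
Require Import Defs.
From mathcomp Require Import all_boot all_order all_algebra.
From mathcomp Require Import all_classical all_reals all_analysis.
From mathcomp Require Import measurable_realfun ring lra.
Import Order.TTheory GRing.Theory Num.Theory.
Import numFieldNormedType.Exports.
Set Implicit Arguments.
Unset Strict Implicit.
Unset Printing Implicit Defensive.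
Local Open Scope classical_set_scope.
Local Open Scope ring_scope.

(** * Lebesgue measure and integration on row vectors *)

(** A window for [t] makes the construction possible: exp(4w) grows like |x - x0|^(-8t), integrable
    in dimension four for t < 1/2, while gamma2 + 12 gamma3 (1 - t)^2 turns negative past t = 0.339
    for F_P and past t = 0.269 for F_tau. The value 3/8 lies in both windows and gives the integer
    exponent 3. The functionals involve arbitrarily chosen representatives of weak derivatives.
    Almost everywhere uniqueness of weak derivatives and integration by parts are therefore needed
    before the classical derivatives of a C^2 function can be inserted. Dyadic cubes replace polar
    coordinates. With e of order 4^(-N), the energy density is bounded by a combination of
    indicators of concentric cubes of half-side r / 2^k, k < N, with coefficients of order
    (half-side)^(-4). In dimension four each such cube contributes the same amount, and log(1/e)
    appears as the number N of cubes. No normal coordinates are used: u is built from the metric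
    matrix frozen at x0, and continuity of the inverse metric controls the error. Suprema reduce to
    infima by changing the sign of the three weights. *)

Lemma ord4_ind (P : 'I_4 -> Prop) :
  P 0 -> P 1 -> P 2%:R -> P 3%:R -> forall k, P k.
Proof.
move=> P0 P1 P2 P3 [[|[|[|[|//]]]] i].
- by rewrite (_ : Ordinal i = 0)//; apply/val_inj.
- by rewrite (_ : Ordinal i = 1)//; apply/val_inj.
- by rewrite (_ : Ordinal i = 2%:R)//; apply/val_inj.
- by rewrite (_ : Ordinal i = 3%:R)//; apply/val_inj.
Qed.

(* The Lebesgue measure of the library lives on [measurableTypeR R]. *)
Notation X4 R := (measurableTypeR R * measurableTypeR R * measurableTypeR R * measurableTypeR R)%type.
Notation "'pre4' A" := (@preimage (X4 _) _ (@vec4 _) A) (at level 24, A at level 23).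

Section Measurability.
Context {R : realType}.
Local Notation E4 := 'rV[R]_4.
Local Notation mR := (measurableTypeR R).
Implicit Types (U : set E4) (f : E4 -> R) (p : (X4 R)).

Lemma measurable_coord4 (k : 'I_4) :
  measurable_fun [set: (X4 R)] (fun p => vec4 p 0 k).
Proof.
elim/ord4_ind: k.
- rewrite (_ : (fun _ => _) = fst \o fst \o fst); last by apply/funext=> p /=; rewrite mxE.
  by do 2! (apply: measurableT_comp => //).
- rewrite (_ : (fun _ => _) = snd \o fst \o fst); last by apply/funext=> p /=; rewrite mxE.
  by do 2! (apply: measurableT_comp => //).
- rewrite (_ : (fun _ => _) = snd \o fst); last by apply/funext=> p /=; rewrite mxE.
  by do 2! (apply: measurableT_comp => //).
- rewrite (_ : (fun _ => _) = snd); last by apply/funext=> p /=; rewrite mxE.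
  exact: measurable_snd.
Qed.

Lemma ballP4 (x y : E4) (e : R) :
  ball x e y <-> 0 < e /\ forall k, `|x 0 k - y 0 k| < e.
Proof.
split.
  move=> [e0 h]; split => // k; exact: h.
move=> [e0 h]; split=> // i j; rewrite [i]ord1; exact: h.
Qed.

Lemma measurable_ball4 (x : E4) (e : R) : measurable (pre4 ball x e).
Proof.
have [e0|e0] := ltP 0 e; last first.
  rewrite (_ : _ @^-1` _ = set0)//; apply/seteqP; split=> // p /= /ballP4[].
  by rewrite ltNge e0.
rewrite (_ : _ @^-1` _ =
    \bigcap_(k in [set: 'I_4]) ((fun p => vec4 p 0 k) @^-1` (ball (x 0 k) e))).
  apply: fin_bigcap_measurable; first exact: finite_finset.
  move=> k _; rewrite -[X in measurable X]setTI; apply: measurable_coord4 => //.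
  by apply: open_measurable; exact: ball_open.
apply/seteqP; split=> p /=.
  by move=> /ballP4[_ h] k _; exact: h.
move=> h; apply/ballP4; split=> // k; exact: (h k I).
Qed.

Lemma rat_near (x e : R) : 0 < e -> exists q : rat, `|x - ratr q| < e.
Proof.
move=> e0; have : x - e < x + e by lra.
move=> /rat_in_itvoo[q]; rewrite in_itv/= => /andP[? ?]; exists q.
by rewrite ltr_norml; apply/andP; split; lra.
Qed.

Lemma norm4_ler (x : E4) (e : R) : (`|x| <= e) <-> (0 <= e /\ forall k, `|x 0 k| <= e).
Proof.
split=> [h|[e0 h]].
  split; first exact: le_trans h.
  move=> k; apply: le_trans h.
  rewrite [leRHS]/Num.norm/= mx_normrE.
  by apply: (le_bigmax_cond _ (fun ij => `|x ij.1 ij.2|) (j := (0, k))).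
rewrite [leLHS]/Num.norm/= mx_normrE; apply: bigmax_le => //.
by move=> [i j] _ /=; rewrite [i]ord1.
Qed.

Lemma norm4_coord (x : E4) k : `|x 0 k| <= `|x|.
Proof. by have /norm4_ler[_] := lexx `|x|; apply. Qed.

(** The norm of row vectors is the maximum norm, so this is a cube of side [2 * e]. Its measure is
    explicit, and cubes take the part of balls in all later estimates. *)
Definition cball (x : E4) (e : R) : set E4 := [set y | `|x - y| <= e].

Lemma cball_closed x e : closed (cball x e).
Proof.
rewrite /cball (_ : mkset _ = (fun y => `|x - y|) @^-1` [set z | z <= e])//.
apply: closed_comp; last exact: closed_le.
move=> y _; apply: (@cvg_norm _ E4 E4 (nbhs y) _ (fun y => x - y) (x - y)).
by apply: (@cvgB _ E4 E4 (nbhs y)); [exact: cvg_cst|exact: cvg_id].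
Qed.

Lemma cball_compact x e : compact (cball x e).
Proof.
apply: bounded_closed_compact; last exact: cball_closed.
exists (`|x| + e); split => [|r hr y hy]; first by rewrite num_real.
apply: le_trans (ltW hr).
rewrite -[y](subKr x); apply: le_trans (ler_normB _ _) _.
by rewrite lerD2l.
Qed.

(** Four coordinates of a centre and a radius. This countable family of cubes serves twice: open
    sets are countable unions of measurable cubes, and almost everywhere statements pass from cubes
    to open sets. *)
Definition ratc := (rat * rat * rat * rat * rat)%type.
Definition ratcenter (a : ratc) : E4 :=
  vec4 (ratr a.1.1.1.1, ratr a.1.1.1.2, ratr a.1.1.2, ratr a.1.2).
Definition ratradius (a : ratc) : R := ratr a.2.

Lemma ratball_near (U : set E4) (x : E4) : open U -> U x ->
  exists a : ratc, ball (ratcenter a) (ratradius a) x /\ cball (ratcenter a) (ratradius a) `<=` U.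
Proof.
move=> oU Ux; have /nbhs_ballP[e /= e0 eU] := open_nbhs_nbhs (conj oU Ux).
have e4 : 0 < e / 4 by rewrite divr_gt0.
have : e / 4 < e / 2 by lra.
move=> /rat_in_itvoo[r]; rewrite in_itv/= => /andP[r1 r2].
have [q0 h0] := rat_near (x 0 0) e4.
have [q1 h1] := rat_near (x 0 1) e4.
have [q2 h2] := rat_near (x 0 2%:R) e4.
have [q3 h3] := rat_near (x 0 3%:R) e4.
exists (q0, q1, q2, q3, r); rewrite /ratcenter /ratradius /=.
have hk k : `|vec4 (ratr q0, ratr q1, ratr q2, ratr q3) 0 k - x 0 k| < e / 4.
  by rewrite distrC; elim/ord4_ind: k; rewrite mxE.
split.
  apply/ballP4; split; first by lra.
  by move=> k; apply: lt_trans (hk k) _.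
move=> y /norm4_ler[_ hy]; apply: eU; apply/ballP4; split => // k.
have := hk k; have := hy k; rewrite !mxE => {}hy {}hk.
rewrite (_ : x 0 k - y 0 k = (x 0 k - [:: ratr q0; ratr q1; ratr q2; ratr q3]`_k)
  + ([:: ratr q0; ratr q1; ratr q2; ratr q3]`_k - y 0 k)); last by ring.
apply: le_lt_trans (ler_normD _ _) _; rewrite distrC; lra.
Qed.

Lemma open_ratballs (U : set E4) : open U ->
  U = \bigcup_(a in [set a : ratc | cball (ratcenter a) (ratradius a) `<=` U])
        ball (ratcenter a) (ratradius a).
Proof.
move=> oU; apply/seteqP; split=> [x Ux|x [a /= aU]].
  by have [a [? ?]] := ratball_near oU Ux; exists a.
move=> /ballP4[r0 h]; apply: aU; apply/norm4_ler; split; first exact: ltW.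
by move=> k; rewrite !mxE; have := h k; rewrite mxE; exact: ltW.
Qed.

Lemma open_measurable4 (U : set E4) : open U -> measurable (pre4 U).
Proof.
move=> oU; rewrite (open_ratballs oU) preimage_bigcup.
rewrite bigcup_mkcond; apply: countable_bigcupT_measurable => [|a]; first exact: countableP.
by case: ifP => // _; exact: measurable_ball4.
Qed.

Lemma closed_measurable4 (U : set E4) : closed U -> measurable (pre4 U).
Proof.
move=> cU; rewrite -[X in measurable X]setCK; apply: measurableC.
by rewrite preimage_setC; apply: open_measurable4; exact: closed_openC.
Qed.

Lemma cont_measurable4 (U : set E4) f : open U ->
  (forall x, U x -> {for x, continuous f}) ->
  measurable_fun (pre4 U) (f \o @vec4 R).
Proof.
move=> oU cf.
apply: (measurability _ (RGenOInfty.measurableE R)) => /= _ [_ [a ->] <-].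
rewrite (_ : _ `&` _ = pre4 (U `&` f @^-1` `]a, +oo[)); last first.
  by apply/seteqP; split.
apply: open_measurable4; rewrite openE => x [Ux fx].
apply: filterI; first exact: open_nbhs_nbhs.
apply: cf => //; apply: open_nbhs_nbhs; split => //; exact: interval_open.
Qed.

End Measurability.

Section Integration.
Context {R : realType}.
Local Notation E4 := 'rV[R]_4.
Local Notation mR := (measurableTypeR R).
Local Notation mu := (@leb4 R).
Implicit Types (U : set E4) (f : E4 -> R) (p : (X4 R)).

Lemma leb4_cball (x : E4) (r : R) : 0 <= r ->
  mu (pre4 cball x r) = ((2 * r) ^+ 4)%:E.
Proof.
move=> r0; set A := fun k => [set t | `|x 0 k - t| <= r].
have AE k : A k = `[x 0 k - r, x 0 k + r]%classic.
  apply/seteqP; split=> t; rewrite /A /= in_itv/= ler_norml => /andP[? ?]; apply/andP; split; lra.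
have mA k : measurable (A k) by rewrite AE; exact: measurable_itv.
have lA k : lebesgue_measure (A k) = (2 * r)%:E.
  rewrite AE lebesgue_measure_itv/= lte_fin.
  case: ltP => h; first by rewrite -EFinD; congr EFin; ring.
  by congr EFin; lra.
rewrite (_ : _ @^-1` _ = A 0 `*` A 1 `*` A 2%:R `*` A 3%:R); last first.
  apply/seteqP; split=> [[[[a b] c] d]|[[[a b] c] d]] /=.
    move=> /norm4_ler[_ h].
    have := h 0; have := h 1; have := h 2%:R; have := h 3%:R.
    by rewrite !mxE/=.
  move=> [[[h0 h1] h2] h3]; apply/norm4_ler; split=> // k.
  by elim/ord4_ind: k; rewrite !mxE.
have mA2 : measurable (A 0 `*` A 1) by exact: measurableX.
have mA3 : measurable (A 0 `*` A 1 `*` A 2%:R) by exact: measurableX.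
have -> : mu (A 0 `*` A 1 `*` A 2%:R `*` A 3%:R) =
    (lebesgue_measure (A 0%R) * lebesgue_measure (A 1%R) *
     lebesgue_measure (A 2%:R) * lebesgue_measure (A 3%:R))%E.
  etransitivity; first exact: (@product_measure1E _ _ _ _ R
    ((lebesgue_measure \x lebesgue_measure) \x lebesgue_measure)%E lebesgue_measure _ _ mA3 (mA _)).
  congr (_ * _)%E; etransitivity; first exact: (@product_measure1E _ _ _ _ R
    (lebesgue_measure \x lebesgue_measure)%E lebesgue_measure _ _ mA2 (mA _)).
  congr (_ * _)%E; exact: (@product_measure1E _ _ _ _ R
    lebesgue_measure lebesgue_measure _ _ (mA _) (mA _)).
rewrite !lA -!EFinM.
by congr EFin; ring.
Qed.

Lemma compact_sub_cball (K : set E4) : compact K ->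
  exists2 r, 0 <= r & K `<=` cball 0 r.
Proof.
move=> /compact_bounded[M [Mr h]].
exists (`|M| + 1); first by rewrite addr_ge0.
move=> x Kx; rewrite /cball /= sub0r normrN; apply: h => //.
by rewrite (le_lt_trans (ler_norm _))// ltrDl.
Qed.

Lemma leb4_compact_lty (K : set E4) : compact K -> (mu (pre4 K) < +oo)%E.
Proof.
move=> cK; have [r r0 Kr] := compact_sub_cball cK.
apply: (@le_lt_trans _ _ (mu (pre4 cball 0 r))).
  apply: le_measure; rewrite ?inE.
  - by apply: closed_measurable4; apply: compact_closed => //; exact: norm_hausdorff.
  - by apply: closed_measurable4; exact: cball_closed.
  - exact: preimage_subset.
by rewrite leb4_cball// ltry.
Qed.

Lemma indic_integrable4 (A : set (X4 R)) : measurable A -> (mu A < +oo)%E ->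
  mu.-integrable setT (EFin \o (\1_A : (X4 R) -> R)).
Proof.
move=> mA Aoo; apply/integrableP; split; first exact/measurable_EFinP.
rewrite (eq_integral (EFin \o (\1_A : (X4 R) -> R))); last first.
  by move=> p _ /=; rewrite ger0_norm.
by rewrite integral_indic ?setIT.
Qed.

Lemma bounded_integrable4 (D : set (X4 R)) (K : set E4) f (M : R) :
  measurable D -> measurable_fun D (f \o @vec4 R) -> compact K ->
  (forall p, D p -> `|f (vec4 p)| <= M) ->
  (forall p, D p -> ~ K (vec4 p) -> f (vec4 p) = 0) ->
  mu.-integrable D (EFin \o (f \o @vec4 R)).
Proof.
move=> mD mf cK fM f0.
have mK : measurable (pre4 K).
  by apply: closed_measurable4; apply: compact_closed => //; exact: norm_hausdorff.
apply: (@le_integrable _ _ _ _ _ _ _ (EFin \o (fun p => M * \1_(pre4 K) p))) => //.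
- exact/measurable_EFinP.
- move=> p Dp /=; rewrite lee_fin indicE.
  have [pK|pK] := boolP (p \in _); rewrite ?mulr1 ?mulr0.
    by apply: le_trans (fM _ Dp) (ler_norm _).
  rewrite f0 ?normr0//; move: pK; rewrite notin_setE; exact.
- apply: (@integrableS _ _ _ _ setT) => //.
  rewrite (_ : _ \o _ = (fun p => M%:E * (EFin \o \1_(pre4 K)) p)%E)//.
  apply: integrableZl => //.
  by apply: indic_integrable4 => //; exact: leb4_compact_lty.
Qed.

Lemma cont_compact_bounded (K : set E4) f : compact K ->
  (forall x, K x -> {for x, continuous f}) -> exists M, forall x, K x -> `|f x| <= M.
Proof.
move=> cK cf.
have : compact (f @` K).
  apply: continuous_compact => //.
  apply: continuous_in_subspaceT => x /set_mem; exact: cf.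
move=> /compact_bounded[M [Mr h]]; exists (`|M| + 1) => x Kx.
by apply: (h (`|M| + 1)); [rewrite (le_lt_trans (ler_norm _))// ltrDl|exists x].
Qed.

Lemma cc_integrable4 U (K : set E4) f : open U -> compact K -> K `<=` U ->
  (forall x, U x -> {for x, continuous f}) -> (forall x, U x -> ~ K x -> f x = 0) ->
  mu.-integrable (pre4 U) (EFin \o (f \o @vec4 R)).
Proof.
move=> oU cK KU cf f0.
have [M hM] := cont_compact_bounded cK (fun x Kx => cf x (KU x Kx)).
apply: (@bounded_integrable4 _ K _ `|M|) => //.
- exact: open_measurable4.
- exact: cont_measurable4.
- move=> p Up; have [Kp|Kp] := pselect (K (vec4 p)).
    by apply: le_trans (hM _ Kp) (ler_norm _).
  by rewrite f0// normr0.
- by move=> p Up; exact: f0.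
Qed.

Import HBNNSimple.

(* No measurability is assumed on f and g: the lower integral defining the
   integral does not see null sets. *)
Lemma null_eq_integral d (T : measurableType d) (m : {measure set T -> \bar R})
    (D : set T) (f g : T -> \bar R) (N : set T) : measurable N -> m N = 0%E ->
  (forall x, D x -> ~ N x -> f x = g x) ->
  (\int[m]_(x in D) f x = \int[m]_(x in D) g x)%E.
Proof.
move=> mN N0 fg; rewrite /integral.
have H (u v : T -> \bar R) : (forall x, 0 <= v x)%E -> (forall x, ~ N x -> u x = v x) ->
  (ereal_sup [set sintegral m (h : {nnsfun T >-> R}) | h in [set h | forall x, ((h : {nnsfun T >-> R}) x)%:E <= u x]]
   <= ereal_sup [set sintegral m (h : {nnsfun T >-> R}) | h in [set h | forall x, ((h : {nnsfun T >-> R}) x)%:E <= v x]])%E.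
  move=> v0 uv; apply: ge_ereal_sup => _ [h hu <-].
  (* A simple function below [u], set to 0 on [N], lies below [v] and keeps its integral. *)
  apply: ereal_sup_ubound; exists (proj_nnsfun h (measurableC mN)).
    move=> x; rewrite /proj_nnsfun/= mindicE.
    have [/set_mem Nx|_] := boolP (x \in _); last by rewrite mulr0.
    by rewrite mulr1 -uv.
  have mh (k : {nnsfun T >-> R}) : measurable_fun setT (fun x => (k x)%:E).
    by apply/measurable_EFinP; exact: measurable_funPT.
  rewrite -!integralT_nnsfun; apply: ae_eq_integral => //.
    exists N; split => // x /=; apply: contra_notP => Nx _.
    by rewrite /proj_nnsfun/= mindicE mem_set// mulr1.
have H2 (u v : T -> \bar R) : (forall x, 0 <= u x)%E -> (forall x, 0 <= v x)%E ->
    (forall x, ~ N x -> u x = v x) ->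
  (ereal_sup [set sintegral m (h : {nnsfun T >-> R}) | h in [set h | forall x, ((h : {nnsfun T >-> R}) x)%:E <= u x]]
   = ereal_sup [set sintegral m (h : {nnsfun T >-> R}) | h in [set h | forall x, ((h : {nnsfun T >-> R}) x)%:E <= v x]])%E.
  move=> u0 v0 uv; apply/eqP; rewrite eq_le !H// => x Nx; exact/esym/uv.
have fgN x : ~ N x -> (f \_ D) x = (g \_ D) x.
  move=> Nx; rewrite !patchE; case: ifPn => // /set_mem Dx; exact: fg.
by congr (_ - _)%E; apply: H2 => // x Nx; rewrite ?funeposE ?funenegE fgN.
Qed.

End Integration.

(** * Partial derivatives of finite order *)

Section Calculus1.
Context {R : realType}.
Implicit Types (f g : R -> R) (D : set R).

(** Used where a piecewise definition changes branch: [flat] at 0, [theta] and [theta1] at 1. At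
    these points the contact with the zero branch is quadratic. *)
Lemma is_derive_quad f (x c : R) :
  (\forall y \near x, `|f y - f x| <= c * (y - x) ^+ 2) -> is_derive x 1 f 0.
Proof.
move=> fx.
have hx : (fun h : R => h + x) @ (0 : R) --> x.
  by rewrite -[X in _ --> X]add0r; apply: cvgD; [exact: cvg_id|exact: cvg_cst].
have H : h^-1 *: ((f \o shift x) (h *: 1) - f x) @[h --> 0^'] --> (0 : R).
  apply/cvgrPdist_lt => e e0.
  have c1 : 0 < `|c| + 1 by rewrite ltr_wpDl.
  near=> h.
  have h0 : h != 0 by near: h; exact: nbhs_dnbhs_neq.
  rewrite sub0r normrN /= [h%:A]mulr1 normrZ normfV.
  have : `|f (h + x) - f x| <= c * (h + x - x) ^+ 2.
    by near: h; apply: nbhs_dnbhs; exact: (hx _ fx).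
  rewrite addrK => hq; rewrite mulrC ltr_pdivrMr ?normr_gt0//.
  apply: (le_lt_trans hq); apply: (@le_lt_trans _ _ ((`|c| + 1) * `|h| * `|h|)).
    rewrite -mulrA -expr2 -normrX (ger0_norm (sqr_ge0 h)).
    by apply: ler_wpM2r; [exact: sqr_ge0|rewrite (le_trans (ler_norm _))// lerDl].
  rewrite ltr_pM2r ?normr_gt0// mulrC -ltr_pdivlMr//.
  by near: h; apply: dnbhs0_lt; rewrite divr_gt0.
by apply: DeriveDef; [apply/cvg_ex; exists 0|apply: cvg_lim].
Unshelve. all: by end_near. Qed.

Fixpoint Cn1 (n : nat) D g : Prop :=
  (forall x, D x -> {for x, continuous g}) /\
  if n is n'.+1 then (forall x, D x -> derivable g x 1) /\ Cn1 n' D (derive1 g)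
  else True.

Lemma Cn1_cont n D g : Cn1 n D g -> forall x, D x -> {for x, continuous g}.
Proof. by case: n => [[]|n []]. Qed.

Lemma near_open (T : topologicalType) (D : set T) (x : T) (P : T -> Prop) :
  open D -> D x -> (forall y, D y -> P y) -> \forall y \near x, P y.
Proof.
by move=> oD Dx h; apply: filterS h _; exact: open_nbhs_nbhs.
Qed.

Lemma near_eq_cont (T : topologicalType) (f g : T -> R) x :
  (\forall y \near x, f y = g y) -> {for x, continuous f} -> {for x, continuous g}.
Proof.
move=> fg cf; rewrite /prop_for /continuous_at -(nbhs_singleton fg).
by apply: cvg_trans cf; apply: near_eq_cvg; apply: filterS fg => y ->.
Qed.

Lemma Cn1_eq n D f g : open D -> (forall x, D x -> f x = g x) ->
  Cn1 n D f -> Cn1 n D g.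
Proof.
move=> oD; elim: n f g => [|n IH] f g fg.
  move=> [cf _]; split => // x Dx; apply: near_eq_cont (cf _ Dx).
  exact: near_open Dx fg.
move=> [cf [df Cf]]; split.
  move=> x Dx; apply: near_eq_cont (cf _ Dx); exact: near_open Dx fg.
split.
  move=> x Dx; apply: near_eq_derivable (df _ Dx); exact: near_open Dx fg.
apply: IH Cf => x Dx; rewrite !derive1E; apply: near_eq_derive.
exact: near_open Dx fg.
Qed.

Lemma derivable1_cont f x : derivable f x 1 -> {for x, continuous f}.
Proof. by move=> /derivable1_diffP/differentiable_continuous. Qed.

Lemma Cn1_intro n D f g : open D -> (forall x, D x -> is_derive x 1 f (g x)) ->
  Cn1 n D g -> Cn1 n.+1 D f.
Proof.
move=> oD fg Cg; split; last split.
- by move=> x /fg[df _]; exact: derivable1_cont.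
- by move=> x /fg[].
- by apply: Cn1_eq Cg => // x /fg[_ <-]; rewrite derive1E.
Qed.

Lemma derive_slice (V : normedModType R) (f : V -> R) (x v : V) :
  'D_1 (fun h : R => f (h *: v + x)) 0 = 'D_v f x.
Proof.
rewrite /derive; set g1 := (fun h : R => h^-1 *: _); set g2 := (fun h : R => h^-1 *: _).
suff -> : g1 = g2 by [].
by apply/funext => h; rewrite /g1 /g2 /= addr0 scale0r add0r [_%:A]mulr1.
Qed.

(** [Cn] provides derivatives along coordinate directions only; restricting to the line through [x]
    reduces the rule to one variable. *)
Lemma is_derive_comp_dir (V : normedModType R) (f : V -> R) (g : R -> R)
    (x v : V) (dg : R) : is_derive (f x) 1 g dg -> derivable f x v ->
  is_derive x v (g \o f) (dg * 'D_v f x).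
Proof.
move=> dg1 df.
pose F h := f (h *: v + x).
have dF : is_derive (0 : R) 1 F ('D_v f x).
  by apply: DeriveDef; [exact: ((derivable1P f x v).1 df)|exact: derive_slice].
have F0 : F 0 = f x by rewrite /F scale0r add0r.
rewrite -F0 in dg1.
have [dgF gFE] := is_derive1_comp dg1 dF.
apply: DeriveDef; first exact: ((derivable1P (g \o f) x v).2 dgF).
by rewrite -gFE -derive_slice.
Qed.

End Calculus1.

Section CalculusE4.
Context {R : realType}.
Local Notation E4 := 'rV[R]_4.
Implicit Types (U V : set E4) (f g : E4 -> R).

(** Finite orders are kept because the bubble is only C^2, and because induction on [n] handles
    products, inverses and composites; [smooth_on] amounts to all [n] at once. *)
Fixpoint Cn (n : nat) U f : Prop :=
  (forall x, U x -> {for x, continuous f}) /\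
  if n is n'.+1 then
    (forall k x, U x -> derivable f x (delta_mx 0 k)) /\
    (forall k, Cn n' U (pd k f))
  else True.

Lemma Cn_cont n U f : Cn n U f -> forall x, U x -> {for x, continuous f}.
Proof. by case: n => [[]|n []]. Qed.

Lemma Cn_pd n U f k : Cn n.+1 U f -> Cn n U (pd k f).
Proof. by move=> [_ [_ h]]; exact: h. Qed.

Lemma Cn_derivable n U f k x : Cn n.+1 U f -> U x -> derivable f x (delta_mx 0 k).
Proof. by move=> [_ [h _]]; exact: h. Qed.

Lemma Cn_is_derive n U f k x : Cn n.+1 U f -> U x ->
  is_derive x (delta_mx 0 k) f (pd k f x).
Proof. by move=> Cf Ux; apply: DeriveDef => //; exact: Cn_derivable Cf Ux. Qed.

Lemma CnW n U f : Cn n.+1 U f -> Cn n U f.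
Proof.
elim: n f => [|n IH] f [cf [df Cf]]; first by split.
by split => //; split => // k; exact: IH.
Qed.

Lemma Cn_sub n U V f : V `<=` U -> Cn n U f -> Cn n V f.
Proof.
move=> VU; elim: n f => [|n IH] f; first by move=> [cf _]; split => // x /VU/cf.
move=> [cf [df Cf]]; split; first by move=> x /VU/cf.
by split=> k; [move=> x /VU; exact: df|exact: IH (Cf k)].
Qed.

Lemma Cn_local n U f :
  (forall x, U x -> exists V, V x /\ Cn n V f) -> Cn n U f.
Proof.
elim: n f => [|n IH] f h.
  by split => // x /h[V [Vx Cf]]; exact: Cn_cont Cf x Vx.
split; first by move=> x /h[V [Vx Cf]]; exact: Cn_cont Cf x Vx.
split; first by move=> k x /h[V [Vx Cf]]; exact: Cn_derivable Cf Vx.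
by move=> k; apply: IH => x /h[V [Vx Cf]]; exists V; split=> //; exact: Cn_pd.
Qed.

Lemma pd_eq U f g k x : open U -> U x -> (forall y, U y -> f y = g y) ->
  pd k f x = pd k g x.
Proof. by move=> oU Ux fg; apply: near_eq_derive; exact: near_open Ux fg. Qed.

Lemma Cn_eq n U f g : open U -> (forall x, U x -> f x = g x) ->
  Cn n U f -> Cn n U g.
Proof.
move=> oU; elim: n f g => [|n IH] f g fg.
  move=> [cf _]; split => // x Ux; apply: near_eq_cont (cf _ Ux).
  exact: near_open Ux fg.
move=> [cf [df Cf]]; split.
  move=> x Ux; apply: near_eq_cont (cf _ Ux); exact: near_open Ux fg.
split=> k.
  move=> x Ux; apply: near_eq_derivable (df _ _ Ux); exact: near_open Ux fg.
by apply: IH (Cf k) => x Ux; apply: (pd_eq _ oU Ux).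
Qed.

Lemma Cn_intro n U f (df : 'I_4 -> E4 -> R) : open U ->
  (forall x, U x -> {for x, continuous f}) ->
  (forall k x, U x -> is_derive x (delta_mx 0 k) f (df k x)) ->
  (forall k, Cn n U (df k)) -> Cn n.+1 U f.
Proof.
move=> oU cf fd Cd; split => //; split=> k.
  by move=> x /(fd k)[].
by apply: Cn_eq (Cd k) => // x /(fd k)[_ <-].
Qed.

Lemma Cn_cst n U (c : R) : open U -> Cn n U (fun=> c).
Proof.
move=> oU; elim: n c => [|n IH] c; first by split => // x _; exact: cst_continuous.
apply: (@Cn_intro _ _ _ (fun _ _ => 0)) => // x _.
exact: cst_continuous.
Qed.

Lemma CnD n U f g : open U -> Cn n U f -> Cn n U g -> Cn n U (fun x => f x + g x).
Proof.
move=> oU; elim: n f g => [|n IH] f g Cf Cg.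
  by split => // x Ux; exact: (continuousD (Cn_cont Cf Ux) (Cn_cont Cg Ux)).
apply: (@Cn_intro _ _ _ (fun k x => pd k f x + pd k g x)) => //.
- by move=> x Ux; exact: (continuousD (Cn_cont Cf Ux) (Cn_cont Cg Ux)).
- by move=> k x Ux; exact: (is_deriveD (Cn_is_derive k Cf Ux) (Cn_is_derive k Cg Ux)).
- by move=> k; apply: IH; exact: Cn_pd.
Qed.

Lemma CnM n U f g : open U -> Cn n U f -> Cn n U g -> Cn n U (fun x => f x * g x).
Proof.
move=> oU; elim: n f g => [|n IH] f g Cf Cg.
  by split => // x Ux; exact: (continuousM (Cn_cont Cf Ux) (Cn_cont Cg Ux)).
apply: (@Cn_intro _ _ _ (fun k x => f x * pd k g x + g x * pd k f x)) => //.
- by move=> x Ux; exact: (continuousM (Cn_cont Cf Ux) (Cn_cont Cg Ux)).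
- move=> k x Ux; exact: (is_deriveM (Cn_is_derive k Cf Ux) (Cn_is_derive k Cg Ux)).
- by move=> k; apply: CnD => //; apply: IH; by [exact: CnW|exact: Cn_pd].
Qed.

Lemma CnN n U f : open U -> Cn n U f -> Cn n U (fun x => - f x).
Proof.
move=> oU Cf; apply: (@Cn_eq _ _ (fun x => -1 * f x)) => //.
  by move=> x _; rewrite mulN1r.
by apply: CnM => //; exact: Cn_cst.
Qed.

Lemma CnB n U f g : open U -> Cn n U f -> Cn n U g -> Cn n U (fun x => f x - g x).
Proof. by move=> oU Cf Cg; apply: CnD => //; exact: CnN. Qed.

Lemma CnX n U f m : open U -> Cn n U f -> Cn n U (fun x => f x ^+ m).
Proof.
move=> oU Cf; elim: m => [|m IH]; first exact: Cn_cst.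
apply: (@Cn_eq _ _ (fun x => f x * f x ^+ m)) => //.
  by move=> x _; rewrite exprS.
exact: CnM.
Qed.

Lemma Cn_sum n U (I : Type) (r : seq I) (P : pred I) (F : I -> E4 -> R) : open U ->
  (forall i, P i -> Cn n U (F i)) -> Cn n U (fun x => \sum_(i <- r | P i) F i x).
Proof.
move=> oU CF; elim: r => [|i r IH].
  by apply: (Cn_eq oU _ (Cn_cst n 0 oU)) => x _; rewrite [RHS]big_nil.
apply: (@Cn_eq _ _ (fun x => (if P i then F i x else 0) + \sum_(i <- r | P i) F i x)) => //.
  by move=> x _; rewrite [RHS]big_cons; case: (P i) => //; rewrite add0r.
apply: CnD => //; case Pi: (P i); [exact: CF|exact: Cn_cst].
Qed.

Lemma Cn_prod n U (I : Type) (r : seq I) (P : pred I) (F : I -> E4 -> R) : open U ->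
  (forall i, P i -> Cn n U (F i)) -> Cn n U (fun x => \prod_(i <- r | P i) F i x).
Proof.
move=> oU CF; elim: r => [|i r IH].
  by apply: (Cn_eq oU _ (Cn_cst n 1 oU)) => x _; rewrite [RHS]big_nil.
apply: (@Cn_eq _ _ (fun x => (if P i then F i x else 1) * \prod_(i <- r | P i) F i x)) => //.
  by move=> x _; rewrite [RHS]big_cons; case: (P i) => //; rewrite mul1r.
apply: CnM => //; case Pi: (P i); [exact: CF|exact: Cn_cst].
Qed.

Lemma Cn_comp n U (D : set R) f (g : R -> R) : open U ->
  (forall x, U x -> D (f x)) -> Cn1 n D g -> Cn n U f -> Cn n U (fun x => g (f x)).
Proof.
move=> oU fD; elim: n g => [|n IH] g Cg Cf.
  split => // x Ux; apply: continuous_comp; first exact: Cn_cont Cf _ Ux.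
  by apply: Cn1_cont Cg _ _; exact: fD.
apply: (@Cn_intro _ _ _ (fun k x => (derive1 g) (f x) * pd k f x)) => //.
- move=> x Ux; apply: continuous_comp; first exact: Cn_cont Cf _ Ux.
  by apply: Cn1_cont Cg _ _; exact: fD.
- move=> k x Ux; apply: is_derive_comp_dir; last exact: Cn_derivable Cf Ux.
  rewrite derive1E; apply: derivableP; apply: Cg.2.1; exact: fD.
- move=> k; apply: CnM => //; last exact: Cn_pd.
  by apply: IH; [exact: Cg.2.2|exact: CnW].
Qed.

Lemma CnV n U f : open U -> (forall x, U x -> f x != 0) -> Cn n U f ->
  Cn n U (fun x => (f x)^-1).
Proof.
move=> oU f0; elim: n => [|n IH] Cf.
  by split => // x Ux; exact: (continuousV (f0 _ Ux) (Cn_cont Cf Ux)).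
apply: (@Cn_intro _ _ _ (fun k x => - ((f x)^-1 ^+ 2) * pd k f x)) => //.
- by move=> x Ux; exact: (continuousV (f0 _ Ux) (Cn_cont Cf Ux)).
- move=> k x Ux; have df : derivable f x (delta_mx 0 k) by exact: Cn_derivable Cf Ux.
  apply: DeriveDef; first exact: (derivableV (f0 _ Ux) df).
  by rewrite (deriveV (f0 _ Ux) df) exprVn.
- move=> k; apply: CnM => //; last exact: Cn_pd.
  by apply: CnN => //; apply: CnX => //; apply: IH; exact: CnW.
Qed.

Lemma is_derive_coord (i k : 'I_4) (x : E4) :
  is_derive x (delta_mx 0 k) (fun x : E4 => x 0 i) ((i == k)%:R).
Proof.
have dx : is_derive x (delta_mx 0 k) (fun y : E4 => y) (delta_mx 0 k).
  exact: is_derive_id.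
apply: DeriveDef; first exact: ((derivable_mxP _ _ _).1 ex_derive).
have := derive_mx (@ex_derive _ _ _ _ _ _ _ dx).
rewrite (@derive_val _ _ _ _ _ _ _ dx) => /matrixP/(_ 0 i).
by rewrite !mxE eqxx.
Qed.

Lemma Cn_coord n U i : open U -> Cn n U (fun x : E4 => x 0 i).
Proof.
move=> oU; case: n => [|n].
  by split=> // x _; exact: coord_continuous.
apply: (@Cn_intro _ _ _ (fun k _ => (i == k)%:R)) => //.
- by move=> x _; exact: coord_continuous.
- by move=> k x _; exact: is_derive_coord.
- by move=> k; exact: Cn_cst.
Qed.

Lemma smooth_onP U f : smooth_on U f <-> forall n, Cn n U f.
Proof.
split=> [sf n|Cf].
  elim: n f sf => [|n IH] f sf; first by split => // x Ux; exact: (sf [::] x Ux).1.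
  split; first by move=> x Ux; exact: (sf [::] x Ux).1.
  split; first by move=> k x Ux; exact: (sf [::] x Ux).2.
  move=> k; apply: IH => s x Ux.
  have -> : ipd s (pd k f) = ipd (rcons s k) f by rewrite /ipd foldr_rcons.
  exact: sf.
(* [ipd] differentiates first along the last index of [s], hence the induction from the right. *)
move=> s; elim/last_ind: s f Cf => [|s k IH] f Cf x Ux.
  by split; [exact: Cn_cont (Cf 0%N) _ Ux|move=> k; exact: Cn_derivable (Cf 1%N) Ux].
have -> : ipd (rcons s k) f = ipd s (pd k f) by rewrite /ipd foldr_rcons.
by apply: IH => // n; exact: Cn_pd.
Qed.

End CalculusE4.

(** * Smooth bump functions *)

Section FlatFunction.
Context {R : realType}.
Local Notation E4 := 'rV[R]_4.

(** Indexed by [k] because differentiating exp(-1/x) produces powers of 1/x: derivatives stay in the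
    linear span of the family, and smoothness becomes an induction on the order. *)
Definition flat (k : nat) (x : R) : R :=
  if 0 < x then x^-1 ^+ k * expR (- x^-1) else 0.

Lemma flat_le0 k x : x <= 0 -> flat k x = 0.
Proof. by rewrite /flat ltNge => ->. Qed.

(** This is y <= exp y at y = z / (n + 1), raised to the power n + 1. It makes [flat k]
    quadratically small at 0, as [is_derive_quad] requires. *)
Lemma exprn_expR_le (n : nat) (z : R) : 0 <= z -> z ^+ n.+1 * expR (- z) <= n.+1%:R ^+ n.+1.
Proof.
move=> z0; rewrite expRN ler_pdivrMr ?expR_gt0//.
have -> : expR z = expR (z / n.+1%:R) ^+ n.+1.
  by rewrite -expRM_natl; congr expR; rewrite mulrC divfK// pnatr_eq0.
rewrite -exprMn; apply: lerXn2r; rewrite ?nnegrE ?mulr_ge0 ?expR_ge0//.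
rewrite -ler_pdivrMl ?ltr0n// mulrC; apply: le_trans (expR_ge1Dx _).
by rewrite lerDr.
Qed.

Lemma flat_quad k x : `|flat k x| <= (k.+2)%:R ^+ k.+2 * x ^+ 2.
Proof.
rewrite /flat; case: ifP => [x0|_]; last first.
  by rewrite normr0 mulr_ge0// ?sqr_ge0// exprn_ge0.
have xi : 0 < x^-1 by rewrite invr_gt0.
rewrite ger0_norm; last by rewrite mulr_ge0 ?expR_ge0// exprn_ge0// ltW.
rewrite -ler_pdivrMr ?exprn_gt0// mulrAC -exprVn -exprD addn2.
exact/exprn_expR_le/ltW.
Qed.

Lemma is_derive_flat (k : nat) (x : R) : is_derive x 1 (flat k) (flat k.+2 x - k%:R * flat k.+1 x).
Proof.
have [x0|x0|->] := ltgtP x 0.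
- rewrite !flat_le0 ?ltW// mulr0 subr0.
  apply: (@near_eq_is_derive _ _ _ (fun=> 0)).
  near=> y; rewrite flat_le0// ltW//; near: y; exact: lt_nbhsl.
- apply: (@near_eq_is_derive _ _ _ ((fun y => y ^+ k * expR (- y)) \o (fun x => x^-1))).
    near=> y; rewrite /flat/= ifT//; near: y; exact: lt_nbhsr.
  have xn0 : x != 0 by rewrite gt_eqF.
  have di : is_derive x 1 (fun x : R => x^-1) (- (x ^- 2)).
    have := @is_derive_id R R x 1 => d.
    apply: DeriveDef; first exact: (derivableV (f := id) xn0 (@derivable_id _ _ _ _)).
    by rewrite (deriveV (f := id) xn0 (@derivable_id _ _ _ _)) derive_id [_%:A]mulr1.
  have dg (y : R) : is_derive y 1 (fun y : R => y ^+ k * expR (- y))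
     (k%:R * y ^+ k.-1 * expR (- y) - y ^+ k * expR (- y)).
    have d1 : is_derive y 1 (fun y : R => y ^+ k) (k%:R * y ^+ k.-1).
      apply: DeriveDef; first exact: exprn_derivable.
      by rewrite exp_derive [_%:A]mulr1.
    have d2 : is_derive y 1 (expR \o -%R) (expR (- y) * -1).
      exact: (is_derive1_comp (is_derive_expR (- y)) (is_deriveNid y 1)).
    apply: is_derive_eq (is_deriveM d1 d2) _ => /=.
    by rewrite /GRing.scale/=; ring.
  apply: is_derive_eq (is_derive1_comp (dg x^-1) di) _.
  rewrite /flat x0 -exprVn !exprS; case: k {dg} => [|k]; first by rewrite expr0; ring.
  by rewrite -pred_Sn !exprS; ring.
- rewrite !flat_le0// mulr0 subr0; apply: (@is_derive_quad _ _ _ (k.+2%:R ^+ k.+2)).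
  by near=> y; rewrite (flat_le0 _ (lexx 0)) !subr0; exact: flat_quad.
Unshelve. all: by end_near. Qed.

Lemma Cn1D n (D : set R) (f g : R -> R) : open D ->
  Cn1 n D f -> Cn1 n D g -> Cn1 n D (fun x => f x + g x).
Proof.
move=> oD; elim: n f g => [|n IH] f g Cf Cg.
  by split => // x Dx; exact: (continuousD (Cn1_cont Cf Dx) (Cn1_cont Cg Dx)).
apply: (@Cn1_intro _ _ _ _ (fun x => derive1 f x + derive1 g x)) => //.
  move=> x Dx; rewrite !derive1E.
  by apply: is_deriveD; apply: derivableP; [exact: Cf.2.1|exact: Cg.2.1].
by apply: IH; [exact: Cf.2.2|exact: Cg.2.2].
Qed.

Lemma Cn1Z n (D : set R) (c : R) (f : R -> R) : open D ->
  Cn1 n D f -> Cn1 n D (fun x => c * f x).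
Proof.
move=> oD; elim: n f => [|n IH] f Cf.
  by split => // x Dx; exact: (continuousM (@cst_continuous _ _ c x) (Cn1_cont Cf Dx)).
apply: (@Cn1_intro _ _ _ _ (fun x => c * derive1 f x)) => //.
  move=> x Dx; rewrite !derive1E.
  by apply: (@is_deriveZ _ _ _ f c); apply: derivableP; exact: Cf.2.1.
by apply: IH; exact: Cf.2.2.
Qed.

Lemma Cn1_flat n k : Cn1 n setT (flat k).
Proof.
elim: n k => [|n IH] k.
  split => // x _; apply: derivable1_cont; exact: (@ex_derive _ _ _ _ _ _ _ (is_derive_flat k x)).
apply: (@Cn1_intro _ _ _ _ (fun x => flat k.+2 x + - k%:R * flat k.+1 x)).
- exact: openT.
- by move=> x _; rewrite mulNr; exact: is_derive_flat.
- apply: Cn1D; [exact: openT|exact: IH|apply: Cn1Z; [exact: openT|exact: IH]].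
Qed.

Lemma flat_ge0 k x : 0 <= flat k x.
Proof.
rewrite /flat; case: ifP => // x0; rewrite mulr_ge0 ?expR_ge0// exprn_ge0//.
by rewrite invr_ge0 ltW.
Qed.

Lemma flat0_le1 x : flat 0 x <= 1.
Proof.
rewrite /flat; case: ifP => // x0; rewrite expr0 mul1r -expR0 ler_expR oppr_le0.
by rewrite invr_ge0 ltW.
Qed.

Lemma cvg_flat0 x : 0 < x -> flat 0 (n.+1%:R * x) @[n --> \oo] --> (1 : R).
Proof.
move=> x0.
have -> : (fun n => flat 0 (n.+1%:R * x)) = (fun n => expR (- (n.+1%:R^-1 * x^-1))).
  by apply/funext => n; rewrite /flat mulr_gt0// expr0 mul1r invfM mulrC.
rewrite -[X in _ --> X]expR0; apply: continuous_cvg; first exact: continuous_expR.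
rewrite -[X in _ --> X]oppr0; apply: cvgN; rewrite -[X in _ --> X](mul0r x^-1).
by apply: cvgM; [exact: cvg_harmonic|exact: cvg_cst].
Qed.

Definition obox (a b : E4) : set E4 := [set x | forall k, a 0 k < x 0 k < b 0 k].

(** Smooth, with values in [0, 1], zero off the open box, and convergent to the indicator of that
    box as [n] grows: these test functions turn an identity against all test functions into one on
    boxes. *)
Definition bump (a b : E4) (n : nat) (x : E4) : R :=
  \prod_(k < 4) (flat 0 (n.+1%:R * (x 0 k - a 0 k)) * flat 0 (n.+1%:R * (b 0 k - x 0 k))).

Lemma bump_smooth a b n : smooth_on setT (bump a b n).
Proof.
apply/smooth_onP => m; apply: Cn_prod; first exact: openT.
move=> k _; apply: CnM; first exact: openT.
  apply: (Cn_comp (D := setT)) => //; [exact: openT|exact: Cn1_flat|].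
  apply: CnM; [exact: openT|apply: Cn_cst; exact: openT|].
  apply: CnB; [exact: openT|exact: Cn_coord openT|apply: Cn_cst; exact: openT].
apply: (Cn_comp (D := setT)) => //; [exact: openT|exact: Cn1_flat|].
apply: CnM; [exact: openT|apply: Cn_cst; exact: openT|].
apply: CnB; [exact: openT|apply: Cn_cst; exact: openT|exact: Cn_coord openT].
Qed.

Lemma bump_ge0 a b n x : 0 <= bump a b n x.
Proof. by apply: prodr_ge0 => k _; rewrite mulr_ge0// flat_ge0. Qed.

Lemma bump_le1 a b n x : bump a b n x <= 1.
Proof.
apply: prodr_ile1 => k _; rewrite mulr_ge0 ?flat_ge0//=.
by rewrite mulr_ile1 ?flat_ge0 ?flat0_le1.
Qed.

Lemma bump_out a b n x : ~ obox a b x -> bump a b n x = 0.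
Proof.
move=> /existsNP[k /negP]; rewrite negb_and -!leNgt => h.
rewrite /bump (bigD1 k)//=.
have -> : flat 0 (n.+1%:R * (x 0 k - a 0 k)) * flat 0 (n.+1%:R * (b 0 k - x 0 k)) = 0.
  case/orP: h => h.
    by rewrite flat_le0 ?mul0r// pmulr_rle0// subr_le0.
  by rewrite [X in _ * X]flat_le0 ?mulr0// pmulr_rle0// subr_le0.
by rewrite mul0r.
Qed.

Lemma cvg_bump a b x : obox a b x -> bump a b n x @[n --> \oo] --> (1 : R).
Proof.
move=> h; rewrite [X in _ --> X](_ : _ = \prod_(k < 4) (1 * 1 : R)); last first.
  by rewrite mulr1 big1.
apply: cvg_big; first exact: mul_continuous.
move=> k _; have /andP[h1 h2] := h k.
by apply: cvgM; apply: cvg_flat0; rewrite subr_gt0.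
Qed.

End FlatFunction.

(** * The fundamental lemma of the calculus of variations *)

Section NullFunctions.
Context {R : realType}.
Local Notation E4 := 'rV[R]_4.
Local Notation mR := (measurableTypeR R).
Local Notation mu := (@leb4 R).

Definition oboxes : set (set (X4 R)) :=
  [set A | exists a b : E4, A = pre4 obox a b].

Lemma measurable_obox (a b : E4) : measurable (pre4 obox a b).
Proof.
rewrite (_ : _ @^-1` _ = \bigcap_(k in [set: 'I_4])
    ((fun p : (X4 R) => vec4 p 0 k) @^-1` `]a 0 k, b 0 k[)).
  apply: fin_bigcap_measurable; first exact: finite_finset.
  move=> k _; rewrite -[X in measurable X]setTI; apply: measurable_coord4 => //.
apply/seteqP; split=> [x h k _ /=|x h k]; first by rewrite in_itv/=; exact: h.
by have := h k I; rewrite /= in_itv.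
Qed.

Lemma oboxes_setI : setI_closed oboxes.
Proof.
move=> _ _ [a [b ->]] [c [d ->]].
exists (\row_k Num.max (a 0 k) (c 0 k)), (\row_k Num.min (b 0 k) (d 0 k)).
apply/seteqP; split=> [p [h1 h2] k|p h].
  move: (h1 k) (h2 k); rewrite !mxE gt_max lt_min => /andP[-> ->].
  by move=> /andP[-> ->].
by split=> k; have := h k; rewrite !mxE gt_max lt_min => /andP[/andP[? ?] /andP[? ?]]; apply/andP; split.
Qed.

(** Only one inclusion has content: the identity is measurable from the sigma-algebra generated by
    boxes as soon as its four coordinates are, and a half-space is a countable union of open
    boxes. *)
Lemma measurable_oboxes : @measurable _ (X4 R) = <<s oboxes >>.
Proof.
apply/seteqP; split; last first.
  apply: smallest_sub; first exact: sigma_algebra_measurable.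
  by move=> _ [a [b ->]]; exact: measurable_obox.
pose T' := g_sigma_algebraType oboxes.
have mc (k : 'I_4) : measurable_fun [set: T'] ((fun p : (X4 R) => vec4 p 0 k) : T' -> mR).
  apply: (measurability _ (RGenOInfty.measurableE R)) => /= _ [_ [t ->] <-].
  rewrite setTI (_ : _ @^-1` _ = \bigcup_n (@vec4 R @^-1`
      obox (\row_j if j == k then t else - n%:R) (\row_j n%:R))).
    apply: bigcup_measurable => n _; apply: sub_sigma_algebra; by do 2!eexists.
  apply/seteqP; split=> [p /=|p [n _ h] /=].
    rewrite in_itv/= andbT => tp.
    exists (Num.Def.truncn (\sum_(j < 4) `|vec4 p 0 j|)).+1 => // j; rewrite !mxE.
    have hj : `|vec4 p 0 j| < (Num.Def.truncn (\sum_(j < 4) `|vec4 p 0 j|)).+1%:R.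
      apply: le_lt_trans (truncnS_gt _).
      by rewrite (bigD1 j)//= lerDl sumr_ge0.
    move: hj tp; rewrite ltr_norml !mxE => /andP[h1 h2] tp; rewrite h2 andbT.
    by case: eqP => [->|_].
  by have := h k; rewrite !mxE eqxx in_itv/= andbT => /andP[].
have mid : measurable_fun [set: T'] (id : T' -> (X4 R)).
  have E0 : (fun p : (X4 R) => p.1.1.1) = (fun p => vec4 p 0 0) by apply/funext => p; rewrite mxE.
  have E1 : (fun p : (X4 R) => p.1.1.2) = (fun p => vec4 p 0 1) by apply/funext => p; rewrite mxE.
  have E2 : (fun p : (X4 R) => p.1.2) = (fun p => vec4 p 0 2%:R) by apply/funext => p; rewrite mxE.
  have E3 : (fun p : (X4 R) => p.2) = (fun p => vec4 p 0 3%:R) by apply/funext => p; rewrite mxE.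
  apply/measurable_fun_pairP; split; last by rewrite (_ : _ \o _ = (fun p : (X4 R) => p.2))// E3.
  apply/measurable_fun_pairP; split; last by rewrite (_ : _ \o _ = (fun p : (X4 R) => p.1.2))// E2.
  apply/measurable_fun_pairP; split.
    by rewrite (_ : _ \o _ = (fun p : (X4 R) => p.1.1.1))// E0.
  by rewrite (_ : _ \o _ = (fun p : (X4 R) => p.1.1.2))// E1.
by move=> A mA; have := mid measurableT A mA; rewrite setTI.
Qed.

Lemma integral_supp d (T : measurableType d) (m : {measure set T -> \bar R})
    (D E : set T) (f : T -> \bar R) :
  D `<=` E -> (forall x, E x -> ~ D x -> f x = 0%E) ->
  (\int[m]_(x in E) f x = \int[m]_(x in D) f x)%E.
Proof.
move=> DE f0; rewrite -[in RHS](setIidr DE) integral_mkcondr.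
apply: eq_integral => x /set_mem Ex; rewrite patchE.
by case: ifPn => // /negP xD; apply: f0 => // Dx; apply: xD; exact: mem_set.
Qed.

Lemma ball_obox (c : E4) (r : R) : 0 < r ->
  ball c r = obox (c - const_mx r) (c + const_mx r).
Proof.
move=> r0; apply/seteqP; split=> [x /ballP4[_ h] k|x h].
  have := h k; rewrite !mxE ltr_norml => /andP[? ?]; apply/andP; split; lra.
apply/ballP4; split => // k; have := h k; rewrite !mxE ltr_norml => /andP[? ?].
by apply/andP; split; lra.
Qed.

Lemma ball_sub_cball (c : E4) (r : R) : ball c r `<=` cball c r.
Proof.
move=> x /ballP4[r0 h]; apply/norm4_ler; split; first exact: ltW.
by move=> k; have := h k; rewrite !mxE => /ltW.
Qed.

(** By dominated convergence along bumps, [h] has integral zero over the part of the ball in any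
    open box. The sets with this property form a Dynkin system and the boxes a generating system
    stable under intersection, so the integral vanishes over every measurable part of the ball. *)
Lemma null_on_ball (U : set E4) (h : E4 -> R) (c : E4) (r : R) :
  open U -> 0 < r -> cball c r `<=` U ->
  mu.-integrable (pre4 cball c r) (EFin \o (h \o @vec4 R)) ->
  (forall phi, test_fun U phi -> int4 U (fun x => h x * phi x) = 0) ->
  ae_eq mu (pre4 ball c r) (EFin \o (h \o @vec4 R)) (cst 0%E).
Proof.
move=> oU r0 cU ih h0.
set D := pre4 ball c r.
have mD : measurable D by exact: measurable_ball4.
have DU : D `<=` pre4 U.
  by move=> p /ball_sub_cball; exact: cU.
have iD : mu.-integrable D (EFin \o (h \o @vec4 R)).
  apply: integrableS ih => //; first by apply: closed_measurable4; exact: cball_closed.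
  by move=> p; exact: ball_sub_cball.
have step (a b : E4) :
    (\int[mu]_(p in D `&` pre4 obox a b) (h (vec4 p))%:E = 0)%E.
  (* The first factor keeps the support inside the compact [cball c r], whatever the box. *)
  pose phi n x := bump (c - const_mx r) (c + const_mx r) n x * bump a b n x.
  have phi_out n x : ~ ball c r x -> phi n x = 0.
    by move=> nx; rewrite /phi bump_out ?mul0r// -ball_obox.
  have tphi n : test_fun U (phi n).
    split.
      apply/smooth_onP => m; apply: CnM; first exact: openT.
        exact: (smooth_onP _ _).1 (bump_smooth _ _ _) m.
      exact: (smooth_onP _ _).1 (bump_smooth _ _ _) m.
    exists (cball c r); split => //; first exact: cball_compact.
    by move=> x nx; apply: phi_out => /ball_sub_cball.
  have phi01 n x : `|phi n x| <= 1.
    rewrite /phi normrM !ger0_norm ?bump_ge0//.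
    by rewrite mulr_ile1 ?bump_ge0 ?bump_le1.
  have mphi n : measurable_fun D (phi n \o @vec4 R).
    apply: (measurable_funS (E := setT)) => //.
    apply: (@cont_measurable4 _ setT); first exact: openT.
    have [/smooth_onP sp _] := tphi n.
    by move=> x _; exact: Cn_cont (sp 0%N) _ I.
  have mh : measurable_fun D (h \o @vec4 R).
    by apply/measurable_EFinP; exact: (measurable_int _ iD).
  pose f_ n p := (h (vec4 p) * phi n (vec4 p))%:E.
  pose f p := (h (vec4 p) * \1_(pre4 obox a b) p)%:E.
  have mo := measurable_obox a b.
  have mf_ n : measurable_fun D (f_ n).
    by apply/measurable_EFinP; exact: (measurable_funM mh (mphi n)).
  have mf : measurable_fun D f.
    by apply/measurable_EFinP; apply: (measurable_funM mh).
  have if_ n : mu.-integrable D (f_ n).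
    apply: (le_integrable mD (mf_ n) _ iD) => p Dp; rewrite /f_ lee_fin normrM.
    by rewrite ler_piMr.
  have f_f : {ae mu, forall p, D p -> f_ ^~ p @ \oo --> f p}.
    apply: aeW => p Dp; apply: cvg_EFin; first exact: nearW.
    apply: cvgM; first exact: cvg_cst.
    rewrite indicE; have [/set_mem hp|/negP np] := boolP (p \in _).
      rewrite -[X in _ --> X]mulr1; apply: cvgM; apply: cvg_bump => //.
      by rewrite -ball_obox.
    rewrite [X in X @ _ --> _](_ : _ = cst 0); first exact: cvg_cst.
    apply/funext => n; rewrite /= /phi [X in _ * X]bump_out ?mulr0// => op.
    by apply: np; rewrite inE.
  have f_g : {ae mu, forall p n, D p -> (`|f_ n p| <= `|(h (vec4 p))%:E|)%E}.
    by apply: aeW => p n Dp; rewrite /f_ /= lee_fin normrM ler_piMr.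
  have [_ _] := dominated_convergence mD mf_ mf f_f (integrable_abse iD) f_g.
  have -> : [sequence \int[mu]_(x in D) f_ n x]_n%E = cst 0%E.
    apply/funext => n /=.
    have := h0 _ (tphi n); rewrite /int4 /Rintegral.
    rewrite (@integral_supp _ _ _ D); last 2 first.
    - exact: DU.
    - by move=> p _ np; rewrite phi_out ?mulr0.
    move=> e0; rewrite -[LHS]fineK ?e0//; exact: integrable_fin_num.
  move=> H; rewrite integral_mkcondr.
  have := cvg_unique _ H (cvg_cst _) => e; rewrite -e//.
  apply: eq_integral => p _; rewrite /f patchE indicE.
  by case: ifPn => _; rewrite ?mulr1 ?mulr0.
have DO : D = pre4 obox (c - const_mx r) (c + const_mx r) by rewrite /D ball_obox.
have mDO A : measurable A -> measurable (D `&` A) by move=> mA; exact: measurableI.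
have iDO A : measurable A -> mu.-integrable (D `&` A) (EFin \o (h \o @vec4 R)).
  by move=> mA; apply: integrableS iD => //; exact: mDO.
have all0 A : measurable A -> (\int[mu]_(p in D `&` A) (h (vec4 p))%:E = 0)%E.
  rewrite measurable_oboxes; move: A; apply: dynkin_induction.
  - exact: measurable_oboxes.
  - exact: oboxes_setI.
  - by rewrite setIT -[D]setIid [X in D `&` X]DO step.
  - by move=> _ [a [b ->]]; exact: step.
  - move=> S mS S0.
    have := @integral_setU _ _ _ mu (D `&` S) (D `&` ~` S) (EFin \o (h \o @vec4 R)).
    rewrite -setIUr setUv setIT => e.
    have : (\int[mu]_(p in D) (h (vec4 p))%:E = 0)%E.
      by rewrite -[D]setIid [X in D `&` X]DO step.
    rewrite e; first by rewrite S0 add0e.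
    + exact: mDO.
    + by apply: mDO; exact: measurableC.
    + exact: (measurable_int _ iD).
    + apply/disj_setPS => x [[_ ?] [_]]; exact.
  - move=> F mF tF F0; rewrite setI_bigcupr integral_bigcup.
    + by rewrite eseries0.
    + exact: trivIset_setIl.
    + by move=> k; exact: mDO.
    + by rewrite -setI_bigcupr; apply: iDO; exact: bigcup_measurable.
apply: integral_ae_eq => //.
move=> E ED mE; rewrite integral0.
by rewrite -[RHS](all0 E mE) setIidr.
Qed.

End NullFunctions.

(** * Weak derivatives *)

Section WeakDerivatives.
Context {R : realType}.
Local Notation E4 := 'rV[R]_4.
Local Notation mu := (@leb4 R).
Implicit Types (U K : set E4) (f u v phi : E4 -> R).

Lemma aeS4 (P Q : X4 R -> Prop) : (forall p, P p -> Q p) ->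
  {ae mu, forall p, P p} -> {ae mu, forall p, Q p}.
Proof. by move=> PQ; apply: negligibleS => p; apply: contra_not => /PQ. Qed.

(** Countably many rational balls whose closed balls lie in [U] cover [U]; the exceptional set is a
    countable union of negligible ones. *)
Lemma ae_null_on_open U (h : E4 -> R) : open U ->
  (forall K, compact K -> K `<=` U -> mu.-integrable (pre4 K) (EFin \o (h \o @vec4 R))) ->
  (forall phi, test_fun U phi -> int4 U (fun x => h x * phi x) = 0) ->
  {ae mu, forall p, U (vec4 p) -> h (vec4 p) = 0}.
Proof.
move=> oU ih h0.
pose ok (a : ratc) := 0 < ratradius (R := R) a /\ cball (ratcenter a) (ratradius a) `<=` U.
pose bad (a : ratc) : set (X4 R) :=
  [set p | ok a /\ ball (ratcenter a) (ratradius a) (vec4 p) /\ h (vec4 p) != 0].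
have nbad a : mu.-negligible (bad a).
  have [[r0 aU]|nok] := pselect (ok a); last first.
    by rewrite (_ : bad a = set0); [exact: negligible_set0|rewrite -subset0 => p [/nok]].
  have := null_on_ball oU r0 aU (ih _ (@cball_compact R _ _) aU) h0.
  apply: negligibleS => p [_ [pb hp]] /= /(_ pb) [] e.
  by rewrite e eqxx in hp.
pose F n : set (X4 R) := if unpickle n is Some a then bad a else set0.
have nF : mu.-negligible (\bigcup_n F n).
  apply: negligible_bigcup => n; rewrite /F; case: unpickle => //.
  exact: negligible_set0.
apply: negligibleS nF => p /= /not_implyP[Up hp].
have [a [ap aU]] := ratball_near oU Up.
have ba : bad a p.
  by split; [split=> //; case/ballP4 : ap|split=> //; apply/eqP].
have Fa : F (pickle a) = bad a by rewrite /F pickleK.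
by move: ba; rewrite -Fa => Fp; exact: (bigcup_sup (i := pickle a) I Fp).
Qed.

Lemma L2loc_integrable U K v : open U -> L2loc U v -> compact K -> K `<=` U ->
  mu.-integrable (pre4 K) (EFin \o (v \o @vec4 R)).
Proof.
move=> oU [mv v2] cK KU.
have mK : measurable (pre4 K).
  by apply: closed_measurable4; apply: compact_closed => //; exact: norm_hausdorff.
have mvK : measurable_fun (pre4 K) (v \o @vec4 R).
  by apply: measurable_funS mv; [exact: open_measurable4|exact: preimage_subset].
(* Domination by 1 + v^2, integrable because a compact set has finite measure. *)
apply: (@le_integrable _ _ _ _ _ mK _ (EFin \o (fun p => 1 + v (vec4 p) ^+ 2))).
- exact/measurable_EFinP.
- move=> p _ /=; rewrite lee_fin [leRHS]ger0_norm ?addr_ge0 ?sqr_ge0//.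
  have : 0 <= (`|v (vec4 p)| - 1) ^+ 2 by exact: sqr_ge0.
  rewrite sqrrB1 real_normK ?num_real// => ?.
  by have := sqr_ge0 (v (vec4 p)); have := normr_ge0 (v (vec4 p)); lra.
- rewrite (_ : _ \o _ = (cst 1%E \+ (EFin \o (fun p => (v (vec4 p) ^+ 2)%R)))%E)//.
  apply: integrableD => //.
    apply/integrableP; split => //; rewrite integral_cst//= normr1 mul1e.
    exact: leb4_compact_lty.
  apply/integrableP; split.
    by apply/measurable_EFinP; exact: measurable_funX.
  rewrite (eq_integral (EFin \o (fun p : X4 R => v (vec4 p) ^+ 2))); first exact: v2.
  by move=> p _ /=; rewrite ger0_norm ?sqr_ge0.
Qed.

Lemma compact_openC K : compact K -> open (~` K).
Proof.
by move=> cK; apply: closed_openC; apply: compact_closed => //; exact: norm_hausdorff.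
Qed.

Lemma pd_off f K k x : compact K -> (forall x, ~ K x -> f x = 0) -> ~ K x ->
  pd k f x = 0.
Proof.
move=> cK f0 nKx.
by rewrite (pd_eq k (compact_openC cK) nKx (g := fun=> 0)) /pd ?derive_cst.
Qed.

Lemma test_zero U phi : test_fun U phi -> exists K,
  [/\ compact K, K `<=` U, (forall x, ~ K x -> phi x = 0) &
      forall k x, ~ K x -> pd k phi x = 0].
Proof.
move=> [sphi [K [cK KU p0]]]; exists K; split => // k x; exact: pd_off.
Qed.

Lemma L2loc_mul_integrable U K v phi : open U -> L2loc U v -> compact K -> K `<=` U ->
  (forall x, {for x, continuous phi}) -> (forall x, ~ K x -> phi x = 0) ->
  mu.-integrable (pre4 U) (EFin \o ((fun x => v x * phi x) \o @vec4 R)).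
Proof.
move=> oU Lv cK KU cphi p0.
have mK : measurable (pre4 K).
  by apply: closed_measurable4; apply: compact_closed => //; exact: norm_hausdorff.
have mU : measurable (pre4 U) by exact: open_measurable4.
have [M hM] := cont_compact_bounded cK (fun x _ => cphi x).
have iK := L2loc_integrable oU Lv cK KU.
have mphi : measurable_fun (pre4 U) (phi \o @vec4 R) by exact: cont_measurable4.
apply/(integrable_mkcond _ mU).
apply: (@le_integrable _ _ _ _ _ measurableT _
  ((fun p => M%:E * (EFin \o (v \o @vec4 R)) p)%E \_ (pre4 K))).
- apply/(measurable_restrictT _ mU); apply/measurable_EFinP.
  by apply: measurable_funM => //; case: Lv.
- move=> p _; rewrite !patchE.
  have [pK|pK] := boolP (p \in pre4 K).
    have -> : p \in pre4 U by rewrite inE; apply: KU; exact: set_mem.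
    rewrite /= lee_fin !normrM mulrC; apply: ler_wpM2r => //.
    by apply: le_trans (ler_norm M); apply: hM; exact: set_mem.
  case: ifPn => //= _; rewrite p0 ?mulr0//.
  by move=> Kp; move: pK; rewrite notin_setE.
- by apply/(integrable_mkcond _ mK); exact: (integrableZl mK M iK).
Qed.

Lemma cont_L2loc U v : open U -> (forall x, U x -> {for x, continuous v}) -> L2loc U v.
Proof.
move=> oU cv; split; first exact: cont_measurable4.
move=> K cK KU.
have [M hM] := cont_compact_bounded cK (fun x Kx => cv x (KU x Kx)).
have mK : measurable (pre4 K).
  by apply: closed_measurable4; apply: compact_closed => //; exact: norm_hausdorff.
have mvK : measurable_fun (pre4 K) (v \o @vec4 R).
  apply: (measurable_funS (E := pre4 U)); last exact: cont_measurable4.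
  - exact: open_measurable4.
  - exact: preimage_subset.
apply: (@le_lt_trans _ _ (\int[mu]_(p in pre4 K) (cst (M ^+ 2)%:E p))%E).
  apply: ge0_le_integral => //.
  - by move=> p _; rewrite lee_fin sqr_ge0.
  - by apply/measurable_EFinP; exact: measurable_funX.
  - by move=> p Kp; rewrite /cst lee_fin -real_normK ?num_real// lerXn2r ?nnegrE//;
      [exact: le_trans (hM _ Kp)|exact: hM].
rewrite integral_cst//= lte_mul_pinfty ?lee_fin ?sqr_ge0//.
exact: leb4_compact_lty.
Qed.

Lemma is_wpd_unique U k u v1 v2 : open U -> is_wpd U k u v1 -> is_wpd U k u v2 ->
  {ae mu, forall p, U (vec4 p) -> v1 (vec4 p) = v2 (vec4 p)}.
Proof.
move=> oU [L1 h1] [L2 h2].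
have : {ae mu, forall p, U (vec4 p) -> v1 (vec4 p) - v2 (vec4 p) = 0}.
  apply: (@ae_null_on_open U (fun x => v1 x - v2 x)) => //.
    move=> K cK KU.
    have mK : measurable (pre4 K).
      by apply: closed_measurable4; apply: compact_closed => //; exact: norm_hausdorff.
    exact: (integrableB mK (L2loc_integrable oU L1 cK KU) (L2loc_integrable oU L2 cK KU)).
  move=> phi tphi; have [K [cK KU p0 _]] := test_zero tphi.
  have cphi x : {for x, continuous phi}.
    by case: tphi => /smooth_onP/(_ 0%N)[h _] _; exact: h.
  have i1 := L2loc_mul_integrable oU L1 cK KU cphi p0.
  have i2 := L2loc_mul_integrable oU L2 cK KU cphi p0.
  have : int4 U (fun x => v1 x * phi x) - int4 U (fun x => v2 x * phi x) = 0.
    by apply/eqP; rewrite subr_eq0 -eqr_opp -h1// -h2.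
  rewrite /int4 -(RintegralB (open_measurable4 oU) i1 i2) => <-.
  by apply: eq_Rintegral => p _; rewrite /= mulrBl.
by apply: aeS4 => p h /h /eqP; rewrite subr_eq0 => /eqP.
Qed.

Lemma is_derive_line (F : E4 -> R) (v z : E4) (s d : R) :
  is_derive (s *: v + z) v F d -> is_derive s 1 (fun t : R => F (t *: v + z)) d.
Proof.
have E : (fun h : R => h^-1 *: (((fun t : R => F (t *: v + z)) \o shift s) (h *: 1) - F (s *: v + z)))
   = (fun h : R => h^-1 *: ((F \o shift (s *: v + z)) (h *: v) - F (s *: v + z))).
  by apply/funext => h /=; rewrite [h%:A]mulr1 scalerDl addrA.
move=> [dF <-]; apply: DeriveDef.
  by rewrite /derivable E.
by rewrite /derive E.
Qed.

Lemma integral1_derive0 (f df : R -> R) (r : R) : 0 < r ->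
  (forall t : R, is_derive t 1 f (df t)) -> continuous df ->
  (forall t, r < `|t| -> f t = 0) -> (\int[lebesgue_measure]_t (df t)%:E = 0)%E.
Proof.
move=> r0 fd cdf f0.
have df0 t : r < `|t| -> df t = 0.
  move=> rt; have [_ <-] := fd t.
  rewrite (@near_eq_derive _ _ _ f (fun=> 0)) ?derive_cst//.
  near=> y; apply: f0; near: y.
  have : (fun y : R => `|y|) @ t --> `|t| by exact: norm_continuous.
  by move=> /(_ _ (lt_nbhsr rt)).
have cf : continuous f by move=> t; apply: derivable1_cont; case: (fd t).
transitivity (\int[lebesgue_measure]_(t in `[(- (r + 1))%R, (r + 1)%R]%classic) (df t)%:E)%E.
  apply: integral_supp => // t _ /=; rewrite in_itv/= => ht; rewrite df0// ltNge; apply/negP.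
  by rewrite ler_norml => /andP[? ?]; apply: ht; apply/andP; split; lra.
rewrite (@continuous_FTC2 _ df f)//.
- have r1 : r < `|r + 1| by rewrite ger0_norm; lra.
  by rewrite !f0 ?normrN// subee.
- lra.
- exact: continuous_subspaceT.
- split.
  + by move=> t _; exact: (@ex_derive _ _ _ _ _ _ _ (fd t)).
  + by apply: cvg_at_right_filter; exact: cf.
  + by apply: cvg_at_left_filter; exact: cf.
- by move=> t _; rewrite derive1E; exact: (@derive_val _ _ _ _ _ _ _ (fd t)).
Unshelve. all: by end_near. Qed.

End WeakDerivatives.

(** * Integrals that vanish by Fubini's theorem *)

Section FubiniZero.
Context d1 d2 (T1 : measurableType d1) (T2 : measurableType d2) (R : realType).
Variables (m1 : {sigma_finite_measure set T1 -> \bar R})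
          (m2 : {sigma_finite_measure set T2 -> \bar R}).
Local Open Scope ereal_scope.

(* The sigma-finite instance of the library on [m1 \x m2] is shadowed by the one
   for sub-probabilities, whence a named copy of the product. *)
Definition sfprod : set (T1 * T2)%type -> \bar R := m1 \x m2.

HB.instance Definition _ := Measure.copy sfprod (m1 \x m2).

Lemma sfprod_sigma_finite : sigma_finite setT sfprod.
Proof.
have /sigma_finiteP[F [TF ndF Foo]] := sigma_finiteT m1.
have /sigma_finiteP[G [TG ndG Goo]] := sigma_finiteT m2.
exists (fun n => F n `*` G n); last first.
  move=> n; have [mF Fn] := Foo n; have [mG Gn] := Goo n.
  split; first exact: measurableX.
  by rewrite /sfprod product_measure1E// lte_mul_pinfty// ge0_fin_numE.
apply/esym/seteqP; split=> // -[x y] _.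
have [i _ Fix] : (\bigcup_i F i) x by rewrite -TF.
have [j _ Gjy] : (\bigcup_i G i) y by rewrite -TG.
exists (maxn i j) => //; split => /=.
  by move: x Fix; exact/subsetPset/ndF/leq_maxl.
by move: y Gjy; exact/subsetPset/ndG/leq_maxr.
Qed.

HB.instance Definition _ := Measure_isSigmaFinite.Build _ _ _ sfprod sfprod_sigma_finite.

Lemma product_sigma_finite :
  exists s : {sigma_finite_measure set (T1 * T2)%type -> \bar R}, s = m1 \x m2 :> (set _ -> \bar R).
Proof. by exists sfprod. Qed.

Lemma fubini_eq0_inner2 (f : T1 * T2 -> \bar R) : measurable_fun setT f ->
  \int[m1 \x m2]_z `|f z| < +oo ->
  (forall x, \int[m2]_y f (x, y) = 0) -> \int[m1 \x m2]_z f z = 0.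
Proof.
move=> mf foo f0; rewrite -integral12_prod_meas1//; last exact/integrableP.
rewrite /fubini_F.
by under eq_integral do rewrite f0; rewrite integral0.
Qed.

(** The hypothesis concerns only measurable sections with finite absolute integral, so that the
    lemma can be applied again to these sections in a longer product. The remaining [y] form a null
    set, discarded by [null_eq_integral]. *)
Lemma fubini_eq0_inner1 (f : T1 * T2 -> \bar R) : measurable_fun setT f ->
  \int[m1 \x m2]_z `|f z| < +oo ->
  (forall y, measurable_fun setT (fun x => f (x, y)) -> \int[m1]_x `|f (x, y)| < +oo ->
     \int[m1]_x f (x, y) = 0) ->
  \int[m1 \x m2]_z f z = 0.
Proof.
move=> mf foo f0; have fi : (m1 \x m2).-integrable setT f by exact/integrableP.
rewrite -integral21_prod_meas1// /fubini_G.
have [N [mN N0 sN]] := ae_integrable2 fi.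
rewrite (null_eq_integral (g := cst 0) mN N0) ?integral0// => y _ Ny.
have /integrableP[? ?] : m1.-integrable setT (fun x => f (x, y)).
  by apply: contrapT => h; exact/Ny/sN.
exact: f0.
Qed.
End FubiniZero.

Section FubiniZero4.
Context d (T : measurableType d) (R : realType).
Variables (m : {sigma_finite_measure set T -> \bar R}).
Variable f : T * T * T * T -> \bar R.
Local Open Scope ereal_scope.
Local Notation m4 := (m \x m \x m \x m).
Hypothesis mf : measurable_fun setT f.
Hypothesis foo : \int[m4]_p `|f p| < +oo.

(** In these four lemmas the coordinates after the chosen one are fixed, starting from the last, and
    the chosen one is then integrated innermost. [M2] and [M3] supply the sigma-finite structures on
    the partial products. *)
Lemma fubini4_eq0_0 : (forall x2 x3 x4, \int[m]_x f (x, x2, x3, x4) = 0) ->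
  \int[m4]_p f p = 0.
Proof.
move=> f0; have [M2 E2] := product_sigma_finite m m.
have [M3 E3] := product_sigma_finite M2 m.
move: foo; rewrite -!E2 -!E3 => ioo.
apply: (fubini_eq0_inner1 mf ioo) => x4 m1; rewrite E3 => i1.
apply: (fubini_eq0_inner1 m1 i1) => x3 m2; rewrite E2 => i2.
by apply: (fubini_eq0_inner1 m2 i2) => x2 _ _.
Qed.

Lemma fubini4_eq0_1 : (forall x1 x3 x4, \int[m]_x f (x1, x, x3, x4) = 0) ->
  \int[m4]_p f p = 0.
Proof.
move=> f0; have [M2 E2] := product_sigma_finite m m.
have [M3 E3] := product_sigma_finite M2 m.
move: foo; rewrite -!E2 -!E3 => ioo.
apply: (fubini_eq0_inner1 mf ioo) => x4 m1; rewrite E3 => i1.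
apply: (fubini_eq0_inner1 m1 i1) => x3 m2; rewrite E2 => i2.
by apply: (fubini_eq0_inner2 m2 i2) => x1.
Qed.

Lemma fubini4_eq0_2 : (forall x1 x2 x4, \int[m]_x f (x1, x2, x, x4) = 0) ->
  \int[m4]_p f p = 0.
Proof.
move=> f0; have [M2 E2] := product_sigma_finite m m.
have [M3 E3] := product_sigma_finite M2 m.
move: foo; rewrite -!E2 -!E3 => ioo.
apply: (fubini_eq0_inner1 mf ioo) => x4 m1; rewrite E3 => i1.
by apply: (fubini_eq0_inner2 m1 i1) => -[x1 x2].
Qed.

Lemma fubini4_eq0_3 : (forall x1 x2 x3, \int[m]_x f (x1, x2, x3, x) = 0) ->
  \int[m4]_p f p = 0.
Proof.
move=> f0; have [M2 E2] := product_sigma_finite m m.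
have [M3 E3] := product_sigma_finite M2 m.
move: foo; rewrite -!E2 -!E3 => ioo.
by apply: (fubini_eq0_inner2 mf ioo) => -[[x1 x2] x3].
Qed.

End FubiniZero4.

(** * Integration by parts against test functions *)

Section IntegrationByParts.
Context {R : realType}.
Local Notation E4 := 'rV[R]_4.
Local Notation mu := (@leb4 R).
Local Notation leb := (@lebesgue_measure R).

Lemma integral_slice (F : E4 -> R) (K : set E4) (k : 'I_4) (z : E4) :
  Cn 1 setT F -> compact K -> (forall x, ~ K x -> F x = 0) ->
  (\int[leb]_t (pd k F (t *: delta_mx 0 k + z))%:E = 0)%E.
Proof.
move=> CF cK F0; have [r r0 Kr] := compact_sub_cball cK.
apply: (@integral1_derive0 _ (fun t => F (t *: delta_mx 0 k + z)) _ (r + `|z 0 k| + 1)).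
- by rewrite ltr_wpDl// addr_ge0.
- by move=> t; apply: is_derive_line; exact: Cn_is_derive CF I.
- move=> t; apply: (@continuous_comp _ _ _ (fun t : R => t *: delta_mx 0 k + z) (pd k F)).
    apply: cvgD; last exact: cvg_cst.
    by apply: cvgZr_tmp.
  by exact: (Cn_cont (Cn_pd k CF) I).
- move=> t rt; apply: F0 => /Kr; rewrite /cball /= sub0r normrN => h.
  have := le_trans (norm4_coord _ k) h; rewrite !mxE !eqxx mulr1 => {}h.
  have := ler_normB (t + z 0 k) (z 0 k); rewrite addrK; lra.
Qed.

Lemma integral_pd_eq0 (F : E4 -> R) (K : set E4) (k : 'I_4) :
  Cn 1 setT F -> compact K -> (forall x, ~ K x -> F x = 0) ->
  (\int[mu]_p (pd k F (vec4 p))%:E = 0)%E.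
Proof.
move=> CF cK F0.
have dF0 x : ~ K x -> pd k F x = 0 by exact: pd_off.
have iF : mu.-integrable setT (fun p => (pd k F (vec4 p))%:E).
  have -> : setT = pre4 [set: E4] :> set (X4 R) by [].
  apply: (@cc_integrable4 _ setT K (pd k F)) => //; first exact: openT.
    by move=> x _; exact: (Cn_cont (Cn_pd k CF) I).
  by move=> x _; exact: dF0.
have S := fun z => integral_slice k z CF cK F0.
have /integrableP[mF Foo] := iF.
elim/ord4_ind: k dF0 iF mF Foo S => dF0 iF mF Foo S.
- apply: (fubini4_eq0_0 mF Foo) => b c d.
  rewrite -[RHS](S (vec4 (0, b, c, d))); apply: eq_integral => t _.
  congr (pd _ _ _)%:E; apply/rowP => j; rewrite !mxE.
  by elim/ord4_ind: j; rewrite /= ?mulr1 ?mulr0 ?addr0 ?add0r.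
- apply: (fubini4_eq0_1 mF Foo) => a c d.
  rewrite -[RHS](S (vec4 (a, 0, c, d))); apply: eq_integral => t _.
  congr (pd _ _ _)%:E; apply/rowP => j; rewrite !mxE.
  by elim/ord4_ind: j; rewrite /= ?mulr1 ?mulr0 ?addr0 ?add0r.
- apply: (fubini4_eq0_2 mF Foo) => a b d.
  rewrite -[RHS](S (vec4 (a, b, 0, d))); apply: eq_integral => t _.
  congr (pd _ _ _)%:E; apply/rowP => j; rewrite !mxE.
  by elim/ord4_ind: j; rewrite /= ?mulr1 ?mulr0 ?addr0 ?add0r.
- apply: (fubini4_eq0_3 mF Foo) => a b c.
  rewrite -[RHS](S (vec4 (a, b, c, 0))); apply: eq_integral => t _.
  congr (pd _ _ _)%:E; apply/rowP => j; rewrite !mxE.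
  by elim/ord4_ind: j; rewrite /= ?mulr1 ?mulr0 ?addr0 ?add0r.
Qed.

(** [f] is controlled on [U] only, but [U] and the complement of the support of [phi] cover the
    whole space, and the product vanishes on the latter. *)
Lemma Cn_mul_test n U (f phi : E4 -> R) : open U -> Cn n U f -> test_fun U phi ->
  Cn n setT (fun x => f x * phi x).
Proof.
move=> oU Cf tphi; have [K [cK KU p0 _]] := test_zero tphi.
have oK := compact_openC cK.
apply: Cn_local => x _; have [Kx|nKx] := pselect (K x).
  exists U; split; first exact: KU.
  apply: CnM => //; apply: (Cn_sub (U := setT)) => //.
  by case: tphi => /smooth_onP h _; exact: h.
exists (~` K); split => //.
apply: (Cn_eq oK _ (Cn_cst n 0 oK)) => y nKy; rewrite p0 ?mulr0//.
Qed.

Lemma int_by_parts U k (f phi : E4 -> R) : open U -> Cn 1 U f -> test_fun U phi ->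
  int4 U (fun x => f x * pd k phi x) = - int4 U (fun x => pd k f x * phi x).
Proof.
move=> oU Cf tphi; have [K [cK KU p0 dp0]] := test_zero tphi.
have Cphi : Cn 1 setT phi by case: tphi => /smooth_onP h _; exact: h.
have CF := Cn_mul_test oU Cf tphi.
have F0 x : ~ K x -> f x * phi x = 0 by move=> /p0 ->; rewrite mulr0.
have E x : U x -> pd k (fun x => f x * phi x) x = f x * pd k phi x + pd k f x * phi x.
  move=> Ux; have := is_deriveM (Cn_is_derive k Cf Ux) (Cn_is_derive k Cphi (I : setT x)).
  by move=> [_ e]; rewrite [LHS]e /GRing.scale/= [X in _ + X]mulrC.
have i1 : mu.-integrable (pre4 U) (EFin \o ((fun x => f x * pd k phi x) \o @vec4 R)).
  apply: (cc_integrable4 oU cK KU) => x Ux; last by move=> /dp0 ->; rewrite mulr0.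
  by apply: (continuousM (Cn_cont Cf Ux)); exact: (Cn_cont (Cn_pd k Cphi) I).
have i2 : mu.-integrable (pre4 U) (EFin \o ((fun x => pd k f x * phi x) \o @vec4 R)).
  apply: (cc_integrable4 oU cK KU) => x Ux; last by move=> /p0 ->; rewrite mulr0.
  by apply: (continuousM (Cn_cont (Cn_pd k Cf) Ux)); exact: (Cn_cont Cphi I).
apply/eqP; rewrite -subr_eq0 opprK; apply/eqP.
rewrite /int4 -(RintegralD (open_measurable4 oU) i1 i2).
transitivity (fine (\int[mu]_p (pd k (fun x => f x * phi x) (vec4 p))%:E)); last first.
  by rewrite (integral_pd_eq0 k CF cK F0).
rewrite /Rintegral; congr fine; transitivity (\int[mu]_(p in pre4 U)
    (pd k (fun x => f x * phi x) (vec4 p))%:E)%E.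
  by apply: eq_integral => p /set_mem Up; rewrite E.
apply/esym/integral_supp => // p _ nU; rewrite (pd_off k cK F0)// => Kp.
by apply: nU; exact: KU.
Qed.

End IntegrationByParts.

Section ClassicalWeak.
Context {R : realType}.
Local Notation E4 := 'rV[R]_4.
Local Notation mu := (@leb4 R).
Implicit Types (U : set E4) (f g : E4 -> R).

Lemma int4_ae U (D : set E4) f g : D `<=` U ->
  {ae mu, forall p, U (vec4 p) -> f (vec4 p) = g (vec4 p)} -> int4 D f = int4 D g.
Proof.
move=> DU [N [mN N0 sN]]; rewrite /int4 /Rintegral; congr fine.
apply: (null_eq_integral mN N0) => p Dp Np.
by rewrite (_ : f (vec4 p) = g (vec4 p))//; apply: contrapT => h; apply/Np/sN => /(_ (DU _ Dp)).
Qed.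

Lemma Cn_is_wpd U k f : open U -> Cn 1 U f -> is_wpd U k f (pd k f).
Proof.
move=> oU Cf; split; first by apply: cont_L2loc => //; exact: Cn_cont (Cn_pd k Cf).
by move=> phi tphi; exact: int_by_parts.
Qed.

Lemma wpd_is_wpd U k f v : is_wpd U k f v -> is_wpd U k f (wpd U k f).
Proof. by move=> h; rewrite /wpd; apply: (@xgetPex _ (cst 0) [set v | is_wpd U k f v]); exists v. Qed.

Lemma wpd_ae U k f v : open U -> is_wpd U k f v ->
  {ae mu, forall p, U (vec4 p) -> wpd U k f (vec4 p) = v (vec4 p)}.
Proof. by move=> oU h; exact: is_wpd_unique oU (wpd_is_wpd h) h. Qed.

Lemma is_wpd_ae U k f g v : {ae mu, forall p, U (vec4 p) -> f (vec4 p) = g (vec4 p)} ->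
  is_wpd U k g v -> is_wpd U k f v.
Proof.
move=> fg [Lv h]; split=> // phi /h <-.
by apply: (@int4_ae U) => //; apply: aeS4 fg => p e /e ->.
Qed.

Lemma wpd_C1_ae U k f : open U -> Cn 1 U f ->
  {ae mu, forall p, U (vec4 p) -> wpd U k f (vec4 p) = pd k f (vec4 p)}.
Proof. by move=> oU Cf; apply: wpd_ae => //; exact: Cn_is_wpd. Qed.

(** The second weak derivative is taken of the chosen representative [wpd U b f], which agrees with
    [pd b f] only almost everywhere; the integral identity defining weak derivatives does not see
    the difference. *)
Lemma wpd_C2_is_wpd U a b f : open U -> Cn 2 U f ->
  is_wpd U a (wpd U b f) (pd a (pd b f)).
Proof.
move=> oU Cf; apply: (is_wpd_ae (wpd_C1_ae b oU (CnW Cf))).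
by apply: Cn_is_wpd => //; exact: Cn_pd.
Qed.

Lemma wpd_C2_ae U a b f : open U -> Cn 2 U f ->
  {ae mu, forall p, U (vec4 p) -> wpd U a (wpd U b f) (vec4 p) = pd a (pd b f) (vec4 p)}.
Proof. by move=> oU Cf; apply: wpd_ae => //; exact: wpd_C2_is_wpd. Qed.

Lemma aeI4 (P Q : X4 R -> Prop) : {ae mu, forall p, P p} -> {ae mu, forall p, Q p} ->
  {ae mu, forall p, P p /\ Q p}.
Proof.
move=> hP hQ; have := negligibleU hP hQ; apply: negligibleS => p /=.
by move=> /not_andP.
Qed.

Lemma ae_all4 (I : finType) (P : I -> X4 R -> Prop) :
  (forall i, {ae mu, forall p, P i p}) -> {ae mu, forall p, forall i, P i p}.
Proof.
move=> h; have : mu.-negligible (\big[setU/set0]_(i : I) ~` [set p | P i p]).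
  by elim/big_ind: _ => [|A B|i _]; [exact: negligible_set0|exact: negligibleU|exact: h].
apply: negligibleS => p /= /existsNP[i Pi].
by rewrite -bigcup_seq; exists i => //=; rewrite mem_index_enum.
Qed.

End ClassicalWeak.

(** * Regularity of curvature quantities *)

Section PosDef.
Context {R : realType}.

Lemma det_pos_def_neq0 n (A : 'M[R]_n) :
  (forall v : 'rV_n, v != 0 -> 0 < (v *m A *m v^T) 0 0) -> \det A != 0.
Proof.
move=> pA; apply/negP => /det0P[v v0 vA]; have := pA v v0.
by rewrite vA mul0mx mxE ltxx.
Qed.

(* det ((1 - t) I + t A) has no zero for t in [0, 1]. *)
Lemma det_pos_def_gt0 n (A : 'M[R]_n) :
  (forall v : 'rV_n, v != 0 -> 0 < (v *m A *m v^T) 0 0) -> 0 < \det A.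
Proof.
move=> pA.
have p1 (v : 'rV[R]_n) : v != 0 -> 0 < (v *m v^T) 0 0.
  move=> v0; rewrite mxE.
  have /rV0Pn[i vi] := v0.
  rewrite (bigD1 i)//= mxE; apply: ltr_pwDl.
    by rewrite -expr2 lt_def sqrf_eq0 vi sqr_ge0.
  by apply: sumr_ge0 => j _; rewrite mxE -expr2 sqr_ge0.
pose B (t : R) := (1 - t) *: 1%:M + t *: A.
have B0 t : 0 <= t <= 1 -> \det (B t) != 0.
  move=> /andP[t0 t1]; apply: det_pos_def_neq0 => v v0.
  rewrite /B mulmxDr mulmxDl -!scalemxAr mulmx1 -!scalemxAl mxE.
  rewrite [X in X + _]mxE [X in _ + X]mxE.
  have [->|tn1] := eqVneq t 1; first by rewrite subrr mul0r add0r mul1r pA.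
  apply: ltr_pwDl; last by rewrite mulr_ge0// ltW// pA.
  by rewrite mulr_gt0 ?p1// subr_gt0 lt_def eq_sym tn1.
have cB : continuous (fun t => \det (B t)).
  move=> t; rewrite /determinant; apply: cvg_big; first exact: add_continuous.
  move=> s _; apply: cvgM; first exact: cvg_cst.
  apply: cvg_big; first exact: mul_continuous.
  move=> i _; rewrite /B.
  move: (perm.fun_of_perm s i) => j.
  have E (r : R) : ((1 - r) *: 1%:M + r *: A) i j = (1 - r) * (1%:M : 'M[R]_n) i j + r * A i j.
    by rewrite !mxE.
  rewrite E; under eq_fun do rewrite E.
  apply: cvgD; apply: cvgM; [|exact: cvg_cst|exact: cvg_id|exact: cvg_cst].
  by apply: cvgB; [exact: cvg_cst|exact: cvg_id].
have E0 : \det (B 0) = 1 by rewrite /B subr0 scale1r scale0r addr0 det1.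
have E1 : \det (B 1) = \det A by rewrite /B subrr scale1r scale0r add0r.
rewrite ltNge; apply/negP => A0.
have [||c] := @IVT _ (fun t => \det (B t)) 0 1 0 ler01.
- exact: continuous_subspaceT.
- by rewrite E0 E1 ge_min le_max A0 ler01 orbT.
rewrite in_itv/= => c01 /eqP; exact/negP/B0.
Qed.

End PosDef.

Section GeometrySmooth.
Context {R : realType}.
Local Notation E4 := 'rV[R]_4.
Variables (U : set E4) (G : E4 -> 'M[R]_4).
Hypothesis oU : open U.
Hypothesis sG : forall a b, smooth_on U (fun x => G x a b).
Hypothesis pG : forall x, U x -> forall v : E4, v != 0 -> 0 < (v *m G x *m v^T) 0 0.

Let Sm (f : E4 -> R) := forall n, Cn n U f.

Lemma Cn_det n m (A : E4 -> 'M[R]_m) : (forall i j, Cn n U (fun x => A x i j)) ->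
  Cn n U (fun x => \det (A x)).
Proof.
move=> CA; apply: Cn_sum => // s _; apply: CnM => //; first exact: Cn_cst.
by apply: Cn_prod => // i _; exact: CA.
Qed.

Let Sm_pd k f : Sm f -> Sm (pd k f).
Proof. by move=> Sf n; exact: Cn_pd (Sf n.+1). Qed.

Let Sm_low a b : Sm (low G a b).
Proof. by move=> n; exact: (smooth_onP _ _).1 (sG a b) n. Qed.

Lemma det_metric_gt0 x : U x -> 0 < \det (G x).
Proof. by move=> Ux; apply: det_pos_def_gt0; exact: pG. Qed.

Lemma smooth_upp a b n : Cn n U (upp G a b).
Proof.
have sG' i j : Cn n U (fun x => G x i j) by exact: (smooth_onP _ _).1 (sG i j) n.
apply: (@Cn_eq _ _ _ (fun x => (\det (G x))^-1 * cofactor (G x) b a)) => //.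
  move=> x Ux; rewrite /upp /invmx unitmxE unitfE gt_eqF ?det_metric_gt0//.
  by rewrite !mxE.
apply: CnM => //.
  apply: CnV => //; first by move=> x Ux; rewrite gt_eqF// det_metric_gt0.
  exact: Cn_det.
apply: CnM => //; first exact: Cn_cst.
by apply: Cn_det => i j; apply: (Cn_eq oU _ (sG' (lift b i) (lift a j))) => x _; rewrite !mxE.
Qed.
Let Sm_upp a b : Sm (upp G a b). Proof. exact: smooth_upp. Qed.

Ltac smooth := repeat first
  [ exact: oU | exact: Sm_low | exact: Sm_upp | exact: Cn_cst
  | (apply: Cn_sum; [exact: oU|move=> ? _]) | (apply: CnX; [exact: oU|])
  | (apply: CnD; [exact: oU| |]) | (apply: CnN; [exact: oU|])
  | (apply: CnM; [exact: oU| |])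
  | (apply: Sm_pd; move=> ?) ].

Lemma smooth_christoffel c a b n : Cn n U (christoffel G c a b).
Proof. by rewrite /christoffel; smooth. Qed.
Let Sm_chr c a b : Sm (christoffel G c a b). Proof. exact: smooth_christoffel. Qed.

Ltac smooth1 := repeat first [exact: Sm_chr | progress smooth].

Lemma smooth_riem d c a b n : Cn n U (riem G d c a b).
Proof. rewrite /riem; smooth1. Qed.
Let Sm_riem d c a b : Sm (riem G d c a b). Proof. exact: smooth_riem. Qed.

Ltac smooth2 := repeat first [exact: Sm_riem | progress smooth1].

Lemma smooth_ric a b n : Cn n U (ric G a b).
Proof. rewrite /ric; smooth2. Qed.
Let Sm_ric a b : Sm (ric G a b). Proof. exact: smooth_ric. Qed.

Ltac smooth3 := repeat first [exact: Sm_ric | progress smooth2].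

Lemma smooth_scal n : Cn n U (scal G).
Proof. rewrite /scal; smooth3. Qed.
Let Sm_scal : Sm (scal G). Proof. exact: smooth_scal. Qed.

Ltac smooth4 := repeat first [exact: Sm_scal | progress smooth3].

Lemma smooth_weyl_norm2 n : Cn n U (weyl_norm2 G).
Proof.
have Sw d c a b : Sm (weyl G d c a b) by rewrite /weyl /riem_low => m; smooth4.
rewrite /weyl_norm2; repeat first [exact: Sw | progress smooth].
Qed.

Lemma smooth_lap_scal n : Cn n U (lap G (scal G)).
Proof. rewrite /lap /lap_of; smooth4. Qed.

Lemma smooth_Qcurv n : Cn n U (Qcurv G).
Proof.
rewrite /Qcurv /ric_norm2; repeat first [exact: smooth_lap_scal | progress smooth4].
Qed.

Lemma cont_vol_density x : U x -> {for x, continuous (vol_density G)}.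
Proof.
move=> Ux; apply: continuous_comp; last exact: sqrt_continuous.
apply: (Cn_cont (n := 0)) Ux; apply: Cn_det => i j.
exact: (smooth_onP _ _).1 (sG i j) 0%N.
Qed.

Lemma vol_density_gt0 x : U x -> 0 < vol_density G x.
Proof. by move=> Ux; rewrite sqrtr_gt0 det_metric_gt0. Qed.

End GeometrySmooth.

(** * Transplanting a function from a chart *)

Section Manifold.
Context {R : realType} {M : topologicalType} (g : closed_riemannian4 R M).
Local Notation E4 := 'rV[R]_4.
Local Notation mu := (@leb4 R).
Local Notation I := 'I_(nchart g).

Lemma img_dom (i : I) y : img i y -> dom i (parm i y).
Proof. by move=> [p dp <-]; rewrite chartK. Qed.

Lemma img_parmK (i : I) y : img i y -> chart i (parm i y) = y.
Proof. by move=> [p dp <-]; rewrite chartK. Qed.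

Lemma open_overlap (i : I) (V : set M) : open V ->
  open [set y | img i y /\ V (parm i y)].
Proof.
move=> oV; rewrite openE => y [iy Vy]; apply: filterI.
  by apply: open_nbhs_nbhs; split => //; exact: img_open.
by apply: (parm_cont iy); exact: open_nbhs_nbhs.
Qed.

Lemma overlapE (i j : I) :
  chart i @` (dom i `&` dom j) = [set y | img i y /\ dom j (parm i y)].
Proof.
apply/seteqP; split=> [_ [p [dip djp] <-]|y [iy djy]].
  by split; [exists p|rewrite chartK].
by exists (parm i y); [split=> //; exact: img_dom|exact: img_parmK].
Qed.

(** [piece i] removes the points of earlier charts, so the first nonempty chart is counted in full
    and a function supported in it is integrated over a single image. *)
Lemma first_chart : exists i0 : I, dom i0 !=set0 /\
  forall j : I, (j < i0)%N -> dom j = set0.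
Proof.
have [p _] := M_nonempty g.
have [i _ di] : (\bigcup_i @dom _ _ g i) p by rewrite dom_cover.
pose P n := `[< exists j : I, val j = n /\ dom j !=set0 >].
have exP : exists n, P n by exists (val i); apply/asboolP; exists i; split => //; exists p.
have [n /asboolP[i0 [<- di0]] hmin] := ex_minnP exP.
exists i0; split => // j ji; apply: contrapT => /eqP/set0P dj.
by have := hmin j (asboolT (ex_intro _ j (conj erefl dj))); rewrite leqNgt ji.
Qed.

(* Requiring the composites with changes of charts to be C^2 avoids a chain rule
   in several variables. *)
Definition C2_composable (psi : E4 -> R) := forall (V : set E4) (T : 'I_4 -> E4 -> R),
  open V -> (forall c, Cn 2 V (T c)) -> Cn 2 V (fun y => psi (\row_c T c y)).

Section Transplant.
Variables (i0 : I) (psi : E4 -> R) (K : set E4).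
Hypothesis min0 : forall j : I, (j < i0)%N -> dom j = set0.
Hypothesis Cpsi : C2_composable psi.
Hypothesis cK : compact K.
Hypothesis KU : K `<=` img i0.
Hypothesis psi0 : forall x, ~ K x -> psi x = 0.

Definition transplant (p : M) : R := if `[< dom i0 p >] then psi (chart i0 p) else 0.
Let w := transplant.

Let S := parm i0 @` K.

Let closedS : closed S.
Proof.
apply: compact_closed; first exact: (M_hausdorff g).
apply: continuous_compact => //; apply: continuous_in_subspaceT => x /set_mem Kx.
by apply: parm_cont; exact: KU.
Qed.

Lemma transplant_off p : ~ S p -> w p = 0.
Proof.
move=> nS; rewrite /w /transplant; case: asboolP => // dp.
apply: psi0 => Kx; apply: nS; exists (chart i0 p) => //; exact: chartK.
Qed.

Lemma loc_transplant x : img i0 x -> loc w i0 x = psi x.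
Proof.
move=> ix; rewrite /loc /w /transplant /= asboolT; last exact: img_dom.
by rewrite img_parmK.
Qed.

Lemma C2_psi : Cn 2 setT psi.
Proof.
apply: (@Cn_eq _ _ _ (fun y => psi (\row_c y 0 c))); first exact: openT.
  by move=> y _; congr psi; apply/rowP => c; rewrite mxE.
by apply: Cpsi; [exact: openT|move=> c; exact: Cn_coord openT].
Qed.

(** [dom i0] and the complement of the closed set [S] cover M. On the first, the expression in the
    chart [j] is [psi] composed with a change of charts; on the second it is zero. *)
Lemma C2_loc (j : I) : Cn 2 (img j) (loc w j).
Proof.
have oS : open (~` S) by exact: closed_openC.
apply: Cn_local => y jy; have [dy|ndy] := pselect (dom i0 (parm j y)).
  exists [set y | img j y /\ dom i0 (parm j y)]; split => //.
  have oV : open [set y | img j y /\ dom i0 (parm j y)].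
    by apply: open_overlap; exact: dom_open.
  apply: (@Cn_eq _ _ _ (fun y => psi (\row_c chart i0 (parm j y) 0 c))) => //.
    move=> z [_ dz]; rewrite /loc /w /transplant /= asboolT//.
    by congr psi; apply/rowP => c; rewrite mxE.
  apply: Cpsi => // c; apply: (smooth_onP _ _).1.
  by rewrite -overlapE; exact: trans_smooth.
exists [set y | img j y /\ (~` S) (parm j y)]; split.
  by split => // -[x Kx xy]; apply: ndy; rewrite -xy; apply: img_dom; exact: KU.
have oV := @open_overlap j _ oS.
by apply: (Cn_eq oV _ (Cn_cst 2 0 oV)) => z [_ nz]; rewrite /loc /= transplant_off.
Qed.

Lemma piece_first : piece i0 = img i0.
Proof.
rewrite /piece /img; congr (_ @` _); apply/seteqP; split=> [p [] //|p dp].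
by split => // j /min0 ->.
Qed.

(** Such a point lies outside [dom i0]: either [i0] is an earlier chart, or [dom j] is empty. It is
    then off the closed set [S], and vanishing on a neighbourhood also removes the derivatives. *)
Lemma loc_transplant_piece (j : I) x : j != i0 -> piece j x ->
  exists V, [/\ open V, V x & forall y, V y -> loc w j y = 0].
Proof.
move=> ji [p [djp h] <-].
have oS : open (~` S) by exact: closed_openC.
exists [set y | img j y /\ (~` S) (parm j y)]; split.
- exact: open_overlap.
- split; first by exists p.
  rewrite chartK// => -[z Kz zp].
  have d0 : dom i0 p by rewrite -zp; apply: img_dom; exact: KU.
  have [ij|] := ltnP i0 j; first exact: (h i0 ij).
  rewrite leq_eqVlt => /orP[/eqP/val_inj e|/min0 e]; first by rewrite e eqxx in ji.
  by rewrite e in djp.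
- by move=> z [_ nz]; rewrite /loc /= transplant_off.
Qed.

Lemma transplant_W22 : W22 g w.
Proof.
move=> i; have oi : open (img i) by exact: img_open.
have C := C2_loc i; split.
- by apply: cont_L2loc => //; exact: Cn_cont C.
- by move=> a; exists (pd a (loc w i)); apply: Cn_is_wpd => //; exact: CnW.
- move=> a b; exists (pd a (pd b (loc w i))); exact: wpd_C2_is_wpd.
Qed.

Lemma jets_ae (i : I) : {ae mu, forall p, img i (vec4 p) ->
  (forall a, wD1 w i a (vec4 p) = pd a (loc w i) (vec4 p)) /\
  (forall a b, wD2 w i a b (vec4 p) = pd a (pd b (loc w i)) (vec4 p))}.
Proof.
have oi : open (img i) by exact: img_open.
have C := C2_loc i.
have h1 := ae_all4 (fun a => wpd_C1_ae a oi (CnW C)).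
have h2 := ae_all4 (fun ab : 'I_4 * 'I_4 => wpd_C2_ae ab.1 ab.2 oi C).
apply: aeS4 (aeI4 h1 h2) => p [e1 e2] ip; split=> [a|a b]; first exact: e1.
exact: (e2 (a, b)).
Qed.

(** [F] is an arbitrary pointwise function of the 2-jet, so one statement serves all the integrals
    of the functionals. Pieces other than [i0] see the zero jet; on [i0] the weak derivatives are
    replaced by those of [psi]. *)
Lemma intM_jet (F : I -> ('I_4 -> R) -> ('I_4 -> 'I_4 -> R) -> R -> E4 -> R) :
  (forall i x, F i (fun=> 0) (fun _ _ => 0) 0 x = 0) ->
  intM (g := g) (fun i x => F i (fun a => wD1 w i a x) (fun a b => wD2 w i a b x) (loc w i x) x) =
  int4 (img i0) (fun x => F i0 (fun a => pd a psi x) (fun a b => pd a (pd b psi) x)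
    (psi x) x * vol_density (met i0) x).
Proof.
move=> F0; rewrite /intM (bigD1 i0)//= [X in _ + X]big1 ?addr0; last first.
  move=> j ji; rewrite [LHS](_ : _ = int4 (piece j) (fun=> 0)).
    by rewrite /int4 /Rintegral integral0.
  have pj : piece j `<=` img j by move=> _ [p [dp _] <-]; exists p.
  pose H x := F j (fun a => pd a (loc w j) x) (fun a b => pd a (pd b (loc w j)) x)
    (loc w j x) x * vol_density (met j) x.
  transitivity (int4 (piece j) H).
    apply: (int4_ae pj); apply: aeS4 (jets_ae j) => p h /h[e1 e2].
    congr (F j _ _ _ _ * _); apply/funext => a; first exact: e1.
    by apply/funext => b; exact: e2.
  apply: eq_Rintegral => p /set_mem px; rewrite /H.
  have [V [oV Vx V0]] := loc_transplant_piece ji px.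
  have d1 a y : V y -> pd a (loc w j) y = 0.
    by move=> Vy; rewrite (pd_eq a oV Vy (g := fun=> 0)) /pd ?derive_cst.
  have d2 a b : pd a (pd b (loc w j)) (vec4 p) = 0.
    by rewrite (pd_eq a oV Vx (g := fun=> 0)) /pd ?derive_cst// => y; exact: d1.
  transitivity (F j (fun=> 0) (fun _ _ => 0) 0 (vec4 p) * vol_density (met j) (vec4 p)); last first.
    by rewrite F0 mul0r.
  congr (F j _ _ _ _ * _); [|apply/funext => a|exact: V0].
    by apply/funext => a; exact: d1.
  by apply/funext => b; exact: d2.
rewrite piece_first.
pose H x := F i0 (fun a => pd a (loc w i0) x) (fun a b => pd a (pd b (loc w i0)) x)
    (loc w i0 x) x * vol_density (met i0) x.
transitivity (int4 (img i0) H).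
  apply: (@int4_ae _ (img i0)) => //; apply: aeS4 (jets_ae i0) => p h /h[e1 e2].
  congr (F i0 _ _ _ _ * _); apply/funext => a; first exact: e1.
  by apply/funext => b; exact: e2.
apply: eq_Rintegral => p /set_mem px; rewrite /H.
have oi : open (img i0) by exact: img_open.
have d1 a y : img i0 y -> pd a (loc w i0) y = pd a psi y.
  by move=> iy; apply: (pd_eq a oi iy); exact: loc_transplant.
have d2 a b : pd a (pd b (loc w i0)) (vec4 p) = pd a (pd b psi) (vec4 p).
  by apply: (pd_eq a oi px) => y; exact: d1.
congr (F i0 _ _ _ _ * _); [|apply/funext => a|exact: (loc_transplant px)].
  by apply/funext => a; exact: d1.
by apply/funext => b; exact: d2.
Qed.

End Transplant.
End Manifold.

Section ZeroJet.
Context {R : realType} (G : 'rV[R]_4 -> 'M[R]_4) (x : 'rV[R]_4).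

Lemma lap_of_eq0 (D1 : 'I_4 -> 'rV[R]_4 -> R) (D2 : 'I_4 -> 'I_4 -> 'rV[R]_4 -> R) :
  (forall a, D1 a x = 0) -> (forall a b, D2 a b x = 0) -> lap_of G D1 D2 x = 0.
Proof.
move=> z1 z2; rewrite /lap_of; apply: big1 => a _; apply: big1 => b _.
by rewrite z2 big1 ?subr0 ?mulr0// => c _; rewrite z1 mulr0.
Qed.

Lemma grad2_of_eq0 (D1 : 'I_4 -> 'rV[R]_4 -> R) :
  (forall a, D1 a x = 0) -> grad2_of G D1 x = 0.
Proof.
by move=> z1; apply: big1 => a _; apply: big1 => b _; rewrite z1 mulr0 mul0r.
Qed.

Lemma ricgrad_of_eq0 (D1 : 'I_4 -> 'rV[R]_4 -> R) :
  (forall a, D1 a x = 0) -> ricgrad_of G D1 x = 0.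
Proof.
move=> z1; do 4! (apply: big1 => ? _); by rewrite z1 mulr0 mul0r.
Qed.

End ZeroJet.

Section JetForm.
Context {R : realType} (G : 'rV[R]_4 -> 'M[R]_4) (x : 'rV[R]_4).
Variables (D1 : 'I_4 -> 'rV[R]_4 -> R) (D2 : 'I_4 -> 'I_4 -> 'rV[R]_4 -> R).

(** The operators at [x] use only the values of [D1] and [D2] at [x]; this puts the integrands in
    the pointwise form that [intM_jet] expects. *)
Lemma lap_of_jet :
  lap_of G (fun a _ => D1 a x) (fun a b _ => D2 a b x) x = lap_of G D1 D2 x.
Proof. by []. Qed.

Lemma grad2_of_jet : grad2_of G (fun a _ => D1 a x) x = grad2_of G D1 x.
Proof. by []. Qed.

Lemma ricgrad_of_jet : ricgrad_of G (fun a _ => D1 a x) x = ricgrad_of G D1 x.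
Proof. by []. Qed.

End JetForm.

(** * The functionals on a transplanted function *)

Section Reduction.
Context {R : realType} {M : topologicalType} (g : closed_riemannian4 R M).
Local Notation E4 := 'rV[R]_4.
Local Notation mu := (@leb4 R).
Local Notation I := 'I_(nchart g).
Variables (i0 : I) (psi : E4 -> R) (K : set E4).
Hypothesis min0 : forall j : I, (j < i0)%N -> dom j = set0.
Hypothesis Cpsi : C2_composable psi.
Hypothesis cK : compact K.
Hypothesis KU : K `<=` img i0.
Hypothesis psi0 : forall x, ~ K x -> psi x = 0.
Let w := transplant i0 psi.
Local Notation G := (met i0).
Local Notation U := (img i0).

Let oU : open U. Proof. exact: img_open. Qed.

Let pG x : U x -> forall v : E4, v != 0 -> 0 < (v *m G x *m v^T) 0 0.
Proof. by move=> Ux v v0; exact: met_pos. Qed.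
Let sG a b : smooth_on U (fun x => G x a b). Proof. exact: met_smooth. Qed.

Definition grad2 (G : E4 -> 'M[R]_4) (f : E4 -> R) := grad2_of G (fun a => pd a f).
Definition ricgrad (G : E4 -> 'M[R]_4) (f : E4 -> R) := ricgrad_of G (fun a => pd a f).

(** Gathers all integrands of the weighted functional except those multiplied by [log_mean_exp4]. *)
Definition energy (g1 g2 g3 : R) (G : E4 -> 'M[R]_4) (f : E4 -> R) (x : E4) : R :=
  g1 * (4 * (f x * weyl_norm2 G x)) +
  g2 * ((lap G f x ^+ 2 + 2 / 3 * scal G x * grad2 G f x - 2 * ricgrad G f x)
        + 4 * (Qcurv G x * f x)) +
  g3 * (12 * (lap G f x + grad2 G f x) ^+ 2
        - 4 * (f x * lap G (scal G) x + scal G x * grad2 G f x)).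

(** The class of densities for which integration over the chart is additive: continuity with compact
    support gives integrability, without which [int4] may take a default value. *)
Definition good (h : E4 -> R) := Cn 0 U h /\ forall x, ~ K x -> h x = 0.

Lemma good_integrable h : good h ->
  mu.-integrable (pre4 U) (EFin \o ((fun x => h x * vol_density G x) \o @vec4 R)).
Proof.
move=> [Ch h0]; apply: (cc_integrable4 oU cK KU) => x Ux.
  apply: (continuousM (Cn_cont Ch Ux)).
  exact: (cont_vol_density oU sG Ux).
by move=> /h0 ->; rewrite mul0r.
Qed.

Lemma goodD h1 h2 : good h1 -> good h2 -> good (fun x => h1 x + h2 x).
Proof.
by move=> [C1 z1] [C2 z2]; split=> [|x nK]; [exact: CnD|rewrite z1// z2// addr0].
Qed.

Lemma goodZ c h : good h -> good (fun x => c * h x).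
Proof.
move=> [C z]; split=> [|x nK]; last by rewrite z// mulr0.
by apply: CnM => //; exact: Cn_cst.
Qed.

Lemma int4_goodD h1 h2 : good h1 -> good h2 ->
  int4 U (fun x => (h1 x + h2 x) * vol_density G x) =
  int4 U (fun x => h1 x * vol_density G x) + int4 U (fun x => h2 x * vol_density G x).
Proof.
move=> H1 H2; rewrite /int4 -(RintegralD (open_measurable4 oU) (good_integrable H1) (good_integrable H2)).
by apply: eq_Rintegral => p _; rewrite /= mulrDl.
Qed.

Lemma int4_goodZ c h : good h ->
  int4 U (fun x => c * h x * vol_density G x) = c * int4 U (fun x => h x * vol_density G x).
Proof.
move=> H; rewrite /int4 -(RintegralZl _ (open_measurable4 oU) (good_integrable H)).
by apply: eq_Rintegral => p _; rewrite /= mulrA.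
Qed.

Let C2U : Cn 2 U psi. Proof. by apply: Cn_sub (C2_psi Cpsi). Qed.
Let C0 : Cn 0 U psi. Proof. exact/CnW/CnW. Qed.
Let C0p a : Cn 0 U (pd a psi). Proof. exact/CnW/Cn_pd. Qed.
Let C0pp a b : Cn 0 U (pd a (pd b psi)). Proof. exact/Cn_pd/Cn_pd. Qed.
Let zp a x : ~ K x -> pd a psi x = 0. Proof. exact: pd_off. Qed.
Let zpp a b x : ~ K x -> pd a (pd b psi) x = 0.
Proof. by apply: pd_off => // y; exact: zp. Qed.

Ltac cont0 := repeat lazymatch goal with
  | |- open _ => exact: oU
  | |- Cn _ _ (pd _ (pd _ psi)) => exact: C0pp
  | |- Cn _ _ (pd _ psi) => exact: C0p
  | |- Cn _ _ psi => exact: C0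
  | |- Cn _ _ (upp _ _ _) => exact: (smooth_upp oU sG pG)
  | |- Cn _ _ (christoffel _ _ _ _) => exact: (smooth_christoffel oU sG pG)
  | |- Cn _ _ (ric _ _ _) => exact: (smooth_ric oU sG pG)
  | |- Cn _ _ (scal _) => exact: (smooth_scal oU sG pG)
  | |- Cn _ _ (weyl_norm2 _) => exact: (smooth_weyl_norm2 oU sG pG)
  | |- Cn _ _ (lap _ (scal _)) => exact: (smooth_lap_scal oU sG pG)
  | |- Cn _ _ (Qcurv _) => exact: (smooth_Qcurv oU sG pG)
  | |- Cn _ _ (fun x => @?f x + @?h x) => apply: CnD
  | |- Cn _ _ (fun x => @?f x * @?h x) => apply: CnM
  | |- Cn _ _ (fun x => - @?f x) => apply: CnN
  | |- Cn _ _ (fun x => @?f x ^+ _) => apply: CnX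
  | |- Cn _ _ (fun x => \sum_(i < _) _) => apply: Cn_sum; [exact: oU|move=> ? _]
  | |- Cn _ _ (fun x => ?c) => apply: Cn_cst
  | |- _ => first [exact: C0 | apply: Cn_sum; [exact: oU|move=> ? _]]
  end.

Let Clap : Cn 0 U (lap G psi). Proof. rewrite /lap /lap_of; cont0. Qed.
Let Cgrad : Cn 0 U (grad2 G psi). Proof. rewrite /grad2 /grad2_of; cont0. Qed.
Let Cricg : Cn 0 U (ricgrad G psi). Proof. rewrite /ricgrad /ricgrad_of; cont0. Qed.
Ltac cont1 := repeat lazymatch goal with
  | |- Cn _ _ (lap _ psi) => exact: Clap
  | |- Cn _ _ (grad2 _ psi) => exact: Cgrad
  | |- Cn _ _ (ricgrad _ psi) => exact: Cricg
  | |- _ => progress cont0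
  end.

Let zlap x : ~ K x -> lap G psi x = 0.
Proof. by move=> nK; apply: lap_of_eq0 => *; [exact: zp|exact: zpp]. Qed.
Let zgrad x : ~ K x -> grad2 G psi x = 0.
Proof. by move=> nK; apply: grad2_of_eq0 => a; exact: zp. Qed.
Let zricg x : ~ K x -> ricgrad G psi x = 0.
Proof. by move=> nK; apply: ricgrad_of_eq0 => a; exact: zp. Qed.

Lemma good_energy g1 g2 g3 : good (energy g1 g2 g3 G psi).
Proof.
split=> [|x nK]; first by rewrite /energy; cont1.
rewrite /energy zlap// zgrad// zricg// psi0//; ring.
Qed.

Lemma Ffun_transplant (g1 g2 g3 : R) :
  Ffun g g1 g2 g3 w = int4 U (fun x => energy g1 g2 g3 G psi x * vol_density G x)
   - (g1 * intM (@W2 R M g) + g2 * intM (@Q R M g)) * log_mean_exp4 g w.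
Proof.
have jet := intM_jet min0 Cpsi cK KU psi0.
pose h1 x := psi x * weyl_norm2 G x.
pose h2 x := lap G psi x ^+ 2 + 2 / 3 * scal G x * grad2 G psi x - 2 * ricgrad G psi x.
pose h3 x := Qcurv G x * psi x.
pose h4 x := (lap G psi x + grad2 G psi x) ^+ 2.
pose h5 x := psi x * lap G (scal G) x + scal G x * grad2 G psi x.
have H1 : good h1 by split=> [|x nK]; [rewrite /h1; cont0|rewrite /h1 psi0// mul0r].
have H2 : good h2.
  split=> [|x nK]; last by rewrite /h2 zlap// zgrad// zricg// expr0n/= !mulr0 subr0 addr0.
  by rewrite /h2; cont1.
have H3 : good h3 by split=> [|x nK]; [rewrite /h3; cont0|rewrite /h3 psi0// mulr0].
have H4 : good h4.
  split=> [|x nK]; last by rewrite /h4 zlap// zgrad// addr0 expr0n.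
  by rewrite /h4; cont1.
have H5 : good h5.
  split=> [|x nK]; last by rewrite /h5 psi0// zgrad// mulr0 mul0r addr0.
  by rewrite /h5; cont1.
have E1 : intM (g := g) (fun i x => loc w i x * W2 i x) = int4 U (fun x => h1 x * vol_density G x).
  apply: (jet (fun i d1 d2 v x => v * W2 i x)) => i x; exact: mul0r.
have E2 : paneitz_form g w = int4 U (fun x => h2 x * vol_density G x).
  pose F (i : I) (d1 : 'I_4 -> R) (d2 : 'I_4 -> 'I_4 -> R) (v : R) (x : E4) :=
    lap_of (met i) (fun a _ => d1 a) (fun a b _ => d2 a b) x ^+ 2
    + 2 / 3 * Sc i x * grad2_of (met i) (fun a _ => d1 a) x
    - 2 * ricgrad_of (met i) (fun a _ => d1 a) x.
  transitivity (intM (g := g) (fun i x => F i (fun a => wD1 w i a x)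
      (fun a b => wD2 w i a b x) (loc w i x) x)).
    apply: (congr1 (@intM R M g)); apply/funext => i; apply/funext => x.
    by rewrite /F (lap_of_jet _ _ (wD1 w i) (wD2 w i)) (grad2_of_jet _ _ (wD1 w i)) (ricgrad_of_jet _ _ (wD1 w i)).
  transitivity (int4 U (fun x => F i0 (fun a => pd a psi x) (fun a b => pd a (pd b psi) x)
      (psi x) x * vol_density G x)).
    apply: (jet F) => i x.
    by rewrite /F lap_of_eq0// grad2_of_eq0// ricgrad_of_eq0// expr0n/= !mulr0 subr0 addr0.
  apply: eq_Rintegral => p _.
  by rewrite /F (lap_of_jet _ _ (fun a => pd a psi) (fun a b => pd a (pd b psi)))
     (grad2_of_jet _ _ (fun a => pd a psi)) (ricgrad_of_jet _ _ (fun a => pd a psi)).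
have E3 : intM (g := g) (fun i x => Q i x * loc w i x) = int4 U (fun x => h3 x * vol_density G x).
  apply: (jet (fun i d1 d2 v x => Q i x * v)) => i x; exact: mulr0.
have E4 : intM (g := g) (fun i x => (Lap w i x + Grad2 w i x) ^+ 2) =
    int4 U (fun x => h4 x * vol_density G x).
  pose F (i : I) (d1 : 'I_4 -> R) (d2 : 'I_4 -> 'I_4 -> R) (v : R) (x : E4) :=
    (lap_of (met i) (fun a _ => d1 a) (fun a b _ => d2 a b) x
     + grad2_of (met i) (fun a _ => d1 a) x) ^+ 2.
  transitivity (intM (g := g) (fun i x => F i (fun a => wD1 w i a x)
      (fun a b => wD2 w i a b x) (loc w i x) x)).
    apply: (congr1 (@intM R M g)); apply/funext => i; apply/funext => x.
    by rewrite /F (lap_of_jet _ _ (wD1 w i) (wD2 w i)) (grad2_of_jet _ _ (wD1 w i)).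
  transitivity (int4 U (fun x => F i0 (fun a => pd a psi x) (fun a b => pd a (pd b psi) x)
      (psi x) x * vol_density G x)).
    apply: (jet F) => i x.
    by rewrite /F lap_of_eq0// grad2_of_eq0// addr0 expr0n.
  apply: eq_Rintegral => p _.
  by rewrite /F (lap_of_jet _ _ (fun a => pd a psi) (fun a b => pd a (pd b psi)))
     (grad2_of_jet _ _ (fun a => pd a psi)).
have E5 : intM (g := g) (fun i x => loc w i x * lap (met i) (Sc i) x + Sc i x * Grad2 w i x) =
    int4 U (fun x => h5 x * vol_density G x).
  apply: (jet (fun i d1 d2 v x => v * lap (met i) (Sc i) x +
    Sc i x * grad2_of (met i) (fun a _ => d1 a) x)) => i x.
  by rewrite grad2_of_eq0// mul0r mulr0 addr0.
rewrite /Ffun /FI /FII /FIII E1 E2 E3 E4 E5.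
have -> : int4 U (fun x => energy g1 g2 g3 G psi x * vol_density G x) =
   int4 U (fun x => ((((g1 * 4) * h1 x + g2 * h2 x) + (g2 * 4) * h3 x) + ((g3 * 12) * h4 x + (- g3 * 4) * h5 x)) * vol_density G x).
  apply: eq_Rintegral => p _; congr (_ * _); rewrite /energy /h1 /h2 /h3 /h4 /h5; ring.
have A1 := goodZ (g1 * 4) H1; have A2 := goodZ g2 H2; have A3 := goodZ (g2 * 4) H3.
have A4 := goodZ (g3 * 12) H4; have A5 := goodZ (- g3 * 4) H5.
rewrite (int4_goodD (goodD (goodD A1 A2) A3) (goodD A4 A5)) (int4_goodD (goodD A1 A2) A3).
rewrite (int4_goodD A1 A2) (int4_goodD A4 A5).
rewrite (int4_goodZ _ H1) (int4_goodZ _ H2) (int4_goodZ _ H3) (int4_goodZ _ H4) (int4_goodZ _ H5).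
ring.
Qed.

End Reduction.

(** * The logarithmic term *)

Section LogMean.
Context {R : realType} {M : topologicalType} (g : closed_riemannian4 R M).
Local Notation E4 := 'rV[R]_4.
Local Notation mu := (@leb4 R).
Local Notation I := 'I_(nchart g).
Variables (i0 : I) (psi : E4 -> R) (K : set E4).
Hypothesis min0 : forall j : I, (j < i0)%N -> dom j = set0.
Hypothesis Cpsi : C2_composable psi.
Hypothesis cK : compact K.
Hypothesis KU : K `<=` img i0.
Hypothesis psi0 : forall x, ~ K x -> psi x = 0.
Hypothesis psi_ge0 : forall x, 0 <= psi x.
Let w := transplant i0 psi.
Local Notation G := (met i0).
Local Notation U := (img i0).
Local Notation vol := (vol_density (met i0)).

Let oU : open U. Proof. exact: img_open. Qed.
Let sG a b : smooth_on U (fun x => G x a b). Proof. exact: met_smooth. Qed.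

Let cvol x : U x -> {for x, continuous vol}.
Proof. exact: cont_vol_density. Qed.
Let cpsi x : {for x, continuous psi}.
Proof. exact: (Cn_cont (C2_psi Cpsi) (Logic.I : setT x)). Qed.
Let vol_ge0 (i : I) x : 0 <= vol_density (met i) x.
Proof. by rewrite sqrtr_ge0. Qed.

(** Subtracting 1 leaves an integrand supported in [K], hence integrable: it measures by how much
    the integral of exp(4w) can exceed the volume. *)
Definition excess : R := int4 U (fun x => (expR (4 * psi x) - 1) * vol x).

Let cexp x : {for x, continuous (fun x => expR (4 * psi x))}.
Proof.
apply: (@continuous_comp _ _ _ (fun x => 4 * psi x) expR); last exact: continuous_expR.
exact: (continuousM (@cst_continuous E4 R 4 x) (@cpsi x)).
Qed.

Let cexc x : {for x, continuous (fun x => expR (4 * psi x) - 1)}.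
Proof. exact: (continuousB (@cexp x) (@cst_continuous E4 R 1 x)). Qed.

Lemma excess_integrable : mu.-integrable (pre4 U) (EFin \o ((fun x => (expR (4 * psi x) - 1) * vol x) \o @vec4 R)).
Proof.
apply: (cc_integrable4 oU cK KU) => x Ux; first exact: (continuousM (@cexc x) (cvol Ux)).
by move=> /psi0 ->; rewrite mulr0 expR0 subrr mul0r.
Qed.

(* The density may fail to be integrable on the image of a chart, in which case
   both integrals over that chart have the junk value 0; hence the existential. *)
Lemma intM_expR : exists2 J : R, 0 <= J <= excess &
  intM (g := g) (fun i x => expR (4 * loc w i x)) = Vol g + J.
Proof.
have e0 : 0 <= excess.
  apply: Rintegral_ge0 => p _; rewrite mulr_ge0// subr_ge0 -expR0 ler_expR.
  by rewrite mulr_ge0.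
pose rest := \sum_(j < nchart g | j != i0) int4 (piece j) (fun x => cst 1 x * vol_density (met j) x).
have EV : Vol g = int4 U (fun x => cst 1 x * vol x) + rest.
  by rewrite /Vol /intM (bigD1 i0)//= piece_first.
have EX : intM (g := g) (fun i x => expR (4 * loc w i x)) =
    int4 U (fun x => expR (4 * psi x) * vol x) + rest.
  rewrite /intM (bigD1 i0)//= piece_first//; congr (_ + _).
    apply: eq_Rintegral => p /set_mem px; congr (expR (4 * _) * _).
    exact: loc_transplant.
  apply: eq_bigr => j ji; apply: eq_Rintegral => p /set_mem px; congr (_ * _).
  have [V [_ Vx V0]] := loc_transplant_piece min0 cK KU psi0 ji px.
  by rewrite V0// mulr0 expR0.
have mU := open_measurable4 oU.
have mvol : measurable_fun (pre4 U) (vol \o @vec4 R) by exact: cont_measurable4.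
have cex x : U x -> {for x, continuous (fun x => expR (4 * psi x) * vol x)}.
  by move=> Ux; exact: (continuousM (@cexp x) (cvol Ux)).
have mex : measurable_fun (pre4 U) ((fun x => expR (4 * psi x) * vol x) \o @vec4 R).
  exact: cont_measurable4.
have [ivol|nivol] := pselect (mu.-integrable (pre4 U) (EFin \o ((fun x => cst 1 x * vol x) \o @vec4 R))).
  exists excess; first by rewrite e0 lexx.
  rewrite EX EV addrAC; congr (_ + _).
  rewrite /excess /int4 -(RintegralD mU ivol excess_integrable).
  by apply: eq_Rintegral => p _; rewrite /= -mulrDl addrC subrK.
exists 0; first by rewrite lexx e0.
rewrite EX EV addr0; congr (_ + _).
have Ioo : (\int[mu]_(p in pre4 U) (vol (vec4 p))%:E = +oo)%E.
  apply/eqP; rewrite -leye_eq leNgt; apply/negP => Ilt; apply: nivol.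
  apply/integrableP; split.
    by apply/measurable_EFinP; apply: eq_measurable_fun mvol => p _; rewrite /= mul1r.
  rewrite (eq_integral (fun p : X4 R => (vol (vec4 p))%:E))//.
  by move=> p _ /=; rewrite mul1r ger0_norm.
rewrite /int4 /Rintegral.
have -> : (\int[mu]_(p in pre4 U) (expR (4 * psi (vec4 p)) * vol (vec4 p))%:E = +oo)%E.
  apply/eqP; rewrite -leye_eq -Ioo; apply: ge0_le_integral => //.
  - by move=> p _; rewrite lee_fin.
  - exact/measurable_EFinP.
  - exact/measurable_EFinP.
  - move=> p _; rewrite lee_fin ler_peMl// -expR0 ler_expR.
    by rewrite mulr_ge0.
rewrite (eq_integral (fun p : X4 R => (vol (vec4 p))%:E)) ?Ioo//.
by move=> p _; rewrite mul1r.
Qed.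

Lemma log_mean_exp4_bounds (L : R) : excess <= L ->
  0 <= log_mean_exp4 g w <= ln (1 + (Vol g)^-1 * L).
Proof.
move=> eL; rewrite /log_mean_exp4; have [J /andP[J0 JL] ->] := intM_expR.
have V0 : 0 <= Vol g.
  by apply: sumr_ge0 => i _; apply: Rintegral_ge0 => p _; rewrite mul1r.
(* [Vol g] is only known to be nonnegative here, since chart integrals can take a default value. If
   it is 0, so is its inverse; then the logarithmic mean is [ln 0 = 0] and the upper bound is
   [ln 1 = 0]. *)
have [->|Vn0] := eqVneq (Vol g) 0; first by rewrite invr0 !mul0r addr0 ln0// ln1 lexx.
have Vp : 0 < Vol g by rewrite lt_def Vn0.
rewrite mulrDr mulVf//.
have VJ : 0 <= (Vol g)^-1 * J by rewrite mulr_ge0// invr_ge0.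
rewrite ln_ge0 ?lerDl//= ler_ln ?posrE ?ltr_wpDr//.
  by rewrite lerD2l ler_wpM2l ?invr_ge0// (le_trans JL).
by rewrite mulr_ge0 ?invr_ge0// (le_trans J0)// (le_trans JL).
Qed.

End LogMean.

(** * The logarithmic bubble *)

Section Theta.
Context {R : realType}.
Implicit Types u v t : R.

(* [- ln] minus its second order Taylor polynomial at 1, cut off at 1. *)
Definition theta u := if u < 1 then - ln u + (u - 1) - (u - 1) ^+ 2 / 2 else 0.
Definition theta1 u := if u < 1 then - ((1 - u) ^+ 2 / u) else 0.
Definition theta2 u := if u < 1 then (1 - u ^+ 2) / u ^+ 2 else 0.

(** Both sides come from ln(1 + x) <= x, at x = u - 1 and at x = 1/u - 1. They give the quadratic
    contact with 0 at u = 1 and the boundedness of [u * theta u]. *)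
Lemma theta_bounds u : 0 < u -> u < 1 ->
  - ((u - 1) ^+ 2 / 2) <= theta u <= (u - 1) ^+ 2 / u.
Proof.
move=> u0 u1; rewrite /theta u1.
have l1 : ln u <= u - 1.
  have := @le_ln1Dx R (u - 1); rewrite (_ : 1 + (u - 1) = u); last by ring.
  by apply; lra.
have l2 : - ln u <= u^-1 - 1.
  have ui : 0 < u^-1 by rewrite invr_gt0.
  have := @le_ln1Dx R (u^-1 - 1); rewrite (_ : 1 + (u^-1 - 1) = u^-1); last by ring.
  by rewrite lnV ?posrE//; apply; lra.
apply/andP; split; first lra.
have -> : (u - 1) ^+ 2 / u = (u^-1 - 1) + (u - 1) by field; lra.
have := sqr_ge0 (u - 1); lra.
Qed.

Lemma is_derive_theta u : 0 < u -> is_derive u 1 theta (theta1 u).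
Proof.
move=> u0; have [u1|u1|u1] := ltgtP u 1.
- rewrite /theta1 u1.
  apply: (@near_eq_is_derive _ _ _ (fun u => - ln u + (u - 1) - (u - 1) ^+ 2 / 2)).
    by near=> v; rewrite /theta ifT//; near: v; exact: lt_nbhsl.
  have d1 := is_derive1_ln u0.
  have d2 : is_derive u 1 (fun v : R => v - 1) 1.
    exact: is_derive_eq (is_deriveB (is_derive_id u (1 : R)) (is_derive_cst (1 : R) u 1)) (subr0 _).
  have d3 := is_deriveB (is_deriveD (is_deriveN d1) d2)
    (is_deriveM (is_deriveX 2 d2) (is_derive_cst (2^-1 : R) u 1)).
  apply: is_derive_eq d3 _; rewrite /GRing.scale/=; field; lra.
- rewrite /theta1 ltNge ltW//=.
  apply: (@near_eq_is_derive _ _ _ (fun=> 0)).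
  by near=> v; rewrite /theta ltNge ltW//; near: v; exact: lt_nbhsr.
rewrite u1 /theta1 ltxx; apply: (@is_derive_quad _ _ _ 2).
near=> v; rewrite /theta ltxx subr0.
have v0 : 2^-1 < v by near: v; apply: lt_nbhsr; rewrite invf_lt1// ltr1n.
case: ifP => v1; last by rewrite normr0 mulr_ge0// sqr_ge0.
have := theta_bounds _ v1; rewrite /theta v1 => /(_ _)/andP[|h1 h2]; first lra.
rewrite ler_norml; apply/andP; split.
  by apply: le_trans h1; rewrite lerN2; have := sqr_ge0 (v - 1); lra.
apply: le_trans h2 _; rewrite ler_pdivrMr; last lra.
rewrite mulrAC ler_peMl ?sqr_ge0//; lra.
Unshelve. all: by end_near. Qed.

Lemma is_derive_theta1 u : 0 < u -> is_derive u 1 theta1 (theta2 u).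
Proof.
move=> u0; have [u1|u1|u1] := ltgtP u 1.
- rewrite /theta2 u1.
  apply: (@near_eq_is_derive _ _ _ (fun u => - ((1 - u) ^+ 2 * u^-1))).
    by near=> v; rewrite /theta1 ifT//; near: v; exact: lt_nbhsl.
  have un0 : u != 0 by rewrite gt_eqF.
  have d1 : is_derive u 1 (fun x : R => x^-1) (- (u ^- 2)).
    apply: DeriveDef; first exact: (derivableV (f := id) un0 (@derivable_id _ _ _ _)).
    by rewrite (deriveV (f := id) un0 (@derivable_id _ _ _ _)) derive_id [_%:A]mulr1.
  have d2 : is_derive u 1 (fun v : R => 1 - v) (- 1).
    exact: is_derive_eq (is_deriveB (is_derive_cst (1 : R) u 1) (is_derive_id u (1 : R))) (sub0r _).
  have d3 := is_deriveN (is_deriveM (is_deriveX 2 d2) d1).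
  by apply: is_derive_eq d3 _; rewrite /GRing.scale ?fctE/=; field.
- rewrite /theta2 ltNge ltW//=.
  apply: (@near_eq_is_derive _ _ _ (fun=> 0)).
  by near=> v; rewrite /theta1 ltNge ltW//; near: v; exact: lt_nbhsr.
rewrite u1 /theta2 ltxx; apply: (@is_derive_quad _ _ _ 2).
near=> v; rewrite /theta1 ltxx subr0.
have v0 : 2^-1 < v by near: v; apply: lt_nbhsr; rewrite invf_lt1// ltr1n.
case: ifP => v1; last by rewrite normr0 mulr_ge0// sqr_ge0.
rewrite normrN ger0_norm ?divr_ge0 ?sqr_ge0//; last lra.
rewrite ler_pdivrMr -?[(1 - v) ^+ 2]sqrrN ?opprB; last lra.
rewrite mulrAC ler_peMl ?sqr_ge0//; lra.
Unshelve. all: by end_near. Qed.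

Lemma cont_theta2 u : 0 < u -> {for u, continuous theta2}.
Proof.
move=> u0.
(* Since (1 - m^2) / m^2 vanishes at m = 1, truncating the argument at 1 merges the two branches
   into one formula. *)
have -> : theta2 = (fun m => (1 - m ^+ 2) / m ^+ 2) \o (fun u => Num.min u 1).
  apply/funext => v; rewrite /theta2 /= minElt.
  by case: ltP => // _; rewrite expr1n subrr mul0r.
apply: continuous_comp; first by apply: continuous_min; [exact: cvg_id|exact: cvg_cst].
have m0 : Num.min u 1 != 0 by rewrite gt_eqF// lt_min u0 ltr01.
apply: continuousM.
  by apply: continuousB; [exact: cst_continuous|exact: exprn_continuous].
apply: continuousV; first by rewrite expf_neq0.
exact: exprn_continuous.
Qed.

Lemma Cn1_theta : Cn1 2 [set u : R | 0 < u] theta.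
Proof.
have oD : open [set u : R | 0 < u] by exact: open_gt.
apply: (@Cn1_intro _ _ _ _ theta1) => //; first by move=> u; exact: is_derive_theta.
apply: (@Cn1_intro _ _ _ _ theta2) => //; first by move=> u; exact: is_derive_theta1.
by split => // u; exact: cont_theta2.
Qed.

(** [theta] vanishes at 1 and its derivative [theta1] is nonpositive before 1. *)
Lemma theta_ge0 u : 0 < u -> 0 <= theta u.
Proof.
move=> u0; have [u1|u1] := ltP u 1; last by rewrite /theta ltNge u1.
have [c|c|c] := @MVT R theta theta1 u 1 u1.
- by rewrite in_itv/= => /andP[uc _]; apply: is_derive_theta; lra.
- apply: continuous_in_subspaceT => x /set_mem; rewrite /= in_itv/= => /andP[ux _].
  have x0 : 0 < x by lra.
  exact: derivable1_cont (@ex_derive _ _ _ _ _ _ _ (is_derive_theta x0)).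
rewrite in_itv/= => /andP[uc c1]; rewrite {1}/theta ltxx sub0r /theta1 c1 => e.
have : 0 <= (1 - c) ^+ 2 / c by rewrite divr_ge0 ?sqr_ge0//; lra.
have u1' : 0 <= 1 - u by lra.
by move=> h; have := mulr_ge0 h u1'; lra.
Qed.

Lemma theta_le_ln u : 0 < u -> u < 1 -> theta u <= - ln u.
Proof. by move=> u0 u1; rewrite /theta u1; have := sqr_ge0 (u - 1); lra. Qed.

Lemma mul_theta_le1 u : 0 < u -> u * theta u <= 1.
Proof.
move=> u0; have [u1|u1] := ltP u 1; last by rewrite /theta ltNge u1 mulr0.
have /andP[_ h] := theta_bounds u0 u1.
rewrite -ler_pdivlMl// mulr1; apply: le_trans h _.
rewrite ler_pdivrMr// mulVf ?gt_eqF// -sqrrN opprB expr_le1//; lra.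
Qed.

(* As 4 t <= 3 / 2, exp(4 psi) is at most of the order of |x|^-3. *)
Lemma expR_theta_le t u v : 0 <= t <= 3 / 8 -> 0 < v -> v ^+ 2 <= u ->
  expR (4 * (t * theta u)) - 1 <= (v^-1) ^+ 3.
Proof.
move=> /andP[t0 t1] v0 vu.
have u0 : 0 < u by apply: lt_le_trans vu; rewrite exprn_gt0.
have [u1|u1] := ltP u 1; last first.
  by rewrite /theta ltNge u1/= !mulr0 expR0 subrr exprn_ge0// invr_ge0 ltW.
apply: (@le_trans _ _ (expR (4 * (t * theta u)))); first by rewrite gerBl.
have -> : v^-1 ^+ 3 = expR (- (3 * ln v)).
  by rewrite expRN expRM_natl lnK ?posrE// exprVn.
rewrite ler_expR; have := theta_le_ln u0 u1; have := theta_ge0 u0 => th0 th1.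
have lu : 2 * ln v <= ln u.
  by rewrite mulr_natl -lnXn// ler_ln ?posrE// exprn_gt0.
apply: (@le_trans _ _ (3 / 2 * theta u)); last lra.
by rewrite mulrA; apply: ler_wpM2r => //; lra.
Qed.

End Theta.

Section Bubble.
Context {R : realType}.
Local Notation E4 := 'rV[R]_4.
Variables (H : 'M[R]_4) (x0 : E4).

Definition qform (y : E4) : R := \sum_(a < 4) \sum_(b < 4) H a b * (y 0 a * y 0 b).
(** Half the gradient of [qform] at [y], for symmetric [H]. *)
Definition lform (y : E4) (a : 'I_4) : R := \sum_(b < 4) H a b * y 0 b.
Definition bubble (t e : R) (x : E4) : R := t * theta (e + qform (x - x0)).

Hypothesis symH : H^T = H.
Hypothesis quad_ge0 : forall y, 0 <= qform y.

Lemma is_derive_sum_fun n (h : 'I_n -> E4 -> R) (x v : E4) (dh : 'I_n -> R) :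
  (forall i, is_derive x v (h i) (dh i)) ->
  is_derive x v (fun y => \sum_(i < n) h i y) (\sum_(i < n) dh i).
Proof.
move=> hd; have -> : (fun y => \sum_(i < n) h i y) = \sum_(i < n) h i.
  by apply/funext => y; rewrite fct_sumE.
exact: is_derive_sum.
Qed.

Lemma is_derive_coordB (a k : 'I_4) (x : E4) :
  is_derive x (delta_mx 0 k) (fun x : E4 => (x - x0) 0 a) ((a == k)%:R).
Proof.
have -> : (fun x : E4 => (x - x0) 0 a) = (fun x : E4 => x 0 a - x0 0 a).
  by apply/funext => y; rewrite !mxE.
have := is_deriveB (is_derive_coord a k x) (is_derive_cst (x0 0 a) x (delta_mx 0 k)).
by rewrite subr0.
Qed.

Lemma is_derive_lin (a k : 'I_4) (x : E4) :
  is_derive x (delta_mx 0 k) (fun x => lform (x - x0) a) (H a k).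
Proof.
apply: is_derive_eq.
  apply: is_derive_sum_fun => b.
  exact: (is_deriveM (is_derive_cst (H a b) x (delta_mx 0 k)) (is_derive_coordB b k x)).
rewrite (bigD1 k)//= eqxx big1 => [|b bk]; rewrite /GRing.scale/= mulr0 addr0 ?mulr1 ?addr0//.
by rewrite (negbTE bk) mulr0.
Qed.

Lemma is_derive_quad4 (k : 'I_4) (x : E4) (e : R) :
  is_derive x (delta_mx 0 k) (fun x => e + qform (x - x0)) (2 * lform (x - x0) k).
Proof.
pose y := x - x0.
apply: (@is_derive_eq _ _ _ _ _ _ _ (0 + \sum_(a < 4) \sum_(b < 4) (H a b * ((a == k)%:R * y 0 b + y 0 a * (b == k)%:R)))).
  apply: is_deriveD; apply: is_derive_sum_fun => a; apply: is_derive_sum_fun => b.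
  have := is_deriveM (is_derive_cst (H a b) x (delta_mx 0 k))
    (is_deriveM (is_derive_coordB a k x) (is_derive_coordB b k x)).
  move=> d; apply: is_derive_eq d _; rewrite /GRing.scale/= mulr0 addr0 /y; ring.
rewrite add0r; under eq_bigr do under eq_bigr do rewrite mulrDr.
under eq_bigr do rewrite big_split/=.
rewrite big_split/= mulr_natl mulr2n; congr (_ + _).
  rewrite (bigD1 k)//= [X in _ + X]big1 ?addr0 => [|a ak].
    by apply: eq_bigr => b _; rewrite eqxx mul1r.
  by apply: big1 => b _; rewrite (negbTE ak) mul0r mulr0.
apply: eq_bigr => a _; rewrite (bigD1 k)//= [X in _ + X]big1 ?addr0 => [|b bk].
  by rewrite eqxx mulr1 -[in LHS]symH mxE.
by rewrite (negbTE bk) !mulr0.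
Qed.

Variables (t e : R).
Hypothesis e0 : 0 < e.

Let u x := e + qform (x - x0).
Let u_gt0 x : 0 < u x. Proof. by rewrite ltr_wpDr. Qed.

Lemma pd_bubble (a : 'I_4) :
  pd a (bubble t e) = (fun x => t * (theta1 (u x) * (2 * lform (x - x0) a))).
Proof.
apply/funext => x; have du := is_derive_quad4 a x e.
have [_ dE] := du.
have d := is_derive_comp_dir (is_derive_theta (u_gt0 x)) (@ex_derive _ _ _ _ _ _ _ du).
have [_ eq] := is_deriveM (is_derive_cst t x (delta_mx 0 a)) d.
rewrite /pd [LHS]eq /GRing.scale/= mulr0 addr0 dE.
by [].
Qed.

Lemma pd2_bubble (b a : 'I_4) x :
  pd b (pd a (bubble t e)) x =
  t * (theta2 (u x) * (4 * (lform (x - x0) a * lform (x - x0) b)) + theta1 (u x) * (2 * H a b)).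
Proof.
rewrite pd_bubble; have du := is_derive_quad4 b x e.
have [_ dE] := du.
have d := is_derive_comp_dir (is_derive_theta1 (u_gt0 x)) (@ex_derive _ _ _ _ _ _ _ du).
have dl := is_deriveM (is_derive_cst (2 : R) x (delta_mx 0 b)) (is_derive_lin a b x).
have [_ eq] := is_deriveM (is_derive_cst t x (delta_mx 0 b)) (is_deriveM d dl).
rewrite /pd [LHS]eq /GRing.scale/= !mulr0 !addr0 dE /u fctE /=; ring.
Qed.

(** The composite is [theta] applied to a polynomial in the functions [T c], so a chain rule with a
    one-variable outer function is enough. *)
Lemma C2_bubble (V : set E4) (T : 'I_4 -> E4 -> R) : open V -> (forall c, Cn 2 V (T c)) ->
  Cn 2 V (fun y => bubble t e (\row_c T c y)).
Proof.
move=> oV CT; apply: CnM => //; first exact: Cn_cst.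
apply: (Cn_comp (D := [set u : R | 0 < u])) => //; first by move=> y _; exact: u_gt0.
  exact: Cn1_theta.
apply: CnD => //; first exact: Cn_cst.
apply: Cn_sum => // a _; apply: Cn_sum => // b _; apply: CnM => //; first exact: Cn_cst.
have CB c : Cn 2 V (fun y => (\row_c T c y - x0) 0 c).
  apply: (@Cn_eq _ _ _ (fun y => T c y - x0 0 c)) => //; first by move=> y _; rewrite !mxE.
  by apply: CnB => //; exact: Cn_cst.
exact: CnM.
Qed.

End Bubble.

(** * Asymptotics of the energy density *)

Section BoundedSmall.
Context {R : realType} {T : Type} (F : set_system T) {FF : Filter F}.
Implicit Types f g : T -> R.

(** [bdd] and [sml] are O(1) and o(1) along [F]. Two filters on pairs (x, e) occur: the principal
    one of K x ]0, 1], for uniform bounds, and that of points close to x0 with e / u small, for the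
    limit. *)
Definition bdd f := exists C, F [set z | `|f z| <= C].
Definition sml f := forall eta, 0 < eta -> F [set z | `|f z| <= eta].

Lemma bdd_cst c : bdd (fun=> c).
Proof. by exists `|c|; apply: filterE => z /=. Qed.

Lemma bddD f g : bdd f -> bdd g -> bdd (fun z => f z + g z).
Proof.
move=> [C fC] [D gD]; exists (C + D); apply: filterS2 fC gD => z /= h1 h2.
by apply: le_trans (ler_normD _ _) _; exact: lerD.
Qed.

Lemma bddN f : bdd f -> bdd (fun z => - f z).
Proof. by move=> [C fC]; exists C; apply: filterS fC => z /=; rewrite normrN. Qed.

Lemma bddM f g : bdd f -> bdd g -> bdd (fun z => f z * g z).
Proof.
move=> [C fC] [D gD]; exists (C * D); apply: filterS2 fC gD => z /= h1 h2.
by rewrite normrM ler_pM.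
Qed.

Lemma bddX f n : bdd f -> bdd (fun z => f z ^+ n).
Proof.
move=> bf; elim: n => [|n IH]; first exact: bdd_cst.
have [C hC] := bddM bf IH; exists C; apply: filterS hC => z /=.
by rewrite exprS.
Qed.

Lemma bdd_sum (I : Type) (r : seq I) (f : I -> T -> R) :
  (forall i, bdd (f i)) -> bdd (fun z => \sum_(i <- r) f i z).
Proof.
move=> bf; elim: r => [|i r IH].
  by exists 0; apply: filterE => z /=; rewrite big_nil normr0.
have [C hC] := bddD (bf i) IH; exists C; apply: filterS hC => z /=.
by rewrite big_cons.
Qed.

Lemma smlD f g : sml f -> sml g -> sml (fun z => f z + g z).
Proof.
move=> sf sg eta e0; have e2 : 0 < eta / 2 by rewrite divr_gt0.
apply: filterS2 (sf _ e2) (sg _ e2) => z /= h1 h2.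
by apply: le_trans (ler_normD _ _) _; lra.
Qed.

Lemma smlM f g : sml f -> bdd g -> sml (fun z => f z * g z).
Proof.
move=> sf [C gC] eta e0; have C1 : 0 < `|C| + 1 by rewrite ltr_wpDl.
apply: filterS2 (sf _ (divr_gt0 e0 C1)) gC => z /= h1 h2.
rewrite normrM; apply: le_trans (ler_pM _ _ h1 (_ : `|g z| <= `|C| + 1)) _ => //.
  by apply: le_trans h2 _; apply: le_trans (ler_norm _) _; rewrite lerDl.
by rewrite divfK// gt_eqF.
Qed.

Lemma smlMr f g : bdd f -> sml g -> sml (fun z => f z * g z).
Proof.
move=> bf sg eta e0; apply: filterS (smlM sg bf e0) => z /=.
by rewrite mulrC.
Qed.

Lemma smlN f : sml f -> sml (fun z => - f z).
Proof. by move=> sf eta e0; apply: filterS (sf _ e0) => z /=; rewrite normrN. Qed.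

Lemma sml_sum (I : Type) (r : seq I) (f : I -> T -> R) :
  (forall i, sml (f i)) -> sml (fun z => \sum_(i <- r) f i z).
Proof.
move=> sf; elim: r => [|i r IH].
  by move=> eta e0; apply: filterE => z /=; rewrite big_nil normr0 ltW.
move=> eta e0; apply: filterS (smlD (sf i) IH e0) => z /=.
by rewrite big_cons.
Qed.

Lemma sml_eq f g : F [set z | f z = g z] -> sml f -> sml g.
Proof. by move=> fg sf eta e0; apply: filterS2 fg (sf _ e0) => z /= ->. Qed.

Lemma sml_le f g : F [set z | `|g z| <= `|f z|] -> sml f -> sml g.
Proof.
by move=> gf sf eta e0; apply: filterS2 gf (sf _ e0) => z /= /le_trans; apply.
Qed.

End BoundedSmall.

Section Asymptotics.
Context {R : realType}.
Local Notation E4 := 'rV[R]_4.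
Local Notation Z := (E4 * R)%type.
Variables (G : E4 -> 'M[R]_4) (x0 : E4) (lam t g1 g2 g3 kap : R) (K : set E4).
Let H := lam *: G x0.
Local Notation quad := (qform H).
Local Notation lin := (lform H).
Hypothesis symH : H^T = H.
Hypothesis kap0 : 0 < kap.
Hypothesis quad_ge : forall y : E4, kap * `|y| ^+ 2 <= quad y.

Lemma quad_nonneg y : 0 <= quad y.
Proof. by apply: le_trans (quad_ge y); rewrite mulr_ge0 ?sqr_ge0// ltW. Qed.

Definition linC : R := \sum_(a < 4) \sum_(b < 4) `|H a b|.

Lemma lin_le (y : E4) a : `|lin y a| <= linC * `|y|.
Proof.
rewrite /lform; apply: le_trans (ler_norm_sum _ _ _) _.
apply: (@le_trans _ _ (\sum_(b < 4) `|H a b| * `|y|)).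
  by apply: ler_sum => b _; rewrite normrM ler_wpM2l// norm4_coord.
rewrite -mulr_suml ler_wpM2r// /linC [leRHS](bigD1 a)//= lerDl.
by apply: sumr_ge0 => i _; apply: sumr_ge0.
Qed.

Lemma quad_le (y : E4) : quad y <= linC * `|y| ^+ 2.
Proof.
have -> : quad y = \sum_(a < 4) \sum_(b < 4) H a b * (y 0 a * y 0 b) by [].
rewrite /linC mulr_suml; apply: ler_sum => a _; rewrite mulr_suml.
apply: ler_sum => b _; apply: le_trans (ler_norm _) _.
by rewrite normrM normrM ler_wpM2l// expr2; apply: ler_pM => //; exact: norm4_coord.
Qed.

(** Each quantity carries the power of [u] that makes it bounded as e tends to 0. With psi the
    bubble at e = z.2, [uA] is u Lap psi, [uB] is u |grad psi|^2, [uC] is u Ric(grad psi, grad psi),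
    and [E] is u^2 times the energy density. *)
Let u (z : Z) := z.2 + quad (z.1 - x0).
Let p0 z := u z * theta (u z).
Let p1 z := u z * theta1 (u z).
Let p2 z := u z ^+ 2 * theta2 (u z).
Let N a (z : Z) := lin (z.1 - x0) a.
Let NN a b z := N a z * N b z / u z.
Let uD1 a z := t * (p1 z * (2 * N a z)).
Let uD2 a b z := t * (p2 z * (4 * NN b a z) + p1 z * (2 * H b a)).
Let uDD a b z := t ^+ 2 * (p1 z ^+ 2 * (4 * NN a b z)).
Let uA z := \sum_(a < 4) \sum_(b < 4) upp G a b z.1 *
  (uD2 a b z - \sum_(c < 4) christoffel G c a b z.1 * uD1 c z).
Let uB z := \sum_(a < 4) \sum_(b < 4) upp G a b z.1 * uDD a b z.
Let uC z := \sum_(a < 4) \sum_(b < 4) \sum_(c < 4) \sum_(d < 4)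
  ric G a b z.1 * upp G a c z.1 * upp G b d z.1 * uDD c d z.
Let E z := g1 * (4 * (u z * (t * p0 z) * weyl_norm2 G z.1)) +
  g2 * ((uA z ^+ 2 + 2 / 3 * scal G z.1 * (u z * uB z) - 2 * (u z * uC z))
        + 4 * (Qcurv G z.1 * (u z * (t * p0 z)))) +
  g3 * (12 * (uA z + uB z) ^+ 2
        - 4 * (u z * (t * p0 z) * lap G (scal G) z.1 + scal G z.1 * (u z * uB z))).

Lemma energy_bubbleE (z : Z) : 0 < z.2 ->
  energy g1 g2 g3 G (bubble H x0 t z.2) z.1 * u z ^+ 2 = E z.
Proof.
move=> e0; set psi := bubble H x0 t z.2.
have u0 : u z != 0 by rewrite gt_eqF// ltr_wpDr// quad_nonneg.
have eA : u z * lap G psi z.1 = uA z.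
  rewrite /lap /lap_of mulr_sumr; apply: eq_bigr => a _.
  rewrite mulr_sumr; apply: eq_bigr => b _.
  rewrite mulrCA; congr (_ * _); rewrite mulrBr mulr_sumr; congr (_ - _).
    rewrite (pd2_bubble x0 symH quad_nonneg t e0) /uD2 /p1 /p2 /NN /N -/(u z); field; exact: u0.
  apply: eq_bigr => c _; rewrite mulrCA; congr (_ * _).
  by rewrite (pd_bubble x0 symH quad_nonneg t e0) /uD1 /p1 /N -/(u z); ring.
have eDD a b : u z * (pd a psi z.1 * pd b psi z.1) = uDD a b z.
  rewrite !(pd_bubble x0 symH quad_nonneg t e0) /uDD /p1 /NN /N -/(u z); field; exact: u0.
have eB : u z * grad2 G psi z.1 = uB z.
  rewrite /grad2 /grad2_of mulr_sumr; apply: eq_bigr => a _.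
  rewrite mulr_sumr; apply: eq_bigr => b _.
  by rewrite -eDD -mulrA mulrCA.
have eC : u z * ricgrad G psi z.1 = uC z.
  rewrite /ricgrad /ricgrad_of mulr_sumr; apply: eq_bigr => a _.
  rewrite mulr_sumr; apply: eq_bigr => b _; rewrite mulr_sumr; apply: eq_bigr => c _.
  rewrite mulr_sumr; apply: eq_bigr => d _.
  by rewrite -eDD -mulrA mulrCA.
have ep : u z * psi z.1 = t * p0 z by rewrite /psi /bubble /p0 -/(u z) mulrCA.
rewrite /E -eA -eB -eC -ep /energy.
move: (lap G psi z.1) (grad2 G psi z.1) (ricgrad G psi z.1) (psi z.1).
move: (weyl_norm2 G z.1) (scal G z.1) (Qcurv G z.1) (lap G (scal G) z.1) (u z).
by move=> *; ring.
Qed.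

Let bK (f : E4 -> R) := exists C, forall x, K x -> `|f x| <= C.
Hypothesis b_y : bK (fun x => `|x - x0|).
Hypothesis b_upp : forall a b, bK (upp G a b).
Hypothesis b_chr : forall c a b, bK (christoffel G c a b).
Hypothesis b_ric : forall a b, bK (ric G a b).
Hypothesis b_scal : bK (scal G).
Hypothesis b_weyl : bK (weyl_norm2 G).
Hypothesis b_Q : bK (Qcurv G).
Hypothesis b_lap : bK (lap G (scal G)).

Section WithFilter.
Variables (F : set_system Z) (FF : Filter F).
Hypothesis FP : F [set z : Z | K z.1 /\ 0 < z.2 <= 1].

Let bdd_coef f : bK f -> bdd F (fun z : Z => f z.1).
Proof. by move=> [C hC]; exists C; apply: filterS FP => z [/hC]. Qed.

Let Fu : F [set z | 0 < u z].
Proof. by apply: filterS FP => z [_ /andP[z0 _]]; rewrite /= ltr_wpDr// quad_nonneg. Qed.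

Let Bu : bdd F u.
Proof.
have [C hC] := b_y; exists (1 + linC * C ^+ 2).
apply: filterS FP => z [/hC Kz /andP[z0 z1]] /=.
have l0 : 0 <= linC by apply: sumr_ge0 => a _; apply: sumr_ge0.
rewrite normr_id in Kz.
rewrite ger0_norm; last by rewrite addr_ge0 ?quad_nonneg// ltW.
apply: lerD => //; apply: le_trans (quad_le _) _; apply: ler_wpM2l => //.
by rewrite lerXn2r ?nnegrE// (le_trans _ Kz).
Qed.

Let Bp0 : bdd F p0.
Proof.
exists 1; apply: filterS Fu => z /= u0; rewrite ger0_norm; first exact: mul_theta_le1.
by rewrite mulr_ge0 ?theta_ge0// ltW.
Qed.

Let Ep1 z : 0 < u z -> u z < 1 -> p1 z = - (1 - u z) ^+ 2.
Proof. by move=> u0 u1; rewrite /p1 /theta1 u1 mulrN mulrC divfK// gt_eqF. Qed.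

Let Ep2 z : 0 < u z -> u z < 1 -> p2 z = 1 - u z ^+ 2.
Proof. by move=> u0 u1; rewrite /p2 /theta2 u1 mulrC divfK// expf_neq0// gt_eqF. Qed.

Let Bp1 : bdd F p1.
Proof.
exists 1; apply: filterS Fu => z /= u0; have [u1|u1] := ltP (u z) 1; last first.
  by rewrite /p1 /theta1 ltNge u1 mulr0 normr0.
rewrite Ep1// normrN ger0_norm ?sqr_ge0// expr_le1//; lra.
Qed.

Let Bp2 : bdd F p2.
Proof.
exists 1; apply: filterS Fu => z /= u0; have [u1|u1] := ltP (u z) 1; last first.
  by rewrite /p2 /theta2 ltNge u1 mulr0 normr0.
have : 0 <= u z ^+ 2 <= 1 by rewrite sqr_ge0 expr_le1//; lra.
by rewrite Ep2// => /andP[? ?]; rewrite ger0_norm; lra.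
Qed.

Let BN a : bdd F (N a).
Proof.
have [C hC] := b_y; exists (linC * C).
apply: filterS FP => z [/hC Kz _] /=; rewrite normr_id in Kz.
apply: le_trans (lin_le _ _) _; apply: ler_wpM2l => //.
by apply: sumr_ge0 => i _; apply: sumr_ge0.
Qed.

(** This is where ellipticity enters: a product of two linear forms is at most a multiple of |y|^2,
    hence of the quadratic form, hence of [u]. *)
Let BNN a b : bdd F (NN a b).
Proof.
exists (linC ^+ 2 / kap); apply: filterS FP => z /= [_ /andP[z0 _]].
have u0 : 0 < u z by rewrite ltr_wpDr// quad_nonneg.
rewrite /NN normrM normfV (gtr0_norm u0) ler_pdivrMr//.
have qu : quad (z.1 - x0) <= u z.
  by rewrite /u lerDr; exact: ltW.
have l0 : 0 <= linC by apply: sumr_ge0 => i _; apply: sumr_ge0.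
rewrite normrM; apply: le_trans (ler_pM _ _ (lin_le _ a) (lin_le _ b)) _ => //.
apply: (@le_trans _ _ (linC ^+ 2 / kap * (kap * `|z.1 - x0| ^+ 2))).
  by rewrite mulrA divfK ?gt_eqF// !expr2; lra.
apply: ler_wpM2l; first by rewrite divr_ge0 ?sqr_ge0// ltW.
exact: le_trans (quad_ge _) qu.
Qed.

Ltac bddt := repeat lazymatch goal with
  | |- bdd _ u => exact: Bu
  | |- bdd _ p0 => exact: Bp0
  | |- bdd _ p1 => exact: Bp1
  | |- bdd _ p2 => exact: Bp2
  | |- bdd _ (N _) => exact: BN
  | |- bdd _ (NN _ _) => exact: BNN
  | |- bdd _ (fun z => upp _ _ _ z.1) => exact: bdd_coef (b_upp _ _)
  | |- bdd _ (fun z => christoffel _ _ _ _ z.1) => exact: bdd_coef (b_chr _ _ _)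
  | |- bdd _ (fun z => ric _ _ _ z.1) => exact: bdd_coef (b_ric _ _)
  | |- bdd _ (fun z => scal _ z.1) => exact: bdd_coef b_scal
  | |- bdd _ (fun z => weyl_norm2 _ z.1) => exact: bdd_coef b_weyl
  | |- bdd _ (fun z => Qcurv _ z.1) => exact: bdd_coef b_Q
  | |- bdd _ (fun z => lap _ _ z.1) => exact: bdd_coef b_lap
  | |- bdd _ (fun z => @?f z + @?h z) => apply: bddD
  | |- bdd _ (fun z => @?f z * @?h z) => apply: bddM
  | |- bdd _ (fun z => - @?f z) => apply: bddN
  | |- bdd _ (fun z => @?f z ^+ _) => apply: bddX
  | |- _ => first [exact: bdd_cst | apply: bdd_sum => ?]
  end.

Let BD1 a : bdd F (uD1 a). Proof. rewrite /uD1; bddt. Qed.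
Let BD2 a b : bdd F (uD2 a b). Proof. rewrite /uD2; bddt. Qed.
Let BDD a b : bdd F (uDD a b). Proof. rewrite /uDD; bddt. Qed.

Ltac bddt1 := repeat lazymatch goal with
  | |- bdd _ (uD1 _) => exact: BD1
  | |- bdd _ (uD2 _ _) => exact: BD2
  | |- bdd _ (uDD _ _) => exact: BDD
  | |- _ => progress bddt
  end.

Let BA : bdd F uA. Proof. rewrite /uA; bddt1. Qed.
Let BB : bdd F uB. Proof. rewrite /uB; bddt1. Qed.
Let BC : bdd F uC. Proof. rewrite /uC; bddt1. Qed.

Ltac bddt2 := repeat lazymatch goal with
  | |- bdd _ uA => exact: BA
  | |- bdd _ uB => exact: BB
  | |- bdd _ uC => exact: BC
  | |- _ => progress bddt1
  end.

Lemma bdd_energy : bdd F E.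
Proof. rewrite /E; bddt2. Qed.

Hypothesis unitG : G x0 \in unitmx.
Hypothesis Su : sml F u.
Hypothesis Srho : sml F (fun z : Z => z.2 / u z).
Hypothesis Sy : sml F (fun z : Z => `|z.1 - x0|).
Hypothesis Supp : forall a b, sml F (fun z : Z => upp G a b z.1 - upp G a b x0).

Let Fu1 : F [set z | u z < 1].
Proof.
have h2 : 0 < (2^-1 : R) by rewrite invr_gt0.
apply: filterS (Su h2) => z /= h; apply: le_lt_trans (ler_norm _) _.
by apply: le_lt_trans h _; rewrite invf_lt1// ltr1n.
Qed.

Let Sp1 : sml F (fun z => p1 z + 1).
Proof.
apply: (@sml_eq _ _ _ _ (fun z => u z * (2 - u z))).
  by apply: filterS2 Fu Fu1 => z u0 u1; rewrite /= Ep1//; ring.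
by apply: smlM => //; bddt.
Qed.

Let Sp2 : sml F (fun z => p2 z - 1).
Proof.
apply: (@sml_eq _ _ _ _ (fun z => u z * - u z)).
  by apply: filterS2 Fu Fu1 => z u0 u1; rewrite /= Ep2//; ring.
by apply: smlM => //; bddt.
Qed.

Let SN a : sml F (N a).
Proof.
have l0 : 0 <= linC by apply: sumr_ge0 => i _; apply: sumr_ge0.
apply: (@sml_le _ _ F FF (fun z : Z => `|z.1 - x0| * linC)); last first.
  by apply: smlM => //; exact: bdd_cst.
apply: filterE => z /=; rewrite normrM normr_id (ger0_norm l0) mulrC.
exact: lin_le.
Qed.

Let SD1 a : sml F (uD1 a).
Proof.
by rewrite /uD1; apply: smlMr; [bddt|apply: smlMr; [bddt|apply: smlMr; [bddt|exact: SN]]].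
Qed.

Let upp_lin (y : E4) (a : 'I_4) : \sum_(b < 4) upp G a b x0 * lin y b = lam * y 0 a.
Proof.
have /matrixP UG : invmx (G x0) *m G x0 = 1%:M by rewrite mulVmx.
transitivity (\sum_(b < 4) \sum_(c < 4) lam * y 0 c * (upp G a b x0 * G x0 b c)).
  apply: eq_bigr => b _; rewrite /lform mulr_sumr; apply: eq_bigr => c _.
  by rewrite mxE; ring.
rewrite exchange_big/= (bigD1 a)//= [X in _ + X]big1 ?addr0 => [|c ca].
  rewrite -mulr_sumr; have := UG a a; rewrite !mxE eqxx => h.
  by rewrite [X in _ * X](_ : _ = 1) ?mulr1.
rewrite -mulr_sumr; have := UG a c; rewrite !mxE eq_sym (negbTE ca) => h.
by rewrite [X in _ * X](_ : _ = 0) ?mulr0.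
Qed.

Let upp_trace : \sum_(a < 4) \sum_(b < 4) upp G a b x0 * H b a = 4 * lam.
Proof.
have /matrixP UG : invmx (G x0) *m G x0 = 1%:M by rewrite mulVmx.
transitivity (\sum_(a < 4) lam).
  apply: eq_bigr => a _; transitivity (lam * \sum_(b < 4) invmx (G x0) a b * G x0 b a).
    by rewrite mulr_sumr; apply: eq_bigr => b _; rewrite /H mxE /upp; ring.
  by have := UG a a; rewrite !mxE eqxx => ->; rewrite mulr1.
by rewrite sumr_const card_ord mulr_natl.
Qed.

Let upp_quad (y : E4) : \sum_(a < 4) \sum_(b < 4) upp G a b x0 * (lin y a * lin y b) = lam * quad y.
Proof.
transitivity (\sum_(a < 4) lin y a * (lam * y 0 a)).
  apply: eq_bigr => a _; rewrite -upp_lin mulr_sumr; apply: eq_bigr => b _; ring.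
rewrite /qform mulr_sumr; apply: eq_bigr => a _.
rewrite mulrCA [_ * y 0 a]mulrC; congr (lam * _); rewrite /lform mulr_sumr.
by apply: eq_bigr => b _; ring.
Qed.

(** With y = x - x0, contracting with the inverse metric at x0 gives lam quad(y) / u, and quad(y) /
    u = 1 - e / u. The limit therefore requires e to be negligible compared with [u], not merely
    small. *)
Let upp_NN z : 0 < u z ->
  \sum_(a < 4) \sum_(b < 4) upp G a b x0 * NN a b z = lam * (1 - z.2 / u z).
Proof.
move=> u0; transitivity (lam * quad (z.1 - x0) / u z).
  rewrite -upp_quad mulr_suml; apply: eq_bigr => a _.
  by rewrite mulr_suml; apply: eq_bigr => b _; rewrite /NN /N mulrA.
rewrite (_ : quad (z.1 - x0) = u z - z.2); last by rewrite /u [z.2 + _]addrC addrK.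
by field; rewrite gt_eqF.
Qed.

(** The inverse metric is frozen at x0. The remainder [rem] is small because the inverse metric is
    continuous and because the Christoffel terms multiply first derivatives, which are smaller than
    second ones by the small factor [N]. *)
Let SA : sml F (fun z => uA z + 4 * t * lam).
Proof.
pose rem z := \sum_(a < 4) \sum_(b < 4) ((upp G a b z.1 - upp G a b x0) * uD2 a b z
  - upp G a b z.1 * \sum_(c < 4) christoffel G c a b z.1 * uD1 c z).
have Srem : sml F rem.
  apply: sml_sum => a; apply: sml_sum => b; apply: smlD.
    by apply: smlM; [exact: Supp|exact: BD2].
  apply: smlN; apply: smlMr; first by bddt.
  by apply: sml_sum => c; apply: smlMr; [bddt|exact: SD1].
apply: (@sml_eq _ _ _ _ (fun z => rem z +
    4 * t * lam * (((p2 z - 1) + - (z.2 / u z * p2 z)) + (p1 z + 1) * 2))); last first.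
  apply: smlD => //; apply: smlMr; first by bddt.
  apply: smlD; first by apply: smlD; [exact: Sp2|apply: smlN; apply: smlM => //; bddt].
  by apply: smlM => //; bddt.
apply: filterS Fu => z u0 /=.
have -> : uA z = rem z + \sum_(a < 4) \sum_(b < 4) upp G a b x0 * uD2 a b z.
  rewrite /uA /rem -big_split/=; apply: eq_bigr => a _.
  by rewrite -big_split/=; apply: eq_bigr => b _; rewrite mulrBr; ring.
(* As p2 tends to 1, p1 to -1 and e / u to 0, this tends to t (4 lam - 8 lam); the factor 4 of the
   trace is the dimension. *)
have -> : \sum_(a < 4) \sum_(b < 4) upp G a b x0 * uD2 a b z =
    t * (4 * p2 z * (lam * (1 - z.2 / u z)) + 2 * p1 z * (4 * lam)).
  rewrite -(upp_NN u0) -upp_trace !mulr_sumr -big_split/= mulr_sumr.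
  apply: eq_bigr => a _; rewrite !mulr_sumr -big_split/= mulr_sumr.
  by apply: eq_bigr => b _; rewrite /uD2 /NN; ring.
ring.
Qed.

Let SB : sml F (fun z => uB z - 4 * t ^+ 2 * lam).
Proof.
pose rem z := \sum_(a < 4) \sum_(b < 4) (upp G a b z.1 - upp G a b x0) * uDD a b z.
have Srem : sml F rem.
  apply: sml_sum => a; apply: sml_sum => b.
  by apply: smlM; [exact: Supp|exact: BDD].
apply: (@sml_eq _ _ _ _ (fun z => rem z +
    4 * t ^+ 2 * lam * ((p1 z + 1) * (p1 z - 1) + - (z.2 / u z * p1 z ^+ 2)))); last first.
  apply: smlD => //; apply: smlMr; first by bddt.
  by apply: smlD; [apply: smlM => //; bddt|apply: smlN; apply: smlM => //; bddt].
apply: filterS Fu => z u0 /=.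
have -> : uB z = rem z + \sum_(a < 4) \sum_(b < 4) upp G a b x0 * uDD a b z.
  rewrite /uB /rem -big_split/=; apply: eq_bigr => a _.
  by rewrite -big_split/=; apply: eq_bigr => b _; ring.
have -> : \sum_(a < 4) \sum_(b < 4) upp G a b x0 * uDD a b z =
    t ^+ 2 * p1 z ^+ 2 * 4 * (lam * (1 - z.2 / u z)).
  rewrite -(upp_NN u0) mulr_sumr.
  apply: eq_bigr => a _; rewrite mulr_sumr.
  by apply: eq_bigr => b _; rewrite /uDD; ring.
ring.
Qed.

(* With H = lam G(x0), u Lap psi tends to - 4 t lam and u |grad psi|^2 tends to
   4 t^2 lam, where u = e + H(x - x0); all other terms are of lower order. *)
Lemma sml_energy :
  sml F (fun z => E z - 16 * t ^+ 2 * lam ^+ 2 * (g2 + 12 * g3 * (1 - t) ^+ 2)).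
Proof.
pose cA := - (4 * t * lam); pose cB := 4 * t ^+ 2 * lam.
(* The lower order terms carry a factor [u]. The two squares minus their limits are factored as
   differences of squares, one factor small and the other bounded. *)
apply: (@sml_eq _ _ _ _ (fun z =>
  (u z * (g1 * (4 * (t * p0 z * weyl_norm2 G z.1)) +
    g2 * (2 / 3 * scal G z.1 * uB z - 2 * uC z + 4 * (Qcurv G z.1 * (t * p0 z)))
    - g3 * (4 * (t * p0 z * lap G (scal G) z.1 + scal G z.1 * uB z))) +
   (uA z + 4 * t * lam) * (g2 * (uA z + cA) + 12 * g3 * (uA z + uB z + (cA + cB)))) +
   (uB z - 4 * t ^+ 2 * lam) * (12 * g3 * (uA z + uB z + (cA + cB))))).
  apply: filterE => z /=; rewrite /E /cA /cB.
  move: (uA z) (uB z) (uC z) (p0 z) (u z) (weyl_norm2 G z.1) (scal G z.1).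
  by move: (Qcurv G z.1) (lap G (scal G) z.1) => *; ring.
apply: smlD; first apply: smlD.
- by apply: smlM => //; bddt2.
- by apply: smlM => //; bddt2.
- by apply: smlM => //; bddt2.
Qed.

End WithFilter.
End Asymptotics.

(** * Dyadic estimates *)

Section DyadicSums.
Context {R : realType}.
Implicit Types (r m : R) (N : nat).

Let halve r N : r / 2 ^+ N.+1 = r / 2 ^+ N / 2.
Proof. by rewrite exprS invfM; ring. Qed.

(** The full series is geometric of ratio 16, so all terms before index [N] add up to at most the
    term of index [N]. *)
Lemma dyadic_sum4_core r m N : 0 < r ->
  \sum_(k < N) (if m <= r / 2 ^+ k then (r / 2 ^+ k) ^- 4 else 0) <= (r / 2 ^+ N) ^- 4.
Proof.
move=> r0; elim: N => [|N IH].
  by rewrite big_ord0 invr_ge0 exprn_ge0// divr_ge0// ltW.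
rewrite big_ord_recr/=.
have p0 : 0 < r / 2 ^+ N by rewrite divr_gt0// exprn_gt0.
have -> : (r / 2 ^+ N.+1) ^- 4 = 16 * (r / 2 ^+ N) ^- 4.
  by rewrite halve; move: p0; move: (_ / 2 ^+ N) => q q0; field; rewrite gt_eqF.
have q0 : 0 < (r / 2 ^+ N) ^- 4 by rewrite invr_gt0 exprn_gt0.
by case: ifP => _; lra.
Qed.

(** The last nonzero term is at most m^(-4), and so is the sum of all earlier ones. With m = |x -
    x0|, this compares the dyadic sum with the true density |x - x0|^(-4). *)
Lemma dyadic_sum4 r m N : 0 < r -> 0 < m ->
  \sum_(k < N) (if m <= r / 2 ^+ k then (r / 2 ^+ k) ^- 4 else 0) <= 2 * m ^- 4.
Proof.
move=> r0 m0; elim: N => [|N IH].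
  by rewrite big_ord0 mulr_ge0// invr_ge0 exprn_ge0// ltW.
rewrite big_ord_recr/=; case: ifPn => [h|_]; last by rewrite addr0.
have := dyadic_sum4_core m N r0.
have : (r / 2 ^+ N) ^- 4 <= m ^- 4.
  by rewrite lef_pV2 ?posrE ?exprn_gt0 ?(lt_le_trans m0 h)// lerXn2r ?nnegrE ?(le_trans _ h)// ltW.
lra.
Qed.

(** Here the dyadic sum has to dominate. The factor 8 = 2^3 pays for replacing [m] by the next
    larger dyadic radius. *)
Lemma dyadic_sum3 r m N : 0 < r ->
  (Num.max m (r / 2 ^+ N)) ^- 3 <=
  r ^- 3 + \sum_(k < N) (if m <= r / 2 ^+ k then 8 * (r / 2 ^+ k) ^- 3 else 0).
Proof.
move=> r0; elim: N => [|N IH].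
  rewrite big_ord0 addr0 expr0 divr1 lef_pV2 ?posrE ?exprn_gt0 ?lt_max ?r0 ?orbT//.
  by rewrite lerXn2r ?nnegrE ?le_max ?lexx ?(ltW r0) ?orbT.
have p0 : 0 < r / 2 ^+ N by rewrite divr_gt0// exprn_gt0.
have p1 : 0 < r / 2 ^+ N.+1 by rewrite divr_gt0// exprn_gt0.
have pE := halve r N.
rewrite big_ord_recr/= addrA; case: ifPn => [h|]; last first.
  rewrite -ltNge addr0 => h; apply: le_trans IH.
  rewrite !(elimT max_idPl)//; first exact: ltW.
  by rewrite pE; lra.
apply: (@le_trans _ _ (8 * (r / 2 ^+ N) ^- 3)).
  apply: (@le_trans _ _ ((r / 2 ^+ N.+1) ^- 3)).
    rewrite lef_pV2 ?posrE ?exprn_gt0 ?lt_max ?p1 ?orbT//.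
    by rewrite lerXn2r ?nnegrE ?le_max ?lexx ?(ltW p1) ?orbT.
  rewrite pE; move: p0; move: (_ / 2 ^+ N) => q q0.
  by rewrite [leLHS](_ : _ = 8 * q ^- 3)//; field; rewrite gt_eqF.
rewrite lerDr addr_ge0 ?invr_ge0 ?exprn_ge0// ?(ltW r0)//.
apply: sumr_ge0 => k _; case: ifP => // _.
by rewrite mulr_ge0// invr_ge0 exprn_ge0// divr_ge0// ltW.
Qed.

Lemma dyadic_sum1 r N : 0 < r -> \sum_(k < N) r / 2 ^+ k <= 2 * r.
Proof.
move=> r0; suff -> : \sum_(k < N) r / 2 ^+ k = 2 * r - 2 * (r / 2 ^+ N).
  by rewrite gerBl mulr_ge0// divr_ge0// ltW.
elim: N => [|N IH]; first by rewrite big_ord0 expr0 divr1 subrr.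
by rewrite big_ord_recr/= IH halve; field.
Qed.

End DyadicSums.

Section StepBound.
Context {R : realType}.
Local Notation E4 := 'rV[R]_4.
Local Notation mu := (@leb4 R).
Variables (U : set E4) (x0 : E4) (delta : R).
Hypothesis oU : open U.
Hypothesis KU : cball x0 delta `<=` U.

(** The substitute for integration in polar coordinates: [s] lists pairs (coefficient, half-side) of
    concentric cubes, and the coefficients may have either sign. *)
Lemma int4_step_le (s : seq (R * R)) (f : E4 -> R) :
  (forall p, p \in s -> 0 <= p.2 <= delta) ->
  mu.-integrable (pre4 U) (EFin \o (f \o @vec4 R)) ->
  (forall x, U x -> f x <= \sum_(p <- s) p.1 * \1_(cball x0 p.2) x) ->
  int4 U f <= \sum_(p <- s) p.1 * (2 * p.2) ^+ 4.
Proof.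
move=> sd fi fs; have mU := open_measurable4 oU.
have [Si SE] : mu.-integrable (pre4 U) (EFin \o ((fun x => \sum_(p <- s) p.1 * \1_(cball x0 p.2) x) \o @vec4 R))
   /\ int4 U (fun x => \sum_(p <- s) p.1 * \1_(cball x0 p.2) x) = \sum_(p <- s) p.1 * (2 * p.2) ^+ 4.
  elim: s sd {fs} => [|p s IH] sd.
    rewrite big_nil; split.
      apply: (eq_integrable mU (cst 0%E)) => [q _|]; first by rewrite /= big_nil.
      exact: integrable0.
    transitivity (\int[mu]_(q in pre4 U) (0 : R)); last by rewrite Rintegral_cst// mul0r.
    by apply: eq_Rintegral => q _; rewrite big_nil.
  have [|Si SE] := IH; first by move=> q qs; apply: sd; rewrite inE qs orbT.
  have /andP[p0 pd] : 0 <= p.2 <= delta by apply: sd; rewrite mem_head.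
  have cU : pre4 cball x0 p.2 `<=` pre4 U.
    by move=> q /= cq; apply: KU; exact: le_trans cq pd.
  have mc : measurable (pre4 cball x0 p.2) by apply: closed_measurable4; exact: cball_closed.
  have ii : mu.-integrable (pre4 U) (EFin \o ((\1_(cball x0 p.2) : E4 -> R) \o @vec4 R)).
    apply: (@integrableS _ _ _ mu setT) => //.
    apply: (@indic_integrable4 R (pre4 cball x0 p.2)) => //.
    by rewrite leb4_cball// ltry.
  have iE : int4 U (\1_(cball x0 p.2)) = (2 * p.2) ^+ 4.
    rewrite /int4 /Rintegral.
    apply: (congr1 fine (y := ((2 * p.2) ^+ 4)%:E)).
    transitivity (\int[mu]_(q in pre4 U) (\1_(pre4 cball x0 p.2) q)%:E)%E.
      exact: eq_integral.
    etransitivity; first exact: (integral_indic mu mU mc).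
    etransitivity; last exact: (leb4_cball x0 p0).
    by congr (mu _); apply/setIidPl.
  have iZ := integrableZl mU p.1 ii.
  split.
    apply: (eq_integrable mU _ _ _ (integrableD mU iZ Si)) => q _.
    by rewrite /= big_cons EFinD EFinM.
  rewrite /int4.
  transitivity (\int[mu]_(q in pre4 U) (p.1 * \1_(cball x0 p.2) (vec4 q) +
     \sum_(p <- s) p.1 * \1_(cball x0 p.2) (vec4 q))).
    by apply: eq_Rintegral => q _; rewrite big_cons.
  rewrite big_cons (RintegralD mU iZ Si); congr (_ + _) => //.
  by rewrite -iE (RintegralZl _ mU ii).
rewrite -SE; apply: le_Rintegral => // q Uq; exact: fs.
Qed.

End StepBound.

Section Ellipticity.
Context {R : realType}.
Local Notation E4 := 'rV[R]_4.

Lemma quadE (A : 'M[R]_4) (y : E4) : qform A y = (y *m A *m y^T) 0 0.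
Proof.
rewrite mxE /qform exchange_big; apply: eq_bigr => b _ /=.
rewrite !mxE mulr_suml; apply: eq_bigr => a _; ring.
Qed.

Lemma quadZ (A : 'M[R]_4) (c : R) (y : E4) : qform A (c *: y) = c ^+ 2 * qform A y.
Proof.
rewrite /qform mulr_sumr; apply: eq_bigr => a _; rewrite mulr_sumr.
by apply: eq_bigr => b _; rewrite !mxE; ring.
Qed.

Lemma quad_scale (A : 'M[R]_4) (c : R) (y : E4) : qform (c *: A) y = c * qform A y.
Proof.
rewrite /qform mulr_sumr; apply: eq_bigr => a _; rewrite mulr_sumr.
by apply: eq_bigr => b _; rewrite !mxE; ring.
Qed.

Lemma quad_continuous (A : 'M[R]_4) (y : E4) : {for y, continuous (qform A)}.
Proof.
have oT : open [set: E4] := openT.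
have : Cn 0 [set: E4] (qform A).
  rewrite /qform; apply: Cn_sum => // a _; apply: Cn_sum => // b _.
  by apply: CnM => //; [exact: Cn_cst|apply: CnM => //; exact: Cn_coord].
by move=> C; exact: (Cn_cont C (Logic.I : setT y)).
Qed.

Lemma quad_elliptic (A : 'M[R]_4) :
  (forall y : E4, y != 0 -> 0 < (y *m A *m y^T) 0 0) ->
  exists2 c, 0 < c & forall y, c * `|y| ^+ 2 <= qform A y.
Proof.
move=> pA; pose S : set E4 := [set y | `|y| = 1].
have Sn y : y != 0 -> S (`|y|^-1 *: y).
  by move=> y0; rewrite /S /= normrZ normfV normr_id mulVf// normr_eq0.
have S0 : S !=set0.
  pose v : E4 := const_mx 1; exists (`|v|^-1 *: v); apply: Sn; apply/eqP => /rowP /(_ 0).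
  by rewrite !mxE => /eqP; rewrite oner_eq0.
have cS : compact S.
  apply: (@subclosed_compact _ S (cball 0 1)); last 2 first.
  - exact: cball_compact.
  - by move=> y; rewrite /S /cball /= sub0r normrN => ->.
  rewrite (_ : S = (fun y => `|y|) @^-1` [set z | z = 1])//.
  apply: closed_comp; last exact: closed_eq.
  by move=> y _; apply: (@cvg_norm _ E4 E4 (nbhs y) _ id y); exact: cvg_id.
have [c] := EVT_min_rV S0 cS (continuous_subspaceT (@quad_continuous A)).
rewrite inE => Sc hc; exists (qform A c).
  rewrite quadE pA//; apply/eqP => c0; move: Sc; rewrite /S /= c0 normr0 => /eqP.
  by rewrite eq_sym oner_eq0.
move=> y; have [->|y0] := eqVneq y 0.
  by rewrite normr0 expr0n mulr0 /qform; do 2 apply: sumr_ge0 => ? _; rewrite !mxE !mulr0.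
have y2 : 0 < `|y| ^+ 2 by rewrite exprn_gt0// normr_gt0.
have := hc _ (mem_set (Sn _ y0)); rewrite quadZ exprVn => h.
by rewrite -ler_pdivlMr// mulrC.
Qed.

End Ellipticity.

(** * Bounds for the energy density of the bubble *)

Section BubbleEnergy.
Context {R : realType}.
Local Notation E4 := 'rV[R]_4.
Local Notation Z := (E4 * R)%type.
Variables (U : set E4) (G : E4 -> 'M[R]_4) (x0 : E4) (lam t g1 g2 g3 kap delta : R).
Hypothesis oU : open U.
Hypothesis sG : forall a b, smooth_on U (fun x => G x a b).
Hypothesis pG : forall x, U x -> forall v : E4, v != 0 -> 0 < (v *m G x *m v^T) 0 0.
Hypothesis delta0 : 0 < delta.
Hypothesis KU : cball x0 delta `<=` U.
Let K := cball x0 delta.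
Let H := lam *: G x0.
Local Notation quad := (qform H).
Hypothesis symH : H^T = H.
Hypothesis kap0 : 0 < kap.
Hypothesis quad_ge : forall y : E4, kap * `|y| ^+ 2 <= quad y.
Let u (x : E4) (e : R) := e + quad (x - x0).

Let Ux0 : U x0. Proof. by apply: KU; rewrite /cball /= subrr normr0 ltW. Qed.

Let bK f : Cn 0 U f -> exists C, forall x, K x -> `|f x| <= C.
Proof.
move=> Cf; apply: cont_compact_bounded => [|x Kx]; first exact: cball_compact.
by apply: (Cn_cont Cf); exact: KU.
Qed.

Let b_y : exists C, forall x, K x -> `|(`|x - x0| : R)| <= C.
Proof. by exists delta => x; rewrite /K /cball /= normr_id distrC. Qed.

(** [bdd_energy] for the principal filter on the whole range of (x, e), which makes [C] independent
    of e. *)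
Lemma energy_bubble_le : exists2 C, 0 <= C & forall x e, cball x0 delta x -> 0 < e <= 1 ->
  energy g1 g2 g3 G (bubble H x0 t e) x * u x e ^+ 2 <= C.
Proof.
have [C hC] := @bdd_energy R G x0 lam t g1 g2 g3 kap K kap0 quad_ge b_y
  (fun a b => bK (smooth_upp oU sG pG a b 0)) (fun c a b => bK (smooth_christoffel oU sG pG c a b 0))
  (fun a b => bK (smooth_ric oU sG pG a b 0)) (bK (smooth_scal oU sG pG 0))
  (bK (smooth_weyl_norm2 oU sG pG 0)) (bK (smooth_Qcurv oU sG pG 0))
  (bK (smooth_lap_scal oU sG pG 0)) _ (globally_filter [set z : Z | K z.1 /\ 0 < z.2 <= 1])
  (fun z => id).
exists `|C| => // x e Kx /andP[e0 e1].
have := hC (x, e) (conj Kx _); rewrite /= e0 e1 => /(_ isT) h.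
rewrite (energy_bubbleE t g1 g2 g3 symH kap0 quad_ge (z := (x, e)) e0).
apply: le_trans (ler_norm _) _; apply: le_trans h _; exact: ler_norm.
Qed.

(* Points near x0 where e is negligible compared with the quadratic form. *)
Let adm (d : R) : set Z :=
  [set z | [/\ 0 < z.2, `|z.1 - x0| <= d & z.2 <= d * u z.1 z.2]].
Let F : set_system Z := [set A | exists2 d, 0 < d & adm d `<=` A].

Let u0 z : 0 < z.2 -> 0 < u z.1 z.2.
Proof.
by move=> z0; rewrite ltr_wpDr//; apply: le_trans (quad_ge _); rewrite mulr_ge0 ?sqr_ge0// ltW.
Qed.

Let adm_mono d d' : d <= d' -> adm d `<=` adm d'.
Proof.
move=> dd z [z0 zd zu]; split=> //; first exact: le_trans zd dd.
by apply: le_trans zu _; rewrite ler_wpM2r// ltW// u0.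
Qed.

Let FF : Filter F.
Proof.
split.
- by exists 1.
- move=> A B [a a0 aA] [b b0 bB]; exists (Num.min a b); first by rewrite lt_min a0.
  move=> z hz; split.
    by apply: aA; apply: adm_mono hz; rewrite ge_min lexx.
  by apply: bB; apply: adm_mono hz; rewrite ge_min lexx orbT.
- by move=> A B AB [a a0 aA]; exists a => // z /aA /AB.
Qed.

Let Sy : sml F (fun z : Z => `|z.1 - x0|).
Proof. by move=> eta e0; exists eta => // z [_ h _]; rewrite /= normr_id. Qed.

Let Srho : sml F (fun z : Z => z.2 / u z.1 z.2).
Proof.
move=> eta e0; exists eta => // z [z0 _ h] /=; have up := u0 z0.
rewrite ger0_norm; first by rewrite ler_pdivrMr.
by apply: divr_ge0; exact: ltW.
Qed.

Let Su : sml F (fun z : Z => u z.1 z.2).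
Proof.
have l0 : 0 <= linC G x0 lam by apply: sumr_ge0 => a _; apply: sumr_ge0.
move=> eta e0.
(* The bound 1/2 gives e <= u / 2, which is absorbed into [u]; the other bound makes the quadratic
   form at most eta / 2. *)
pose d := Num.min (2^-1) (eta / (2 * (linC G x0 lam + 1))).
have d2 : d <= 2^-1 by rewrite ge_min lexx.
have d0 : 0 < d by rewrite lt_min invr_gt0 ltr0n/= divr_gt0// mulr_gt0// ltr_wpDl.
exists d => // z [z0 zd zu] /=; have up := u0 z0.
have q1 : quad (z.1 - x0) <= linC G x0 lam * `|z.1 - x0| ^+ 2 by exact: quad_le.
have q2 : linC G x0 lam * `|z.1 - x0| ^+ 2 <= (linC G x0 lam + 1) * d.
  apply: ler_pM => //; first by rewrite lerDl.
  rewrite expr2; apply: (@le_trans _ _ (d * 1)); last by rewrite mulr1.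
  by apply: ler_pM => //; rewrite (le_trans zd)// (le_trans d2)//; lra.
have q3 : (linC G x0 lam + 1) * d <= eta / 2.
  have : d <= eta / (2 * (linC G x0 lam + 1)) by rewrite ge_min lexx orbT.
  rewrite ler_pdivlMr ?mulr_gt0// ?ltr_wpDl//; lra.
have : d * u z.1 z.2 <= 2^-1 * u z.1 z.2 by rewrite ler_wpM2r// ltW.
rewrite gtr0_norm//; move: zu; rewrite /u; lra.
Qed.

Let Supp a b : sml F (fun z : Z => upp G a b z.1 - upp G a b x0).
Proof.
move=> eta e0.
have /cvgrPdist_le /(_ _ e0) := Cn_cont (smooth_upp oU sG pG a b 0) Ux0.
rewrite -nbhs_nbhs_norm => -[d /= d0 hd].
exists (d / 2); first by rewrite divr_gt0.
move=> z [_ zd _] /=; rewrite distrC; apply: hd.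
rewrite /ball_ /= distrC (le_lt_trans zd)//; lra.
Qed.

Let FP : F [set z : Z | K z.1 /\ 0 < z.2 <= 1].
Proof.
have [d d0 hd] := Su ltr01.
exists (Num.min d (Num.min 1 delta)); first by rewrite !lt_min d0 ltr01.
move=> z hz; have [z0 _ _] := hz.
have : adm d z by apply: adm_mono hz; rewrite ge_min lexx.
move=> /hd /=; rewrite gtr0_norm ?u0// => u1.
split; first by case: hz => _ h _; rewrite /K /cball /= distrC (le_trans h)// !ge_min lexx !orbT.
rewrite z0 (le_trans _ u1)// /u lerDl; apply: le_trans (quad_ge _).
by rewrite mulr_ge0 ?sqr_ge0// ltW.
Qed.

Lemma energy_bubble_neg : 0 < lam -> 0 < t -> g2 + 12 * g3 * (1 - t) ^+ 2 < 0 ->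
  exists d c, [/\ 0 < d, 0 < c & forall x e, 0 < e -> `|x - x0| <= d -> e <= d * u x e ->
    energy g1 g2 g3 G (bubble H x0 t e) x * u x e ^+ 2 <= - c].
Proof.
move=> lam0 t0 neg; set Lam := _ + _ in neg.
have unitG : G x0 \in unitmx by rewrite unitmxE unitfE; exact: (det_pos_def_neq0 (pG Ux0)).
(* The limit is -2 c, so an error of size at most [c] leaves the value below -c. *)
pose c := - (8 * t ^+ 2 * lam ^+ 2 * Lam).
have c0 : 0 < c.
  by rewrite /c -mulrN mulr_gt0 ?oppr_gt0// mulr_gt0 ?exprn_gt0// mulr_gt0 ?exprn_gt0.
have := @sml_energy R G x0 lam t g1 g2 g3 kap K kap0 quad_ge b_y
  (fun a b => bK (smooth_upp oU sG pG a b 0)) (fun c a b => bK (smooth_christoffel oU sG pG c a b 0))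
  (fun a b => bK (smooth_ric oU sG pG a b 0)) (bK (smooth_scal oU sG pG 0))
  (bK (smooth_weyl_norm2 oU sG pG 0)) (bK (smooth_Qcurv oU sG pG 0))
  (bK (smooth_lap_scal oU sG pG 0)) _ FF FP unitG Su Srho Sy Supp c c0.
move=> [d d0 hd]; exists d, c; split=> // x e e0 xd eu.
have h := le_trans (ler_norm _) (hd (x, e) (And3 e0 xd eu)).
rewrite lerBlDr in h.
rewrite (energy_bubbleE t g1 g2 g3 symH kap0 quad_ge (z := (x, e)) e0).
apply: le_trans h _; rewrite /c /Lam; lra.
Qed.

End BubbleEnergy.

Section BubbleSteps.
Context {R : realType}.
Local Notation E4 := 'rV[R]_4.
Variables (U : set E4) (G : E4 -> 'M[R]_4) (x0 : E4) (lam t g1 g2 g3 kap delta : R).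
Hypothesis oU : open U.
Hypothesis sG : forall a b, smooth_on U (fun x => G x a b).
Hypothesis pG : forall x, U x -> forall v : E4, v != 0 -> 0 < (v *m G x *m v^T) 0 0.
Hypothesis delta0 : 0 < delta.
Hypothesis KU : cball x0 delta `<=` U.
Let H := lam *: G x0.
Local Notation quad := (qform H).
Hypothesis symH : H^T = H.
Hypothesis kap0 : 0 < kap.
Hypothesis quad_ge : forall y : E4, kap * `|y| ^+ 2 <= quad y.
Hypothesis kap_delta : kap * delta ^+ 2 = 1.
Hypothesis t0 : 0 < t.
Hypothesis t38 : t <= 3 / 8.
Hypothesis lam0 : 0 < lam.
Hypothesis neg : g2 + 12 * g3 * (1 - t) ^+ 2 < 0.
Variables (vol : E4 -> R) (v0 v1 : R).
Hypothesis v0_gt0 : 0 < v0.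
Hypothesis vol_bounds : forall x, cball x0 delta x -> v0 <= vol x <= v1.

Let v1_gt0 : 0 < v1.
Proof.
have /vol_bounds/andP[h1 h2] : cball x0 delta x0 by rewrite /cball /= subrr normr0 ltW.
exact: lt_le_trans v0_gt0 (le_trans h1 h2).
Qed.

Let qn y : 0 <= quad y. Proof. exact: (quad_nonneg kap0 quad_ge). Qed.

(** The normalization [kap * delta ^+ 2 = 1] makes the quadratic form at least 1 outside the cube,
    where [theta] has already been cut off. *)
Lemma bubble_off e x : 0 < e -> ~ cball x0 delta x -> bubble H x0 t e x = 0.
Proof.
move=> e0 /negP; rewrite -ltNge distrC => h.
rewrite /bubble /theta ltNge (_ : 1 <= _) ?mulr0//= -kap_delta.
apply: (@le_trans _ _ (quad (x - x0))); last by rewrite lerDr ltW.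
apply: le_trans (quad_ge _); rewrite ler_wpM2l ?(ltW kap0)//.
by rewrite lerXn2r ?nnegrE// ltW.
Qed.

Lemma bubble_ge0 e x : 0 < e -> 0 <= bubble H x0 t e x.
Proof. by move=> e0; rewrite mulr_ge0 ?(ltW t0)// theta_ge0// ltr_wpDr. Qed.

Let sq_bound (en u C s : R) : en * u ^+ 2 <= C -> 0 <= C -> 0 < s -> s <= u -> en <= C / s ^+ 2.
Proof.
move=> h C0 s0 su; have u0 : 0 < u := lt_le_trans s0 su.
apply: (@le_trans _ _ (C / u ^+ 2)); first by rewrite ler_pdivlMr// exprn_gt0.
by rewrite ler_wpM2l// lef_pV2 ?posrE ?exprn_gt0// lerXn2r// nnegrE ltW.
Qed.

(** Three zones for m = |x - x0|. If m <= r / 2^N, only u >= e is used, for a crude bound of order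
    (r / 2^N)^(-4). If r / 2^N < m <= r, the choice of e gives e <= d u, so the density is negative
    of order m^(-4). Beyond [r] it is bounded independently of [N]. *)
Lemma energy_bubble_step : exists a b c d r,
  [/\ 0 <= a, 0 < c, 0 < d <= 1, 0 < r <= delta & forall N x, cball x0 delta x ->
    energy g1 g2 g3 G (bubble H x0 t (d * kap * (r / 2 ^+ N) ^+ 2)) x * vol x <=
    a + (if `|x - x0| <= r / 2 ^+ N then b * (r / 2 ^+ N) ^- 4 else 0)
      - c * \sum_(k < N) (if `|x - x0| <= r / 2 ^+ k then (r / 2 ^+ k) ^- 4 else 0)].
Proof.
have [C C0 hC] := energy_bubble_le t g1 g2 g3 oU sG pG KU symH kap0 quad_ge.
have [d' [cc [d'0 cc0 hcc]]] :=
  energy_bubble_neg g1 oU sG pG delta0 KU symH kap0 quad_ge lam0 t0 neg.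
pose d := Num.min d' 1; pose r := Num.min d delta.
have d0 : 0 < d by rewrite lt_min d'0 ltr01.
have d1 : d <= 1 by rewrite ge_min lexx orbT.
have dd' : d <= d' by rewrite ge_min lexx.
have r0 : 0 < r by rewrite lt_min d0.
have rd : r <= d by rewrite ge_min lexx.
have rdelta : r <= delta by rewrite ge_min lexx orbT.
pose B := d * kap + linC G x0 lam.
have l0 : 0 <= linC G x0 lam by apply: sumr_ge0 => a _; apply: sumr_ge0.
have dk0 : 0 < d * kap by rewrite mulr_gt0.
have B0 : 0 < B by rewrite ltr_pwDl.
(* [B] satisfies u <= B m^2 in the middle zone, and the factor 2 is the one of [dyadic_sum4]. *)
pose c := cc * v0 / (2 * B ^+ 2).
have c0 : 0 < c by rewrite divr_gt0// ?mulr_gt0// exprn_gt0.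
(* The extra [c] in the second constant makes up for the whole dyadic sum being subtracted on the
   innermost cube, where [dyadic_sum4_core] bounds it. *)
exists (C / (kap * r ^+ 2) ^+ 2 * v1), (C / (d * kap) ^+ 2 * v1 + c), c, d, r.
have a0 : 0 <= C / (kap * r ^+ 2) ^+ 2 * v1.
  by rewrite mulr_ge0 ?(ltW v1_gt0)// divr_ge0// sqr_ge0.
split=> //; rewrite ?d0 ?r0// => N x Kx.
have /andP[vx0 vx1] := vol_bounds Kx.
have vx : 0 < vol x := lt_le_trans v0_gt0 vx0.
set rN := r / 2 ^+ N; set e := d * kap * rN ^+ 2; set m := `|x - x0|.
have rN0 : 0 < rN by rewrite divr_gt0// exprn_gt0.
have rNr : rN <= r by rewrite ler_pdivrMr ?exprn_gt0// ler_peMr ?(ltW r0)// exprn_ege1// ler1n.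
have e0 : 0 < e by rewrite mulr_gt0// exprn_gt0.
have e1 : e <= 1.
  rewrite -kap_delta /e -mulrA -[leRHS]mul1r; apply: ler_pM => //; first exact: ltW.
    by rewrite mulr_ge0 ?sqr_ge0// ltW.
  rewrite ler_wpM2l ?(ltW kap0)// lerXn2r ?nnegrE ?(ltW rN0) ?(ltW delta0)//.
  exact: le_trans rNr rdelta.
have := hC x e Kx; rewrite e0 e1 => /(_ isT).
have := hcc x e e0.
set en := energy _ _ _ _ _ _; set u := e + _ => hneg hup.
have qm : kap * m ^+ 2 <= quad (x - x0) := quad_ge _.
have ukm : kap * m ^+ 2 <= u by rewrite (le_trans qm)// /u lerDr ltW.
have [mN|mN] := leP m rN.
  have h1 : en <= C / e ^+ 2 by apply: sq_bound hup _ _ _ => //; rewrite lerDl.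
  have h2 : en * vol x <= C / e ^+ 2 * v1.
    apply: (@le_trans _ _ (C / e ^+ 2 * vol x)); first by rewrite ler_wpM2r// ltW.
    by rewrite ler_wpM2l// divr_ge0// sqr_ge0.
  have h3 : C / e ^+ 2 * v1 = C / (d * kap) ^+ 2 * v1 * rN ^- 4.
    rewrite /e; field; rewrite !gt_eqF//; exact: v1_gt0.
  have h4 : c * \sum_(k < N) (if m <= r / 2 ^+ k then (r / 2 ^+ k) ^- 4 else 0) <= c * rN ^- 4.
    by rewrite ler_wpM2l ?(ltW c0)//; exact: dyadic_sum4_core.
  rewrite (le_trans h2)// h3 mulrDl; lra.
have m0 : 0 < m := lt_trans rN0 mN.
rewrite addr0; have [mr|mr] := leP m r.
  have eu : e <= d' * u.
    apply: (@le_trans _ _ (d * u)); last first.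
      by rewrite ler_wpM2r// (le_trans _ ukm)// mulr_ge0 ?sqr_ge0// ltW.
    rewrite /e -mulrA ler_wpM2l ?(ltW d0)// (le_trans _ ukm)// ler_wpM2l ?(ltW kap0)//.
    by rewrite lerXn2r ?nnegrE ?(ltW m0) ?(ltW rN0)// ltW.
  have := hneg (le_trans mr (le_trans rd dd')) eu => hn.
  have uB : u <= B * m ^+ 2.
    rewrite /B mulrDl /u; apply: lerD; last exact: quad_le.
    by rewrite /e ler_wpM2l ?(ltW dk0)// lerXn2r ?nnegrE ?(ltW m0) ?(ltW rN0)// ltW.
  have u0 : 0 < u by apply: lt_le_trans ukm; rewrite mulr_gt0// exprn_gt0.
  have h1 : en <= - (cc / (B * m ^+ 2) ^+ 2).
    apply: (@le_trans _ _ (- cc / u ^+ 2)); first by rewrite ler_pdivlMr// exprn_gt0.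
    rewrite mulNr lerN2 ler_wpM2l ?(ltW cc0)// lef_pV2 ?posrE ?exprn_gt0// ?mulr_gt0 ?exprn_gt0//.
    by rewrite lerXn2r// nnegrE ltW// (lt_le_trans u0).
  have h2 : en * vol x <= - (cc / (B * m ^+ 2) ^+ 2) * v0.
    apply: (@le_trans _ _ (- (cc / (B * m ^+ 2) ^+ 2) * vol x)); first by rewrite ler_wpM2r// ltW.
    by rewrite ler_wnM2l// oppr_le0 divr_ge0 ?sqr_ge0// ltW.
  have h3 : - (cc / (B * m ^+ 2) ^+ 2) * v0 = - (c * (2 * m ^- 4)).
    by rewrite /c; field; rewrite !gt_eqF.
  have h4 : c * \sum_(k < N) (if m <= r / 2 ^+ k then (r / 2 ^+ k) ^- 4 else 0) <= c * (2 * m ^- 4).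
    by rewrite ler_wpM2l ?(ltW c0)//; exact: dyadic_sum4.
  rewrite (le_trans h2)// h3; lra.
rewrite big1 ?mulr0 ?subr0 => [|k _]; last first.
  rewrite leNgt (le_lt_trans _ mr)//.
  by rewrite ler_pdivrMr ?exprn_gt0// ler_peMr ?(ltW r0)// exprn_ege1// ler1n.
have h1 : en <= C / (kap * r ^+ 2) ^+ 2.
  apply: sq_bound hup _ _ _ => //; first by rewrite mulr_gt0// exprn_gt0.
  apply: le_trans ukm; rewrite ler_wpM2l ?(ltW kap0)//.
  by rewrite lerXn2r ?nnegrE ?(ltW m0) ?(ltW r0)// ltW.
apply: (@le_trans _ _ (C / (kap * r ^+ 2) ^+ 2 * vol x)); first by rewrite ler_wpM2r// ltW.
by rewrite ler_wpM2l// divr_ge0// sqr_ge0.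
Qed.

Lemma exp_bubble_step d r : 0 < d <= 1 -> 0 < r ->
  exists2 a, 0 <= a & forall N x, cball x0 delta x ->
    (expR (4 * bubble H x0 t (d * kap * (r / 2 ^+ N) ^+ 2) x) - 1) * vol x <=
    a * (r ^- 3 + \sum_(k < N) (if `|x - x0| <= r / 2 ^+ k then 8 * (r / 2 ^+ k) ^- 3 else 0)).
Proof.
(* With this [k0], v = k0 max(m, r / 2^N) satisfies v^2 <= u: on the inner cube thanks to the
   summand e, outside it thanks to the quadratic form and d <= 1. *)
move=> /andP[d0 d1] r0; pose k0 := Num.sqrt (d * kap).
have dk0 : 0 < d * kap by rewrite mulr_gt0.
have k00 : 0 < k0 by rewrite sqrtr_gt0.
have k2 : k0 ^+ 2 = d * kap by rewrite sqr_sqrtr// ltW.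
exists (v1 * k0 ^- 3); first by rewrite mulr_ge0 ?invr_ge0 ?exprn_ge0// ltW.
move=> N x Kx; have /andP[vx0 vx1] := vol_bounds Kx.
have vx : 0 < vol x := lt_le_trans v0_gt0 vx0.
set rN := r / 2 ^+ N; set m := `|x - x0|; set e := d * kap * rN ^+ 2.
have rN0 : 0 < rN by rewrite divr_gt0// exprn_gt0.
have e0 : 0 < e by rewrite mulr_gt0// exprn_gt0.
have M0 : 0 < Num.max m rN by rewrite lt_max rN0 orbT.
have h1 : expR (4 * bubble H x0 t e x) - 1 <= (k0 * Num.max m rN)^-1 ^+ 3.
  apply: expR_theta_le; [by rewrite (ltW t0)|by rewrite mulr_gt0|].
  rewrite exprMn k2; have [mN|mN] := leP m rN; first by rewrite lerDl.
  apply: (@le_trans _ _ (quad (x - x0))); last by rewrite lerDr ltW.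
  apply: le_trans (quad_ge _); rewrite -mulrA -[leRHS]mul1r ler_wpM2r//.
  by rewrite mulr_ge0 ?sqr_ge0// ltW.
have h2 := dyadic_sum3 m N r0.
have X0 : 0 <= (k0 * Num.max m rN)^-1 ^+ 3 by rewrite exprn_ge0// invr_ge0 mulr_ge0// ltW.
apply: (@le_trans _ _ ((k0 * Num.max m rN)^-1 ^+ 3 * v1)).
  apply: (@le_trans _ _ ((k0 * Num.max m rN)^-1 ^+ 3 * vol x)); first by rewrite ler_wpM2r// ltW.
  by rewrite ler_wpM2l.
rewrite exprVn exprMn invfM mulrC mulrA ler_wpM2l//.
by rewrite mulr_ge0 ?invr_ge0 ?exprn_ge0// ltW.
Qed.

End BubbleSteps.

(** * Unboundedness of the functionals *)

Section Unbounded.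
Context {R : realType} {M : topologicalType} (g : closed_riemannian4 R M).
Local Notation E4 := 'rV[R]_4.

Lemma indic_cball (x0 x : E4) (r : R) :
  \1_(cball x0 r) x = if `|x - x0| <= r then 1 else 0 :> R.
Proof.
rewrite indicE; case: ifPn => [h|/negP h]; first by rewrite mem_set// /cball /= distrC.
by rewrite memNset// /cball /= distrC.
Qed.

Lemma open_cball (U : set E4) x : open U -> U x ->
  exists2 r, 0 < r & cball x r `<=` U.
Proof.
move=> oU Ux; have : nbhs x U by exact: open_nbhs_nbhs.
rewrite -nbhs_nbhs_norm => -[d /= d0 hd]; exists (d / 2); first by rewrite divr_gt0.
move=> y hy; apply: hd; rewrite /ball_ /=; apply: le_lt_trans hy _; lra.
Qed.

(** The lower bound is an upper bound for 1 / f. *)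
Lemma positive_bounds (K : set E4) (f : E4 -> R) : compact K ->
  (forall x, K x -> {for x, continuous f}) -> (forall x, K x -> 0 < f x) ->
  exists2 v0, 0 < v0 & exists v1, forall x, K x -> v0 <= f x <= v1.
Proof.
move=> cK cf f0; have [v1 hv1] := cont_compact_bounded cK cf.
have cV x : K x -> {for x, continuous (fun y => (f y)^-1)}.
  by move=> Kx; apply: (continuousV _ (cf x Kx)); rewrite gt_eqF// f0.
have [v2 hv2] := cont_compact_bounded cK cV.
exists (`|v2| + 1)^-1; first by rewrite invr_gt0 ltr_wpDl.
exists v1 => x Kx; rewrite (le_trans (ler_norm _) (hv1 x Kx)) andbT.
rewrite -[leRHS]invrK lef_pV2 ?posrE ?ltr_wpDl ?invr_gt0 ?f0//.
apply: le_trans (ler_norm _) _; apply: le_trans (hv2 x Kx) _.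
by apply: le_trans (ler_norm _) _; rewrite lerDl.
Qed.

(** Here e is a constant times 4^(-N). Integrating the step bounds, each dyadic cube adds -16 c to
    the energy whatever its size, whereas its contributions to [excess] form a convergent geometric
    series, so [B] does not depend on [N]. *)
Lemma concentrating_bubbles (t g1 g2 g3 : R) : 0 < t -> t <= 3 / 8 ->
  g2 + 12 * g3 * (1 - t) ^+ 2 < 0 ->
  exists i0 : 'I_(nchart g), exists K : set E4, exists A B c : R,
    [/\ forall j : 'I_(nchart g), (j < i0)%N -> dom j = set0,
        compact K, K `<=` img i0, 0 < c &
        forall N : nat, exists psi : E4 -> R,
        [/\ C2_composable psi, forall x, ~ K x -> psi x = 0, forall x, 0 <= psi x,
            int4 (img i0) (fun x => energy g1 g2 g3 (met i0) psi x * vol_density (met i0) x)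
              <= A - c * N%:R & excess i0 psi <= B]].
Proof.
move=> t0 t38 neg; have [i0 [[p dp] min0]] := first_chart g.
set U := img i0; set G := met i0; set x0 := chart i0 p.
have Ux0 : U x0 by exists p.
have oU : open U by exact: img_open.
have sG a b : smooth_on U (fun x => G x a b) by exact: met_smooth.
have pG x : U x -> forall v : E4, v != 0 -> 0 < (v *m G x *m v^T) 0 0.
  by move=> Ux v v0; exact: met_pos.
have [delta delta0 KU] := open_cball oU Ux0.
set K := cball x0 delta in KU.
have cK : compact K by exact: cball_compact.
have [c0 c00 ell] := quad_elliptic (pG x0 Ux0).
(* Chosen so that [kap * delta ^+ 2 = 1]: the cut-off u = 1 is reached inside the cube of half-side
   [delta]. *)
pose lam := (c0 * delta ^+ 2)^-1; pose kap := lam * c0.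
have d20 : 0 < delta ^+ 2 by rewrite exprn_gt0.
have lam0 : 0 < lam by rewrite invr_gt0 mulr_gt0.
have kap0 : 0 < kap by rewrite mulr_gt0.
have kapd : kap * delta ^+ 2 = 1 by rewrite /kap /lam; field; rewrite !gt_eqF.
have symH : (lam *: G x0)^T = lam *: G x0 by rewrite linearZ/= met_sym.
have quad_ge y : kap * `|y| ^+ 2 <= qform (lam *: G x0) y.
  by rewrite quad_scale -mulrA ler_wpM2l// ltW.
have [v0 v00 [v1 vb]] : exists2 v0, 0 < v0 & exists v1, forall x, K x -> v0 <= vol_density G x <= v1.
  apply: positive_bounds => // x Kx; first exact: (cont_vol_density oU sG (KU x Kx)).
  exact: (vol_density_gt0 pG (KU x Kx)).
have [a [b [c [d [r [a0 cp dp1 /andP[r0 rd] hE]]]]]] :=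
  energy_bubble_step g1 oU sG pG delta0 KU symH kap0 quad_ge kapd t0 lam0 neg v00 vb.
have [a' a'0 hX] := exp_bubble_step delta0 kap0 quad_ge t0 t38 v00 vb dp1 r0.
have rk0 k : 0 < r / 2 ^+ k by rewrite divr_gt0// exprn_gt0.
have rkd k : r / 2 ^+ k <= delta.
  by rewrite (le_trans _ rd)// ler_pdivrMr ?exprn_gt0// ler_peMr ?(ltW r0)// exprn_ege1// ler1n.
(* A cube of half-side q has measure 16 q^4, whence 16 b and 16 c. In the second bound, 256 r is 8
   times 16 times the sum 2 r of the radii. *)
exists i0, K, (a * (2 * delta) ^+ 4 + 16 * b),
  (a' * (r ^- 3 * (2 * delta) ^+ 4 + 256 * r)), (16 * c).
split=> //; first by rewrite mulr_gt0.
move=> N; set e := d * kap * (r / 2 ^+ N) ^+ 2; pose psi := bubble (lam *: G x0) x0 t e.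
have e0 : 0 < e by move: dp1 => /andP[d0 _]; rewrite mulr_gt0 ?exprn_gt0// mulr_gt0.
have Cpsi : C2_composable psi by exact: (C2_bubble x0 (quad_nonneg kap0 quad_ge) t e0).
have psi0 x : ~ K x -> psi x = 0 by exact: (bubble_off t delta0 kap0 quad_ge kapd e0).
have psi_ge0 x : 0 <= psi x by exact: (bubble_ge0 kap0 quad_ge t0).
have off (s : seq (R * R)) x : (forall q, q \in s -> 0 <= q.2 <= delta) -> ~ K x ->
    \sum_(q <- s) q.1 * \1_(cball x0 q.2) x = 0.
  move=> sd nK; rewrite big_seq big1// => q /sd/andP[_ qd].
  rewrite indic_cball ifF ?mulr0//; apply/negP => h; apply: nK.
  by rewrite /K /cball /= distrC (le_trans h).
exists psi; split=> //.
- pose s := (a, delta) :: (b * (r / 2 ^+ N) ^- 4, r / 2 ^+ N) ::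
    [seq (- (c * (r / 2 ^+ k) ^- 4), r / 2 ^+ k) | k <- index_iota 0 N].
  have sd q : q \in s -> 0 <= q.2 <= delta.
    rewrite !inE => /orP[/eqP->|/orP[/eqP->|/mapP[k _ ->]]] /=.
    + by rewrite lexx ltW.
    + by rewrite rkd ltW.
    + by rewrite rkd ltW.
  have sE x : \sum_(q <- s) q.1 * \1_(cball x0 q.2) x =
      a * \1_K x + ((if `|x - x0| <= r / 2 ^+ N then b * (r / 2 ^+ N) ^- 4 else 0)
      - c * \sum_(k < N) (if `|x - x0| <= r / 2 ^+ k then (r / 2 ^+ k) ^- 4 else 0)).
    rewrite !big_cons big_map/= (indic_cball x0 x (r / 2 ^+ N)); congr (_ + (_ + _)).
      by case: ifP => _; rewrite ?mulr1 ?mulr0.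
    rewrite mulr_sumr -sumrN big_mkord; apply: eq_bigr => k _.
    by rewrite indic_cball; case: ifP => _; rewrite ?mulr1 ?mulr0 ?oppr0.
  have [Cen en0] := good_energy i0 Cpsi cK psi0 g1 g2 g3.
  have := @int4_step_le R U x0 delta oU KU s _ sd
    (good_integrable cK KU (conj Cen en0)).
  rewrite -/G -/U => h; apply: le_trans (h _) _ => [x Ux|].
    have [Kx|nK] := pselect (K x); last by rewrite off// en0// mul0r.
    by rewrite sE addrA indicE mem_set// mulr1; exact: hE.
  rewrite !big_cons big_map/= big_mkord.
  rewrite (eq_bigr (fun=> - (16 * c))) => [|k _]; last first.
    by move: (rk0 k); move: (r / 2 ^+ k) => q q0; field; rewrite gt_eqF.
  rewrite sumr_const card_ord -(mulr_natr (- (16 * c))).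
  have -> : b * (r / 2 ^+ N) ^- 4 * (2 * (r / 2 ^+ N)) ^+ 4 = 16 * b.
    by move: (rk0 N); move: (r / 2 ^+ N) => q q0; field; rewrite gt_eqF.
  by rewrite mulNr addrA.
- pose s := (a' * r ^- 3, delta) ::
    [seq (a' * (8 * (r / 2 ^+ k) ^- 3), r / 2 ^+ k) | k <- index_iota 0 N].
  have sd q : q \in s -> 0 <= q.2 <= delta.
    rewrite !inE => /orP[/eqP->|/mapP[k _ ->]] /=.
    + by rewrite lexx ltW.
    + by rewrite rkd ltW.
  have sE x : \sum_(q <- s) q.1 * \1_(cball x0 q.2) x =
      a' * (r ^- 3 * \1_K x + \sum_(k < N) (if `|x - x0| <= r / 2 ^+ k then 8 * (r / 2 ^+ k) ^- 3 else 0)).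
    rewrite !big_cons big_map/= mulrDr mulrA; congr (_ + _).
    rewrite mulr_sumr big_mkord; apply: eq_bigr => k _.
    by rewrite indic_cball; case: ifP => _; rewrite ?mulr1 ?mulr0.
  have := @int4_step_le R U x0 delta oU KU s _ sd (excess_integrable Cpsi cK KU psi0).
  rewrite -/G -/U => h; apply: le_trans (h _) _ => [x Ux|].
    have [Kx|nK] := pselect (K x); last by rewrite off// psi0// mulr0 expR0 subrr mul0r.
    by rewrite sE indicE mem_set// mulr1; exact: hX.
  rewrite !big_cons big_map/= big_mkord.
  rewrite (eq_bigr (fun k : 'I_N => a' * 128 * (r / 2 ^+ k))) => [|k _]; last first.
    by move: (rk0 k); move: (r / 2 ^+ k) => q q0; field; rewrite gt_eqF.
  rewrite -mulr_sumr [leRHS]mulrDr; apply: lerD; first by rewrite [leRHS]mulrA.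
  rewrite -mulrA ler_wpM2l//.
  have := dyadic_sum1 N r0; lra.
Qed.

(** The coefficient [kq] of the logarithmic term has no prescribed sign; two-sided bounds on the
    logarithmic mean, uniform in [N], keep this term bounded while the energy decreases linearly in
    [N]. *)
Lemma Ffun_unbounded_below (t g1 g2 g3 m : R) : 0 < t -> t <= 3 / 8 ->
  g2 + 12 * g3 * (1 - t) ^+ 2 < 0 ->
  exists2 w, W22 g w & Ffun g g1 g2 g3 w < m.
Proof.
move=> t0 t38 neg.
have [i0 [K [A [B [c [min0 cK KU c0 hpsi]]]]]] := concentrating_bubbles g1 t0 t38 neg.
set kq := g1 * intM (@W2 R M g) + g2 * intM (@Q R M g).
pose L := ln (1 + (Vol g)^-1 * B).
pose N := Num.bound `|(A + `|kq| * L - m) / c|.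
have [psi [Cpsi psi0 psi_ge0 en ex]] := hpsi N.
exists (transplant i0 psi); first exact: (transplant_W22 Cpsi cK KU psi0).
rewrite (Ffun_transplant min0 Cpsi cK KU psi0) -/kq.
have /andP[l0 lL] := log_mean_exp4_bounds min0 Cpsi cK KU psi0 psi_ge0 ex.
have h1 : - (kq * log_mean_exp4 g (transplant i0 psi)) <= `|kq| * L.
  rewrite -mulNr; apply: le_trans (ler_norm _) _.
  by rewrite normrM normrN ler_wpM2l// ger0_norm.
have h2 : A + `|kq| * L - m < c * N%:R.
  rewrite [ltRHS]mulrC -ltr_pdivrMr//; apply: le_lt_trans (ler_norm _) _.
  exact: archi_boundP (normr_ge0 _).
by apply: le_lt_trans (lerD en h1) _; lra.
Qed.

Lemma FfunN (g1 g2 g3 : R) w : Ffun g (- g1) (- g2) (- g3) w = - Ffun g g1 g2 g3 w.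
Proof. by rewrite /Ffun !mulNr !opprD. Qed.

(** The functional is linear in its weights, so this is the lower statement for the opposite
    weights. *)
Lemma Ffun_unbounded_above (t g1 g2 g3 m : R) : 0 < t -> t <= 3 / 8 ->
  0 < g2 + 12 * g3 * (1 - t) ^+ 2 ->
  exists2 w, W22 g w & m < Ffun g g1 g2 g3 w.
Proof.
move=> t0 t38 pos.
have [|w Ww] := @Ffun_unbounded_below t (- g1) (- g2) (- g3) (- m) t0 t38.
  by rewrite mulrN mulNr -opprD oppr_lt0.
by rewrite FfunN ltrN2; exists w.
Qed.

End Unbounded.

Lemma ereal_inf_unbounded (R : realType) (T : Type) (A : set T) (f : T -> R) :
  (forall m, exists2 w, A w & f w < m) -> ereal_inf [set (f w)%:E | w in A] = -oo%E.
Proof.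
move=> h; have : forall m, (ereal_inf [set (f w)%:E | w in A] < m%:E)%E.
  move=> m; have [w Aw fw] := h m.
  by apply: (@le_lt_trans _ _ (f w)%:E); [apply: ereal_inf_lbound; exists w|rewrite lte_fin].
by case: ereal_inf => [r /(_ r)|/(_ 0)|//]; rewrite ?ltxx.
Qed.

Lemma ereal_sup_unbounded (R : realType) (T : Type) (A : set T) (f : T -> R) :
  (forall m, exists2 w, A w & m < f w) -> ereal_sup [set (f w)%:E | w in A] = +oo%E.
Proof.
move=> h; have : forall m, (m%:E < ereal_sup [set (f w)%:E | w in A])%E.
  move=> m; have [w Aw fw] := h m.
  by apply: (@lt_le_trans _ _ (f w)%:E); [rewrite lte_fin|apply: ereal_sup_ubound; exists w].
by case: ereal_sup => [r /(_ r)|//|/(_ 0)]; rewrite ?ltxx.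
Qed.

Theorem theorem1p2 (R : realType) (M : topologicalType)
    (g : closed_riemannian4 R M) :
  [/\ ereal_inf [set (F_P g w)%:E | w in W22 g] = -oo%E,
      ereal_sup [set (F_P g w)%:E | w in W22 g] = +oo%E,
      ereal_inf [set (F_tau g w)%:E | w in W22 g] = -oo%E
    & ereal_sup [set (F_tau g w)%:E | w in W22 g] = +oo%E].
Proof.
split; [apply: ereal_inf_unbounded|apply: ereal_sup_unbounded
       |apply: ereal_inf_unbounded|apply: ereal_sup_unbounded] => m.
(* For F_P the sign is that of 32 (1 - t)^2 - 14, equal to -3/2 at t = 3/8 and 21/2 at t = 1/8. For
   F_tau it is that of 464 (1 - t)^2 - 248, equal to -267/4 and 429/4. *)
- by apply: (@Ffun_unbounded_below _ _ _ (3 / 8)); lra.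
- by apply: (@Ffun_unbounded_above _ _ _ (1 / 8)); lra.
- by apply: (@Ffun_unbounded_below _ _ _ (3 / 8)); lra.
- by apply: (@Ffun_unbounded_above _ _ _ (1 / 8)); lra.
Qed.
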